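(* Let $M$ be a closed oriented surface immersed in the group $\widetilde{SL}_2$, with generating spinor $\psi=(\psi_1,\psi_2)^{\top}$ and mean curvature $H$. Then its energy $E(M)$ is real-valued and equals $$E(M)=\int_M\left[\frac{H^2}4\left(|\psi_1|^2+|\psi_2|^2\right)^2-\left(\frac12|\psi_1|^2-\frac34|\psi_2|^2\right)\left(\frac34|\psi_1|^2-\frac12|\psi_2|^2\right)\right]\frac{i\,dz\wedge d\bar z}2 .$$
   Context: $\widetilde{SL}_2$ is the universal covering group of $SL(2,\mathbb{R})$, whose Lie algebra is realized (as $\mathfrak{su}(1,1)$) with basis $f_1=\begin{pmatrix}0&1\\1&0\end{pmatrix}$, $f_2=\begin{pmatrix}0&i\\-i&0\end{pmatrix}$, $f_3=\begin{pmatrix}i/2&0\\0&-i/2\end{pmatrix}$. The left-invariant metric is the one with $\langle f_j,f_k\rangle=4\delta_{jk}$, so that $e_j=\frac12f_j$ is an orthonormal basis, taken positively oriented; it satisfies $[e_1,e_2]=-2e_3$, $[e_1,e_3]=-\frac12e_2$, $[e_2,e_3]=\frac12e_1$. $\nabla$ is the Levi-Civita connection. Let $f:M\to\widetilde{SL}_2$ be the immersion, $z=x+iy$ a local conformal parameter compatible with the orientation, and $e^{2\alpha}dz\,d\bar z$ the induced metric. Write $f^{-1}f_z=\sum_{k=1}^3Z_ke_k$ (left translation to the Lie algebra). The generating spinor $\psi$ (defined locally up to a common sign) is a smooth function with $$Z_1=\tfrac i2(\bar\psi_2^2+\psi_1^2),\quad Z_2=\tfrac12(\bar\psi_2^2-\psi_1^2),\quad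 Z_3=\psi_1\bar\psi_2,$$ so $e^\alpha=|\psi_1|^2+|\psi_2|^2$. The unit normal $N$ is given by $$f^{-1}(N)=2ie^{-2\alpha}\left[(\bar Z_2Z_3-Z_2\bar Z_3)e_1+(\bar Z_3Z_1-Z_3\bar Z_1)e_2+(\bar Z_1Z_2-Z_1\bar Z_2)e_3\right]$$ and the mean curvature $H$ by $\nabla_{f_{\bar z}}f_z=\frac12e^{2\alpha}HN$. The spinor satisfies $\bar\partial\psi_1=V\psi_2$, $\partial\psi_2=-U\psi_1$ with potentials $$U=\frac H2\left(|\psi_1|^2+|\psi_2|^2\right)+i\left(\frac12|\psi_1|^2-\frac34|\psi_2|^2\right),\quad V=\frac H2\left(|\psi_1|^2+|\psi_2|^2\right)+i\left(\frac34|\psi_1|^2-\frac12|\psi_2|^2\right).$$ The form $UV\,dz\wedge d\bar z$ is a globally well-defined $2$-form on $M$, and the energy is $$E(M)=\int_MUV\,\frac{i\,dz\wedge d\bar z}2 .$$ *)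

(* Defs.v *)
From HB Require Import structures.
From mathcomp Require Import all_boot all_order all_algebra.
From mathcomp Require Import complex ring lra.
From mathcomp Require Import all_classical all_reals all_analysis.
Import Order.TTheory GRing.Theory Num.Theory numFieldNormedType.Exports.

Set Implicit Arguments.
Unset Strict Implicit.
Unset Printing Implicit Defensive.

Local Open Scope classical_set_scope.
Local Open Scope complex_scope.
Local Open Scope ring_scope.

Notation plane R := (R * R)%type.

Section Plane.
Variable R : realType.

Definition vx : plane R := (1, 0).
Definition vy : plane R := (0, 1).

Fixpoint Ck_on (k : nat) (U : set (plane R)) (g : plane R -> R) : Prop :=
  if k is k'.+1 then
    [/\ forall p, U p -> derivable g p vx /\ derivable g p vy,
        Ck_on k' U ('D_vx g) & Ck_on k' U ('D_vy g)]
  else forall p, U p -> {for p, continuous g}.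

(* C^infinity on an open set [U]; values of [g] outside [U] are irrelevant. *)
Definition smooth_on (U : set (plane R)) (g : plane R -> R) : Prop :=
  forall k, Ck_on k U g.

Definition csmooth_on (U : set (plane R)) (g : plane R -> R[i]) : Prop :=
  smooth_on U (fun p => complex.Re (g p)) /\
  smooth_on U (fun p => complex.Im (g p)).

Definition cderive (v : plane R) (g : plane R -> R[i]) (p : plane R) : R[i] :=
  'D_v (fun q => complex.Re (g q)) p +i* 'D_v (fun q => complex.Im (g q)) p.

Definition d_z (g : plane R -> R[i]) (p : plane R) : R[i] :=
  2^-1 * (cderive vx g p - 'i * cderive vy g p).

Definition d_zbar (g : plane R -> R[i]) (p : plane R) : R[i] :=
  2^-1 * (cderive vx g p + 'i * cderive vy g p).

Definition absq (w : R[i]) : R := complex.Re w ^+ 2 + complex.Im w ^+ 2.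

End Plane.
Arguments vx {R}.
Arguments vy {R}.

(* The universal covering group of SL(2,R) = SU(1,1).  A matrix of SU(1,1) is
   [[a, b], [b^*, a^*]] with |a|^2 = 1 + |b|^2; an element of the covering group
   is such a matrix together with a choice of t = arg a, and is thus encoded by
   the pair (b, t), a global chart onto the simply connected C x R.  The covering
   homomorphism onto SU(1,1) is [cover] below. *)
Section UniversalCover.
Variable R : realType.
Local Notation C := (R[i]).

Definition SL2t : Type := (R[i] * R)%type.
HB.instance Definition _ := Choice.copy SL2t (R[i] * R)%type.

Definition offdiag (x : SL2t) : C := x.1.
Definition angle (x : SL2t) : R := x.2.

Definition expi (t : R) : C := cos t +i* sin t.

Definition diag (x : SL2t) : C :=
  (Num.sqrt (1 + absq (offdiag x)))%:C * expi (angle x).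

(* The argument in ]-pi/2, pi/2[ of a number with positive real part. *)
Definition rarg (w : C) : R := atan (complex.Im w / complex.Re w).

(* The diagonal entry of the product matrix is [diag x * diag y * pert x y]. *)
Definition pert (x y : SL2t) : C :=
  1 + offdiag x * (offdiag y)^*%C / (diag x * diag y).

Definition SL2t_mul (x y : SL2t) : SL2t :=
  (diag x * offdiag y + offdiag x * (diag y)^*%C,
   angle x + angle y + rarg (pert x y)).
Definition SL2t_one : SL2t := (0, 0).
Definition SL2t_inv (x : SL2t) : SL2t := (- offdiag x, - angle x).

Let absq_ge0 (w : C) : 0 <= absq w.
Proof. by apply: addr_ge0; exact: sqr_ge0. Qed.

Let absqM (v w : C) : absq (v * w) = absq v * absq w.
Proof. by case: v => a b; case: w => c d; rewrite /absq /=; ring. Qed.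

Let absq_expi t : absq (expi t) = 1.
Proof. exact: cos2Dsin2. Qed.

Let absq_real (r : R) : absq r%:C = r ^+ 2.
Proof. by rewrite /absq /= expr0n addr0. Qed.

Let absq_diag x : absq (diag x) = 1 + absq (offdiag x).
Proof.
by rewrite /diag absqM absq_real absq_expi mulr1 sqr_sqrtr// addr_ge0.
Qed.

Let expiD s t : expi (s + t) = expi s * expi t.
Proof. by rewrite /expi cosD sinD; congr (_ +i* _); ring. Qed.

Let diag_neq0 x : diag x != 0.
Proof.
apply/eqP => d0; have := absq_diag x; have := absq_ge0 (offdiag x).
by rewrite d0 {2}/absq /= expr0n /= {d0} => *; lra.
Qed.

Let diag2_neq0 x y : diag x * diag y != 0.
Proof. by rewrite mulf_eq0 negb_or !diag_neq0. Qed.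

Let pertE x y : diag x * diag y * pert x y =
  diag x * diag y + offdiag x * (offdiag y)^*%C.
Proof.
by rewrite /pert mulrDr mulr1 [X in _ + X]mulrC divfK// diag2_neq0.
Qed.

Let conjD (v w : C) : (v + w)^*%C = v^*%C + w^*%C.
Proof. exact: rmorphD. Qed.

Let conjM (v w : C) : (v * w)^*%C = v^*%C * w^*%C.
Proof. exact: rmorphM. Qed.

Let absq_conj (w : C) : absq w^*%C = absq w.
Proof. by case: w => a b; rewrite /absq /= sqrrN. Qed.

Let Re_pert x y : 0 < complex.Re (pert x y).
Proof.
rewrite /pert; set q := _ / _.
have e : absq q * (absq (diag x) * absq (diag y)) =
         absq (offdiag x) * absq (offdiag y).
  by rewrite -!absqM /q (divfK (diag2_neq0 x y)) absqM absq_conj -absqM.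
move: e; rewrite !absq_diag.
have := absq_ge0 (offdiag x); have := absq_ge0 (offdiag y).
set u := absq (offdiag x); set v := absq (offdiag y) => v0 u0 e.
have q1 : absq q < 1.
  rewrite ltNge; apply/negP => q1.
  have uv : u * v < (1 + u) * (1 + v) by nra.
  have B0 : 0 <= (1 + u) * (1 + v) by rewrite mulr_ge0// addr_ge0.
  have := ler_wpM2r B0 q1; rewrite e mul1r => /le_lt_trans/(_ uv).
  by rewrite ltxx.
clearbody q; case: q q1 {e} => a b; rewrite /absq /= => q1; nra.
Qed.

Let polar (w : C) : 0 < complex.Re w -> w = (Num.sqrt (absq w))%:C * expi (rarg w).
Proof.
case: w => a b /= a0; rewrite /absq /expi /rarg /=.
set u := b / a.
have bE : b = u * a by rewrite /u divfK// gt_eqF.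
have s0 : 0 < 1 + u ^+ 2 by rewrite ltr_wpDr ?sqr_ge0.
have cE : cos (atan u) = (Num.sqrt (1 + u ^+ 2))^-1 by rewrite cos_atan.
have c0 : cos (atan u) != 0 by rewrite cE invr_eq0 gt_eqF// sqrtr_gt0.
have sE : sin (atan u) = u * cos (atan u).
  by rewrite -{2}(atanK u) /tan divfK.
have rE : Num.sqrt (a ^+ 2 + b ^+ 2) = a * Num.sqrt (1 + u ^+ 2).
  have -> : a ^+ 2 + b ^+ 2 = a ^+ 2 * (1 + u ^+ 2) by rewrite bE; ring.
  by rewrite sqrtrM ?sqr_ge0// sqrtr_sqr gtr0_norm.
have r0 : Num.sqrt (1 + u ^+ 2) != 0 by rewrite gt_eqF// sqrtr_gt0.
rewrite sE cE rE bE; apply/eqP; rewrite eq_complex /=; apply/andP; split.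
  by apply/eqP; field.
by apply/eqP; field.
Qed.

Let absq_mul (a b c d : C) :
  absq a = 1 + absq b -> absq d = 1 + absq c ->
  1 + absq (a * c + b * d^*%C) = absq (a * d + b * c^*%C).
Proof.
case: a b c d => a1 a2 [b1 b2] [c1 c2] [d1 d2]; rewrite /absq /= => ea ed.
transitivity ((a1 ^+ 2 + a2 ^+ 2 - (b1 ^+ 2 + b2 ^+ 2)) *
  (d1 ^+ 2 + d2 ^+ 2 - (c1 ^+ 2 + c2 ^+ 2)) +
  ((a1 * c1 - a2 * c2 + (b1 * d1 - b2 * - d2)) ^+ 2 +
   (a1 * c2 + a2 * c1 + (b1 * - d2 + b2 * d1)) ^+ 2)); last by ring.
by rewrite ea ed; ring.
Qed.

Lemma diag_mul x y : diag (SL2t_mul x y) =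
  diag x * diag y + offdiag x * (offdiag y)^*%C.
Proof.
have e : 1 + absq (offdiag (SL2t_mul x y)) = absq (diag x * diag y * pert x y).
  by rewrite pertE; apply: absq_mul; exact: absq_diag.
have dE z : diag z = (Num.sqrt (absq (diag z)))%:C * expi (angle z).
  by rewrite absq_diag.
rewrite -pertE [LHS]/diag {}e /angle /= !expiD.
move: (pert x y) (Re_pert x y) => p p0.
rewrite [in RHS](dE x) [in RHS](dE y) [in RHS](polar p0) !absqM.
by rewrite !sqrtrM ?mulr_ge0 ?absq_ge0// !rmorphM /= /angle; ring.
Qed.

Lemma offdiag_mul x y : offdiag (SL2t_mul x y) =
  diag x * offdiag y + offdiag x * (diag y)^*%C.
Proof. by []. Qed.

Let cos_eq1 (d : R) : `|d| < pi *+ 2 -> cos d = 1 -> d = 0.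
Proof.
move=> lt d1; have h : d = (d / 2) *+ 2 by rewrite mulr2n -splitr.
have sd : sin (d / 2) = 0.
  move: d1; rewrite {1}h cos_mulr2n => d1; have := cos2Dsin2 (d / 2).
  by move=> c2; apply/eqP; rewrite -sqrf_eq0; apply/eqP; lra.
move: lt; rewrite mulr2n ltr_norml => /andP[l1 l2].
case: (ltgtP d 0) => // d0.
  have : 0 < sin (- (d / 2)) by apply: sin_gt0_pi; apply/andP; split; lra.
  by rewrite sinN sd oppr0 ltxx.
have : 0 < sin (d / 2) by apply: sin_gt0_pi; apply/andP; split; lra.
by rewrite sd ltxx.
Qed.

Let expiDint t (k : int) : expi (t + k%:~R * (pi *+ 2)) = expi t.
Proof.
have nat_case s n : expi (s + n%:R * (pi *+ 2)) = expi s.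
  by rewrite mulr_natl /expi (periodicn (@cosD2pi R)) (periodicn (@sinD2pi R)).
case: k => n; first exact: nat_case.
by rewrite -[RHS](nat_case _ n.+1) NegzE mulrNz mulNr -(nat_case (_ - _) n.+1) subrK.
Qed.

Let SL2t_eq x y : offdiag x = offdiag y -> diag x = diag y ->
  `|angle x - angle y| < pi *+ 2 -> x = y.
Proof.
case: x => b s; case: y => c t; rewrite /diag /offdiag /angle /= => <-.
have n0 : (Num.sqrt (1 + absq b))%:C != 0.
  rewrite eq_complex /= eqxx andbT gt_eqF// sqrtr_gt0.
  by have := absq_ge0 b; lra.
move=> /(mulfI n0) [ec es] lt; congr (_, _); apply/subr0_eq.
by apply: cos_eq1 => //; rewrite cosB ec es -!expr2 cos2Dsin2.
Qed.

Let SL2t_mulA : associative SL2t_mul.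
Proof.
move=> x y z; apply: SL2t_eq.
- rewrite !(offdiag_mul, diag_mul).
  move: (diag x) (diag y) (diag z) => a b c.
  by rewrite conjD !conjM conjcK; ring.
- rewrite !(offdiag_mul, diag_mul).
  move: (diag x) (diag y) (diag z) => a b c.
  by rewrite conjD !conjM conjcK; ring.
rewrite /angle /= /rarg ltr_norml mulr2n.
set a1 := atan _; set a2 := atan _; set a3 := atan _; set a4 := atan _.
have b1 : - (pi / 2) < a1 < pi / 2 by rewrite atan_gtNpi2 atan_ltpi2.
have b2 : - (pi / 2) < a2 < pi / 2 by rewrite atan_gtNpi2 atan_ltpi2.
have b3 : - (pi / 2) < a3 < pi / 2 by rewrite atan_gtNpi2 atan_ltpi2.
have b4 : - (pi / 2) < a4 < pi / 2 by rewrite atan_gtNpi2 atan_ltpi2.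
move: b1 b2 b3 b4 => /andP[? ?] /andP[? ?] /andP[? ?] /andP[? ?].
by apply/andP; split; lra.
Qed.

Let diag_one : diag SL2t_one = 1.
Proof.
rewrite /diag /absq /offdiag /angle /= expr0n !addr0 sqrtr1 /expi cos0 sin0.
by rewrite mulr1.
Qed.

Let diag_inv x : diag (SL2t_inv x) = (diag x)^*%C.
Proof.
rewrite /diag conjM conjc_real; congr (_%:C * _); last first.
  by rewrite /expi cosN sinN.
by rewrite /absq /offdiag; case: x => -[a b] t /=; rewrite !sqrrN.
Qed.

Let rarg_real (r : R) : rarg r%:C = 0.
Proof. by rewrite /rarg /= mul0r atan0. Qed.

Let SL2t_mul1g : left_id SL2t_one SL2t_mul.
Proof.
case=> b t; rewrite /SL2t_mul /pert diag_one /offdiag /angle.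
by rewrite !mul0r !addr0 (rarg_real 1) mul1r add0r addr0.
Qed.

Let SL2t_mulg1 : right_id SL2t_one SL2t_mul.
Proof.
case=> b t; rewrite /SL2t_mul /pert diag_one /offdiag /angle.
by rewrite conjc0 conjc1 !mulr0 mul0r !addr0 (rarg_real 1) mulr1 add0r addr0.
Qed.

Let mul_conj (w : C) : w * w^*%C = (absq w)%:C.
Proof.
by case: w => a b; apply/eqP; rewrite eq_complex /absq /=; apply/andP; split;
  apply/eqP; ring.
Qed.

Let SL2t_mulVg : left_inverse SL2t_one SL2t_inv SL2t_mul.
Proof.
move=> x; rewrite /SL2t_mul /pert diag_inv.
have -> : offdiag (SL2t_inv x) = - offdiag x by [].
have -> : angle (SL2t_inv x) = - angle x by [].
rewrite !mulNr mul_conj [(diag x)^*%C * diag x]mulrC mul_conj.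
have -> : 1 - (absq (offdiag x))%:C / (absq (diag x))%:C =
          (1 - absq (offdiag x) / absq (diag x))%:C.
  by rewrite rmorphB rmorph1 fmorph_div.
by rewrite rarg_real addNr addr0 [_^*%C * _]mulrC subrr.
Qed.

Let SL2t_invK x : SL2t_inv (SL2t_inv x) = x.
Proof. by case: x => b t; rewrite /SL2t_inv /offdiag /angle /= !opprK. Qed.

Let SL2t_mulgV : right_inverse SL2t_one SL2t_inv SL2t_mul.
Proof. by move=> x; rewrite -{1}(SL2t_invK x) SL2t_mulVg. Qed.

HB.instance Definition _ := isGroup.Build SL2t
  SL2t_mulA SL2t_mul1g SL2t_mulg1 SL2t_mulVg SL2t_mulgV.

Definition mx2 (a b c d : C) : 'M[C]_2 := \matrix_(i, j)
  if i == 0 then (if j == 0 then a else b) else (if j == 0 then c else d).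

Definition cover (x : SL2t) : 'M[C]_2 :=
  mx2 (diag x) (offdiag x) (offdiag x)^*%C (diag x)^*%C.

Lemma mulmx2 (a b c d a' b' c' d' : C) : mx2 a b c d *m mx2 a' b' c' d' =
  mx2 (a * a' + b * c') (a * b' + b * d') (c * a' + d * c') (c * b' + d * d').
Proof.
apply/matrixP => i j; rewrite !mxE big_ord_recl big_ord1 !mxE /=.
by case: eqP => _; case: eqP.
Qed.

Lemma coverM (x y : SL2t) : cover (x * y)%g = cover x *m cover y.
Proof.
have -> : (x * y)%g = SL2t_mul x y by [].
rewrite /cover diag_mul offdiag_mul mulmx2 !conjD !conjM !conjcK.
by congr mx2; rewrite addrC.
Qed.

(* [cover] is onto SU(1,1), with infinite cyclic kernel. *)
Lemma cover_onto (a b : C) : absq a - absq b = 1 ->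
  exists x : SL2t, cover x = mx2 a b b^*%C a^*%C.
Proof.
move=> ab; have {}ab : absq a = 1 + absq b by lra.
have a1 : 1 <= absq a by have := absq_ge0 b; lra.
pose r := Num.sqrt (absq a).
have r0 : 0 < r by rewrite sqrtr_gt0; lra.
have rr : r ^+ 2 = absq a by rewrite sqr_sqrtr//; lra.
have [t ta] : exists t, a = r%:C * expi t.
  pose c := complex.Re a / r; pose s := complex.Im a / r.
  have cs : c ^+ 2 + s ^+ 2 = 1.
    by rewrite !expr_div_n -mulrDl rr -/(absq a) divff// gt_eqF// (lt_le_trans _ a1).
  have c1 : -1 <= c <= 1 by apply/andP; split; nra.
  have ac : a = r%:C * (c +i* s).
    apply/eqP; rewrite eq_complex /= !mul0r subr0 addr0 /c /s.
    by rewrite ![r * _]mulrC !(divfK (lt0r_neq0 r0)) !eqxx.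
  have ss : Num.sqrt (1 - c ^+ 2) = `|s|.
    by rewrite -sqrtr_sqr; congr Num.sqrt; lra.
  have [s0|s0] := leP 0 s.
    by exists (acos c); rewrite {1}ac /expi acosK// sin_acos// ss ger0_norm.
  exists (- acos c); rewrite {1}ac /expi cosN sinN acosK// sin_acos// ss.
  by rewrite ltr0_norm// opprK.
exists (b, t).
have dE : diag (b, t) = a by rewrite [RHS]ta /r ab.
by rewrite /cover dE.
Qed.

Lemma cover_ker (x : SL2t) : cover x = 1%:M <->
  exists k : int, x = (0, k%:~R * (pi *+ 2)).
Proof.
split=> [/matrixP cx|[k ->]].
  have /= := cx ord0 ord0; have /= := cx ord0 ord_max; rewrite !mxE /= => b0.
  rewrite /diag b0 /absq /= expr0n /= !addr0 sqrtr1 mul1r => -[c1 s0] {cx}.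
  have p0 : 0 < pi *+ 2 :> R by rewrite mulrn_wgt0// pi_gt0.
  pose k := Num.floor (angle x / (pi *+ 2)); exists k.
  have /andP[k1 k2] := floor_itv (angle x / (pi *+ 2)).
  move: k1 k2; rewrite -/k ler_pdivlMr// ltr_pdivrMr// intrD mulrDl mul1r.
  move=> k1 k2; case: x b0 c1 s0 k k1 k2 => b t /= -> c1 s0 k k1 k2.
  congr (_, _); apply/subr0_eq/cos_eq1.
    by rewrite /angle /= in k1 k2 *; rewrite ger0_norm; lra.
  by case: (expiDint t (- k)); rewrite mulrNz mulNr => ->.
have dE : diag (0, k%:~R * (pi *+ 2)) = 1.
  by rewrite -diag_one /diag /angle -[X in expi X]add0r expiDint.
have oE : offdiag (0, k%:~R * (pi *+ 2)) = 0 by [].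
rewrite /cover dE oE conjc0 conjc1.
by apply/matrixP => i j; rewrite !mxE; case: i j => -[|[|]]// ? [[|[|]]].
Qed.

End UniversalCover.

(* The Lie algebra su(1,1), inside its complexification of trace-free matrices;
   [coord A] are the (complex-linear) coordinates in the basis [e_]. *)
Section LieAlgebra.
Variable R : realType.
Local Notation C := (R[i]).

Definition triple (T : Type) (x y z : T) (k : 'I_3) : T :=
  match val k with 0%N => x | 1%N => y | _ => z end.

Definition f_ : 'I_3 -> 'M[C]_2 :=
  triple (mx2 0 1 1 0) (mx2 0 'i (- 'i) 0) (mx2 ('i / 2) 0 0 (- ('i / 2))).

Definition e_ (k : 'I_3) : 'M[C]_2 := 2^-1 *: f_ k.

Definition coord (A : 'M[C]_2) : 'I_3 -> C :=
  triple (A 0 1 + A 1 0) (- 'i * (A 0 1 - A 1 0)) (- (4 * 'i) * A 0 0).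

Definition metric (A B : 'M[C]_2) : C := \sum_k coord A k * coord B k.

Definition bracket (A B : 'M[C]_2) : 'M[C]_2 := A *m B - B *m A.

Definition bracket3 (j k l : 'I_3) : C := metric (bracket (e_ j) (e_ k)) (e_ l).

(* <nabla_{e_j} e_k, e_l> for the Levi-Civita connection, from Koszul's formula
   for left-invariant fields. *)
Definition Gamma (j k l : 'I_3) : C :=
  2^-1 * (bracket3 j k l - bracket3 k l j + bracket3 l j k).

Lemma metric_f j k : metric (f_ j) (f_ k) = if j == k then 4 else 0.
Proof.
rewrite /metric !big_ord_recl big_ord0 /coord.
by case: j => -[|[|[|//]]] ?; case: k => -[|[|[|//]]] ?;
  rewrite /f_ /triple /= !mxE /=; apply/eqP; rewrite eq_complex /=;
  apply/andP; split; apply/eqP; field.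
Qed.

Lemma coord_e (A : 'M[C]_2) : \tr A = 0 -> A = \sum_k coord A k *: e_ k.
Proof.
rewrite /mxtrace big_ord_recl big_ord1 => trA.
have {}trA : A 1 1 = - A 0 0.
  by apply/eqP; rewrite -addr_eq0 addrC; apply/eqP; rewrite -[RHS]trA;
    congr (_ + A _ _); apply/val_inj.
have I2 (u : 'I_2) : u = 0 \/ u = 1.
  by case: u => -[|[|//]] ?; [left|right]; apply/val_inj.
apply/matrixP => a b; rewrite !big_ord_recl big_ord0 addr0.
rewrite 6!mxE /e_ /f_ /coord /triple /=.
by case: (I2 a) => ->; case: (I2 b) => ->; rewrite !mxE /= ?trA;
  move: (A 0 0) (A 0 1) (A 1 0) => [a1 a2] [b1 b2] [c1 c2];
  apply/eqP; rewrite eq_complex /=; apply/andP; split; apply/eqP; field.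
Qed.

Lemma bracket_e :
  [/\ bracket (e_ 0) (e_ 1) = - 2 *: e_ 2,
      bracket (e_ 0) (e_ 2) = - 2^-1 *: e_ 1
    & bracket (e_ 1) (e_ 2) = 2^-1 *: e_ 0].
Proof.
by split; apply/matrixP => -[[|[|//]] ?] [[|[|//]] ?];
  rewrite /bracket /e_ /f_ /triple /= !(mxE, big_ord_recl, big_ord0) /=;
  apply/eqP; rewrite eq_complex /=; apply/andP; split; apply/eqP; field.
Qed.

Let bracket3C j k l : bracket3 j k l = - bracket3 k j l.
Proof.
have coordN (A : 'M[C]_2) n : coord (- A) n = - coord A n.
  by rewrite /coord /triple !mxE; case: (val n) => [|[|?]]; ring.
rewrite /bracket3 /bracket -opprB /metric -sumrN; apply: eq_bigr => n _.
by rewrite coordN mulNr.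
Qed.

Lemma Gamma_torsion_free j k l : Gamma j k l - Gamma k j l = bracket3 j k l.
Proof.
rewrite /Gamma (bracket3C k j) (bracket3C j l) (bracket3C l k).
by field.
Qed.

Lemma Gamma_metric j k l : Gamma j k l + Gamma j l k = 0.
Proof.
rewrite /Gamma (bracket3C k j) (bracket3C l k) (bracket3C l j).
by field.
Qed.

End LieAlgebra.

(* An oriented smooth surface, presented by an atlas of local parameters
   [param i : M -> R^2], meaningful on the open set [dom i]. *)
Record oriented_atlas (R : realType) (M : topologicalType) := OrientedAtlas {
  chart : Type;
  dom : chart -> set M;
  param : chart -> M -> plane R;
  iparam : chart -> plane R -> M;
  img := fun i => param i @` dom i;
  atlas_cover : \bigcup_i dom i = setT;
  dom_open : forall i, open (dom i);
  img_open : forall i, open (img i);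
  paramK : forall i m, dom i m -> iparam i (param i m) = m;
  param_continuous : forall i, {within dom i, continuous (param i)};
  iparam_continuous : forall i, {within img i, continuous (iparam i)};
  transition_smooth : forall i j,
    let U := param i @` (dom i `&` dom j) in
    smooth_on U (fun p => (param j (iparam i p)).1) /\
    smooth_on U (fun p => (param j (iparam i p)).2);
  transition_oriented : forall i j p, (param i @` (dom i `&` dom j)) p ->
    let u := fun q => (param j (iparam i q)).1 in
    let v := fun q => (param j (iparam i q)).2 in
    0 < 'D_vx u p * 'D_vy v p - 'D_vy u p * 'D_vx v p
}.

Section Immersion.
Variables (R : realType) (M : topologicalType) (A : oriented_atlas R M).
Local Notation C := (R[i]).

(* Smooth partition of unity subordinate to the atlas, indexed by a finite
   type as [M] is compact. *)
Record partition_of_unity (K : finType) := PartitionOfUnity {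
  pu_chart : K -> chart A;
  pu_fun : K -> M -> R;
  pu_smooth : forall k (i : chart A),
    smooth_on (img i) (fun p => pu_fun k (iparam i p));
  pu_ge0 : forall k m, 0 <= pu_fun k m;
  pu_support : forall k,
    closure [set m | pu_fun k m != 0] `<=` dom (pu_chart k);
  pu_sum1 : forall m, \sum_k pu_fun k m = 1
}.

(* Integral over [M] of the 2-form equal to [w i * dx /\ dy] in the chart [i];
   note that (i/2) dz /\ dzbar = dx /\ dy. *)
Definition form_integral (K : finType) (P : partition_of_unity K)
    (w : chart A -> plane R -> R) : R :=
  \sum_k \int[(lebesgue_measure \x lebesgue_measure)%E]_(p in img (pu_chart P k))
    (pu_fun P k (iparam (pu_chart P k) p) * w (pu_chart P k) p).

Definition cform_integral (K : finType) (P : partition_of_unity K)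
    (w : chart A -> plane R -> C) : C :=
  form_integral P (fun i p => complex.Re (w i p)) +i*
  form_integral P (fun i p => complex.Im (w i p)).

(* The smooth structure of the covering group is that of its global chart
   C x R. *)
Definition smooth_map (f : M -> SL2t R) : Prop := forall i : chart A,
  csmooth_on (img i) (fun p => offdiag (f (iparam i p))) /\
  smooth_on (img i) (fun p => angle (f (iparam i p))).

(* f^-1 df(v) and f^-1 f_z: [g q = f(p)^-1 * f(q)] has g(p) = 1, and its
   derivative at p is read in the Lie algebra through the covering map. *)
Definition left_deriv (f : plane R -> SL2t R) (v p : plane R) : 'M[C]_2 :=
  \matrix_(a, b) cderive v (fun q => cover ((f p)^-1 * f q)%g a b) p.

Definition left_d_z (f : plane R -> SL2t R) (p : plane R) : 'M[C]_2 :=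
  \matrix_(a, b) d_z (fun q => cover ((f p)^-1 * f q)%g a b) p.

(* All parameters of the atlas are conformal for [f], with induced metric
   e^(2 alpha) dz dzbar = e^(2 alpha) (dx^2 + dy^2); [f] is then an immersion. *)
Definition conformal_immersion (f : M -> SL2t R)
    (alpha : chart A -> plane R -> R) : Prop :=
  smooth_map f /\
  forall (i : chart A) p, img i p ->
    let X := left_deriv (fun q => f (iparam i q)) vx p in
    let Y := left_deriv (fun q => f (iparam i q)) vy p in
    [/\ metric X X = (expR (2 * alpha i p))%:C,
        metric Y Y = (expR (2 * alpha i p))%:C
      & metric X Y = 0].

(* Z_1, Z_2, Z_3 are at the indices 0, 1, 2 of 'I_3. *)
Definition Z_ (psi1 psi2 : plane R -> C) (p : plane R) : 'I_3 -> C :=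
  triple ('i / 2 * ((psi2 p)^*%C ^+ 2 + psi1 p ^+ 2))
         (2^-1 * ((psi2 p)^*%C ^+ 2 - psi1 p ^+ 2))
         (psi1 p * (psi2 p)^*%C).

(* One choice of the common sign of the spinor in each chart. *)
Definition generating_spinor (f : M -> SL2t R)
    (psi1 psi2 : chart A -> plane R -> C) : Prop :=
  forall i,
    [/\ csmooth_on (img i) (psi1 i), csmooth_on (img i) (psi2 i)
      & forall p, img i p -> left_d_z (fun q => f (iparam i q)) p =
                             \sum_k Z_ (psi1 i) (psi2 i) p k *: e_ R k].

(* Coordinates of f^-1(N), N the unit normal. *)
Definition normal (alpha : plane R -> R) (Z : plane R -> 'I_3 -> C)
    (p : plane R) (l : 'I_3) : C :=
  2 * 'i * (expR (- (2 * alpha p)))%:C *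
  triple ((Z p 1)^*%C * Z p 2 - Z p 1 * (Z p 2)^*%C)
         ((Z p 2)^*%C * Z p 0 - Z p 2 * (Z p 0)^*%C)
         ((Z p 0)^*%C * Z p 1 - Z p 0 * (Z p 1)^*%C) l.

(* Coordinates of f^-1(nabla_{f_zbar} f_z), where f_zbar = sum_j Z_j^* e_j. *)
Definition nabla_zbar_z (Z : plane R -> 'I_3 -> C) (p : plane R) (l : 'I_3) : C :=
  d_zbar (fun q => Z q l) p +
  \sum_j \sum_k (Z p j)^*%C * Z p k * Gamma R j k l.

Definition mean_curvature (alpha : chart A -> plane R -> R)
    (psi1 psi2 : chart A -> plane R -> C) (H : M -> R) : Prop :=
  forall i p l, img i p ->
    let Z := Z_ (psi1 i) (psi2 i) in
    nabla_zbar_z Z p l =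
    2^-1 * (expR (2 * alpha i p) * H (iparam i p))%:C * normal (alpha i) Z p l.

End Immersion.

Section Energy.
Variable R : realType.
Local Notation C := (R[i]).

Definition potential_U (H : R) (psi1 psi2 : C) : C :=
  (H / 2 * (absq psi1 + absq psi2))%:C +
  'i * (1 / 2 * absq psi1 - 3 / 4 * absq psi2)%:C.

Definition potential_V (H : R) (psi1 psi2 : C) : C :=
  (H / 2 * (absq psi1 + absq psi2))%:C +
  'i * (3 / 4 * absq psi1 - 1 / 2 * absq psi2)%:C.

Definition energy (M : topologicalType) (A : oriented_atlas R M) (K : finType)
    (P : partition_of_unity A K) (H : M -> R)
    (psi1 psi2 : chart A -> plane R -> C) : C :=
  cform_integral P (fun i p =>
    potential_U (H (iparam i p)) (psi1 i p) (psi2 i p) *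
    potential_V (H (iparam i p)) (psi1 i p) (psi2 i p)).

End Energy.

(* Main.v *)
(* The l = 2 component of the mean curvature equation says that the vector
   field W = (Re Z_3, - Im Z_3) of a chart, Z_3 = psi_1 psi_2^*, has divergence
   H (|psi_2|^4 - |psi_1|^4), which is - 8/5 times the imaginary part of U V.  As
   all charts are conformal, transitions are holomorphic and Re (Z_3 dz) is a
   global 1-form (half the third component of f^-1 df), whose conjugate eta has
   d eta = div W dx /\ dy.  So Im E(M) is a multiple of the integral of an exact
   2-form over a closed surface, and vanishes by Stokes: with a partition of
   unity rho_k, integration by parts in the chart of rho_k turns the integral into
   - sum_k int d rho_k /\ eta = - sum_j,k int rho_j d rho_k /\ eta,
   each term may be computed in the chart of rho_j instead by the change of
   variables formula, and sum_k d rho_k = 0.  That formula is proved by factoring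
   a plane diffeomorphism locally into maps which change one coordinate only. *)
Require Import Defs.
From HB Require Import structures.
From mathcomp Require Import all_boot all_order all_algebra.
From mathcomp Require Import complex ring lra.
From mathcomp Require Import all_classical all_reals all_analysis.
From mathcomp Require Import measurable_realfun.
Import Order.TTheory GRing.Theory Num.Theory numFieldNormedType.Exports.

Set Implicit Arguments.
Unset Strict Implicit.
Unset Printing Implicit Defensive.

Local Open Scope classical_set_scope.
Local Open Scope complex_scope.
Local Open Scope ring_scope.

(** * Change of variables in the plane *)

(** The divergence equation has a geometric origin. For a Killing field X, the tangential part of X
    along a surface has divergence 2 H <X, N>. The left-invariant field e_3 is Killing, and in a
    conformal chart its tangential part is 2 e^(-2 alpha) W, so that div W = H e^(2 alpha) <e_3, N>.
    This is proportional to the imaginary part of U V because U and V have the same real part, while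
    their imaginary parts add up to a multiple of |psi_1|^2 - |psi_2|^2, which is also the shape of
    <e_3, N>. The double sum over j and k is forced by supports: rho_k is compactly supported in its
    own chart only, whereas rho_j d rho_k vanishes off the overlap of two charts and can be carried
    from one to the other. In the change of variables, a map altering one coordinate reduces to
    Tonelli and substitution on the line. The factorization needs a positive partial derivative,
    which holds only near a point and after quarter turns; hence the local formulas and their
    gluing. *)

Section WeightedPushforward.
Context d1 d2 (X : measurableType d1) (Y : measurableType d2) (R : realType).
Variables (mu : {measure set X -> \bar R}) (phi : X -> Y) (w : X -> R).
Local Open Scope ereal_scope.

(** The image under [phi] of the measure with density [w]. The hypotheses are arguments so that the
    measure structure can be attached to the applied term. *)
Definition wpush of measurable_fun [set: X] phi & measurable_fun [set: X] w
  & (forall x, 0 <= w x)%R := fun A : set Y => \int[mu]_(x in phi @^-1` A) (w x)%:E.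

Hypotheses (mphi : measurable_fun [set: X] phi) (mw : measurable_fun [set: X] w).
Hypothesis w0 : (forall x, 0 <= w x)%R.
Local Notation nu := (wpush mphi mw w0).

Let mpre A : measurable A -> measurable (phi @^-1` A).
Proof. by move=> mA; rewrite -[X in measurable X]setTI; exact: mphi. Qed.

Let nu0 : nu set0 = 0.
Proof. by rewrite /wpush preimage_set0 integral_set0. Qed.

Let nu_ge0 A : 0 <= nu A.
Proof. by apply: integral_ge0 => x _; rewrite lee_fin. Qed.

Let nu_sigma_additive : semi_sigma_additive nu.
Proof.
move=> /= F mF tF mUF; rewrite /wpush; apply: cvg_toP.
  apply: ereal_nondecreasing_is_cvgn => m n mn.
  by apply: lee_sum_nneg_natr => // k _ _; apply: integral_ge0 => /= x _; rewrite lee_fin.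
rewrite preimage_bigcup ge0_integral_bigcup//=.
- by move=> k; exact: mpre.
- by apply/measurable_EFinP/measurable_funTS.
- by move=> x _; rewrite lee_fin.
- apply/trivIsetP => i j _ _ ij; rewrite -preimage_setI.
  by move/trivIsetP : tF => ->; rewrite ?preimage_set0.
Qed.

HB.instance Definition _ := isMeasure.Build _ _ _ nu nu0 nu_ge0 nu_sigma_additive.

Import HBNNSimple.

(** For indicators this is the definition of [wpush]; linearity gives simple functions and monotone
    convergence the rest. *)
Lemma ge0_integral_wpush (h : Y -> \bar R) : measurable_fun [set: Y] h ->
  (forall y, 0 <= h y) ->
  \int[nu]_y h y = \int[mu]_x (h (phi x) * (w x)%:E).
Proof.
move=> mh h0; have mT := @measurableT _ Y.
pose s := nnsfun_approx mT mh.
have mwE : measurable_fun [set: X] (EFin \o w) by exact/measurable_EFinP.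
have ms n : measurable_fun [set: X] (fun x => (s n (phi x))%:E).
  by apply/measurable_EFinP; apply: (measurableT_comp _ mphi).
transitivity (lim (\int[nu]_x (EFin \o s n) x @[n --> \oo])).
  have fE x : h x = lim ((EFin \o s n) x @[n --> \oo]).
    by apply/esym/cvg_lim => //; exact: cvg_nnsfun_approx.
  under eq_integral => x _ do rewrite fE.
  apply: monotone_convergence => //.
  - by move=> n; apply/measurable_EFinP; exact/measurable_funP.
  - by move=> n x _ //=; rewrite lee_fin.
  - by move=> x _ a b ab; rewrite lee_fin; exact/lefP/nd_nnsfun_approx.
transitivity (lim (\int[mu]_x ((EFin \o s n) (phi x) * (w x)%:E) @[n --> \oo])); last first.
  have fg x : h (phi x) * (w x)%:E = lim ((EFin \o s n) (phi x) * (w x)%:E @[n --> \oo]).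
    apply/esym/cvg_lim => //; apply: cvgeZr => //; exact: cvg_nnsfun_approx.
  apply/esym; under eq_integral => x _ do rewrite fg.
  apply: monotone_convergence => [//| | |].
  - by move=> n; apply: emeasurable_funM; [exact: ms|exact: mwE].
  - by move=> n x _ /=; rewrite mule_ge0 ?lee_fin.
  - by move=> x _ a b ab/=; rewrite lee_wpmul2r ?lee_fin//; exact/lefP/nd_nnsfun_approx.
suff suf n : \int[mu]_x ((EFin \o s n) (phi x) * (w x)%:E) = \int[nu]_x (EFin \o s n) x.
  by under [in RHS]eq_fun do rewrite suf.
transitivity (\int[nu]_x
   (\sum_(y \in range (s n)) (y * \1_(s n @^-1` [set y]) x)%:E)); last first.
  by apply: eq_integral => t tE; rewrite /= fimfunE -fsumEFin.
have indich m r : measurable_fun [set: Y] (fun x => (r * \1_(s m @^-1` [set r]) x)%:E).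
  by apply: (measurable_comp measurableT) => //; exact: measurable_funM.
rewrite ge0_integral_fsum//; last by move=> m y Ey; exact: nnfun_muleindic_ge0.
transitivity (\int[mu]_x (\sum_(y \in range (s n))
    (y * \1_(s n @^-1` [set y]) (phi x))%:E * (w x)%:E)).
  apply: eq_integral => x _.
  rewrite -ge0_mule_fsuml => [|y]; last exact: nnfun_muleindic_ge0.
  by rewrite fsumEFin // -(fimfunE _ (phi x)).
have indich' m r : measurable_fun [set: X] (fun x => (r * \1_(s m @^-1` [set r]) (phi x))%:E).
  by apply: (measurableT_comp (indich m r)).
rewrite ge0_integral_fsum//; last 2 first.
  - by move=> y; apply: emeasurable_funM.
  - by move=> m y Ey; rewrite mule_ge0 ?nnfun_muleindic_ge0 ?lee_fin.
apply: eq_fsbigr => r rhn.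
have r0 : (0 <= r)%R by move: rhn; rewrite inE => -[t _ <-].
under [RHS]eq_integral do rewrite EFinM.
rewrite integralZl_indic_nnsfun => //.
under eq_integral do rewrite EFinM -muleA.
rewrite ge0_integralZl//.
- rewrite integral_indic// setIT; congr (_ * _).
  transitivity (\int[mu]_(x in phi @^-1` (s n @^-1` [set r])) (w x)%:E); last by [].
  rewrite [RHS]integral_mkcond; apply: eq_integral => x _.
  rewrite patchE indicE; have -> : (x \in phi @^-1` (s n @^-1` [set r])) =
     (phi x \in s n @^-1` [set r]) by apply/idP/idP; rewrite !inE.
  by case: ifP; rewrite ?mul1e ?mul0e.
- apply: emeasurable_funM => //; apply/measurable_EFinP.
  by apply: (measurableT_comp _ mphi); exact: measurable_indic.
- by move=> t Et; rewrite mule_ge0 ?lee_fin.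
Qed.

End WeightedPushforward.

(** * Substitution on the line *)

Section Substitution.
Context (R : realType).
Local Notation mu := (@lebesgue_measure R).

(** Both sides integrate [h] against a measure: Lebesgue measure on the image interval, and the
    image under [u] of the density [du]. These agree on rays by the fundamental theorem of calculus,
    hence on all Borel sets, which covers every measurable [h] and not only continuous ones. *)
Lemma ge0_substitution_increasing (u du : R -> R) (a b : R) (h : R -> \bar R) :
  a < b -> (forall x, a <= x <= b -> is_derive x 1 u (du x)) ->
  (forall x, a <= x <= b -> {for x, continuous du}) ->
  (forall x, a <= x <= b -> 0 < du x) ->
  measurable_fun [set: R] h -> (forall y, (0 <= h y)%E) ->
  (\int[mu]_(y in `]u a, u b[) h y = \int[mu]_(x in `]a, b[) (h (u x) * (du x)%:E))%E.
Proof.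
move=> ab du_ cdu du0 mh h0.
have cu x : a <= x <= b -> {for x, continuous u}.
  move=> /du_ dux; apply/differentiable_continuous/derivable1_diffP.
  exact: ex_derive.
have cuab c d : a <= c -> d <= b -> {within `[c, d], continuous u}.
  move=> ac db; apply: continuous_in_subspaceT => x /[!inE]/=; rewrite in_itv /= => /andP[cx xd].
  by apply: cu; rewrite (le_trans ac cx) (le_trans xd db).
have u_lt x y : a <= x -> x < y -> y <= b -> u x < u y.
  apply: gtr0_derive1_incr.
  - move=> z; rewrite in_itv /= => /andP[az zb].
    have dz := du_ z; have {}dz := dz ltac:(by rewrite !ltW).
    exact: ex_derive.
  - move=> z; rewrite in_itv /= => /andP[az zb].
    have az' : a <= z <= b by rewrite !ltW.
    by have dz := du_ z az'; rewrite derive1E (@derive_val _ _ _ _ _ _ _ dz); apply: du0.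
  - exact: cuab.
have u_le x y : a <= x -> x <= y -> y <= b -> u x <= u y.
  by move=> ax; rewrite le_eqVlt => /orP[/eqP->//|xy] yb; apply/ltW/u_lt.
(* Clamping to [[a, b]] makes [ut] monotone on the whole line, hence measurable, and leaves [u]
   unchanged where the density [w] is nonzero. *)
pose cl x := Num.max a (Num.min b x).
have cl_in x : a <= cl x <= b.
  by rewrite /cl le_max lexx /= ge_max (ltW ab) ge_min lexx.
have clE x : a <= x <= b -> cl x = x.
  by move=> /andP[ax xb]; rewrite /cl min_r// max_r.
have cl_le x y : x <= y -> cl x <= cl y.
  move=> xy; rewrite /cl ge_max le_max lexx /= le_max.
  by rewrite le_min !ge_min lexx /= xy !orbT.
pose ut x := u (cl x).
have mut : measurable_fun [set: R] ut.
  apply: nondecreasing_measurable => // x y xy; apply: u_le.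
  - by have /andP[] := cl_in x.
  - exact: cl_le.
  - by have /andP[] := cl_in y.
pose w := du \_ `]a, b[%classic.
have mw : measurable_fun [set: R] w.
  apply/(measurable_restrictT du (measurable_itv `]a, b[)).
  apply: open_continuous_measurable_fun; first exact: interval_open.
  move=> x; rewrite inE /= in_itv /= => /andP[ax xb].
  by apply: cdu; rewrite !ltW.
have w0 x : 0 <= w x.
  rewrite /w patchE; case: ifPn => //; rewrite inE /= in_itv /= => /andP[ax xb].
  by apply/ltW/du0; rewrite !ltW.
pose J := `]u a, u b[%classic : set R.
have mJ : measurable J by exact: measurable_itv.
have mi : measurable_fun [set: R] (\1_J : R -> R) by exact: measurable_indic.
have i0 x : 0 <= (\1_J x : R) by rewrite indicE.
have mid : measurable_fun [set: R] (@id R) by exact: measurable_id.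
pose m1 := wpush mu mut mw w0 : set R -> \bar R.
pose m2 := wpush mu mid mi i0 : set R -> \bar R.
have uab : u a < u b by apply: u_lt.
have m12 c : m1 `]c, +oo[%classic = m2 `]c, +oo[%classic /\ (m1 `]c, +oo[%classic < +oo)%E.
  (* [g] is the point where [u] crosses the level [c], or an endpoint if [c] lies outside the range;
     both measures of the ray are then [u b - u g]. *)
  have [g /andP[ag gb] [ug gE]] : exists2 g, a <= g <= b &
      (u g = Num.max (u a) (Num.min (u b) c)) /\
      (forall x, a < x < b -> (c < u x) = (g < x)).
    have [cua|uac] := leP c (u a).
      exists a; first by rewrite lexx ltW.
      split; first by rewrite min_r ?max_l// (le_trans cua)// ltW.
      move=> x /andP[ax xb]; rewrite ax; apply: (le_lt_trans cua); apply: u_lt => //.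
      exact: ltW.
    have [ubc|cub] := leP (u b) c.
      exists b; first by rewrite lexx ltW.
      split; first by rewrite ?min_l// max_r// ltW.
      move=> x /andP[ax xb]; rewrite [RHS]ltNge (ltW xb) /=; apply/negbTE.
      by rewrite -leNgt (le_trans _ ubc)// u_le// ltW.
    have [g] := IVT (ltW ab) (cuab _ _ (lexx a) (lexx b))
      (v := c) ltac:(by rewrite ge_min le_max !(ltW uac, ltW cub) orbT).
    rewrite in_itv /= => /andP[ag gb] ugc; exists g; first by rewrite ag.
    split; first by rewrite ?min_r ?max_r// ltW.
    move=> x /andP[ax xb]; rewrite -ugc; apply/idP/idP => [|gx].
      by apply: contraTT; rewrite -!leNgt => xg; apply: u_le => //; apply: ltW.
    by apply: u_lt => //; exact: ltW.
  have m2E : m2 `]c, +oo[%classic = (u b - u g)%:E.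
    rewrite /m2 /wpush preimage_id.
    under eq_integral do rewrite -[X in (X)%:E]mul1r.
    transitivity (\int[mu]_(x in `]c, +oo[) (\1_J x)%:E)%E.
      by apply: eq_integral => x _; rewrite mul1r.
    rewrite integral_indic//.
    have -> : J `&` `]c, +oo[%classic = `]u g, u b[%classic.
      rewrite /J; apply/seteqP; split => x /=; rewrite !in_itv /= andbT ug gt_max gt_min.
        by move=> [/andP[-> ->] ->]; rewrite orbT.
      move=> /andP[/andP[ax]]; move=> /orP[xb xb'|cx xb].
        by move: xb'; rewrite ltNge (ltW xb).
      by rewrite ax.
    transitivity (lebesgue_measure (`]u g, u b[%classic : set R)); first by [].
    rewrite lebesgue_measure_itv /= lte_fin; case: ifPn => [//|].
    rewrite -leNgt => ubg; have /eqP : u b = u g.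
      by apply/eqP; rewrite eq_le ubg u_le.
    by rewrite -subr_eq0 => /eqP ->.
  rewrite m2E; suff -> : m1 `]c, +oo[%classic = (u b - u g)%:E by rewrite ltry.
  rewrite /m1 /wpush integral_mkcond.
  transitivity (\int[mu]_(x in `]g, b[) (du x)%:E)%E.
    rewrite [RHS]integral_mkcond; apply: eq_integral => x _.
    rewrite !patchE /w patchE.
    have -> : (x \in ut @^-1` `]c, +oo[%classic) = (c < ut x).
      by apply/idP/idP; rewrite inE /= in_itv /= andbT.
    have -> : (x \in `]a, b[%classic) = (a < x < b).
      by apply/idP/idP; rewrite inE /= in_itv.
    have -> : (x \in `]g, b[%classic) = (g < x < b).
      by apply/idP/idP; rewrite inE /= in_itv.
    have [axb|axb] := boolP (a < x < b).
      rewrite /ut clE; last by case/andP: axb => ? ?; rewrite !ltW.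
      by rewrite gE// (andP axb).2 andbT.
    rewrite if_same; case: ifPn => // /andP[gx xb].
    by rewrite xb (le_lt_trans ag gx) in axb.
  have [gb'|bg] := ltP g b; last first.
    have -> : g = b by apply/eqP; rewrite eq_le gb bg.
    by rewrite set_itvoo0 // integral_set0 subrr.
  have mdu : measurable_fun `]g, b[ (EFin \o du).
    apply/measurable_EFinP; apply: open_continuous_measurable_fun; first exact: interval_open.
    move=> x; rewrite inE /= in_itv /= => /andP[ax xb].
    by apply: cdu; rewrite !ltW // (le_lt_trans ag).
  rewrite -(integral_itv_bndoo true false)//.
  rewrite EFinB; apply: continuous_FTC2 => //.
  - apply: continuous_in_subspaceT => x /[!inE]/=; rewrite in_itv /= => /andP[gx xb].
    by apply: cdu; rewrite xb (le_trans ag).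
  - split.
    + move=> x; rewrite in_itv /= => /andP[gx xb].
      have xx : a <= x <= b by rewrite !ltW// (le_lt_trans ag).
      have dz := du_ _ xx; exact: ex_derive.
    + by apply: cvg_at_right_filter; apply: cu; rewrite ag.
    + by apply: cvg_at_left_filter; apply: cu; rewrite lexx ltW.
  - move=> x; rewrite in_itv /= => /andP[gx xb].
    have xx : a <= x <= b by rewrite !ltW// (le_lt_trans ag).
    by have dz := du_ x xx; rewrite derive1E (@derive_val _ _ _ _ _ _ _ dz).
transitivity (\int[wpush mu mid mi i0]_y h y)%E.
  rewrite ge0_integral_wpush// [LHS]integral_mkcond; apply: eq_integral => x _.
  by rewrite patchE indicE; case: ifP; rewrite ?mule1 ?mule0.
transitivity (\int[wpush mu mut mw w0]_y h y)%E.
  apply: eq_measure_integral => A mA _.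
  (* Rays are stable under intersection and generate the Borel sets; those starting at [- n] exhaust
     the line and have finite mass. *)
  apply: (measure_unique (@RGenOInfty.G R) (fun n => `](- n%:R), +oo[%classic)) => //.
  - exact: RGenOInfty.measurableE.
  - move=> _ _ [x ->] [y ->]; exists (Num.max x y).
    by apply/seteqP; split => z /=; rewrite !in_itv /= !andbT gt_max => /andP.
  - by move=> n; exists (- n%:R).
  - rewrite -subTset => x _; exists (Num.bound `|x|) => //=.
    rewrite in_itv /= andbT ltrNl (le_lt_trans (ler_norm _))// normrN.
    by apply: archi_boundP.
  - by move=> _ [c ->]; case: (m12 c).
  - move=> k; have [e l] := m12 (- k%:R); rewrite [ltLHS](_ : _ = m1 `]- k%:R, +oo[%classic) //.
rewrite ge0_integral_wpush// [RHS]integral_mkcond; apply: eq_integral => x _.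
rewrite patchE /w patchE; case: ifPn; rewrite ?mule0// inE /= in_itv /= => /andP[ax xb].
by rewrite /ut clE// !ltW.
Qed.

End Substitution.

(** * Measurability of open sets and continuous functions in the plane *)

Section PlaneMeasurability.
Context (R : realType).
Implicit Types (p q : plane R) (U : set (plane R)).

Definition open_box (a b c d : R) : set (plane R) := `]a, b[%classic `*` `]c, d[%classic.

Lemma open_boxP a b c d p :
  open_box a b c d p <-> (a < p.1 < b) /\ (c < p.2 < d).
Proof. by rewrite /open_box /setX /= !in_itv. Qed.

Lemma open_open_box a b c d : open (open_box a b c d).
Proof.
rewrite openE => p [/= p1 p2]; exists (`]a, b[%classic, `]c, d[%classic) => //.
by split; apply: open_nbhs_nbhs; split => //; exact: itv_open.
Qed.

(** Rational corners leave countably many boxes, as needed both for measurability of open sets and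
    for gluing local formulas. *)
Lemma nbhs_rat_box p U : nbhs p U -> exists2 q : rat * rat * (rat * rat),
  open_box (ratr q.1.1) (ratr q.1.2) (ratr q.2.1) (ratr q.2.2) p &
  open_box (ratr q.1.1) (ratr q.1.2) (ratr q.2.1) (ratr q.2.2) `<=` U.
Proof.
move=> /nbhs_ballP[e /= e0 eU].
have ratl (x : R) : exists q : rat, x - e < ratr q < x.
  have [q] := @rat_in_itvoo R (x - e) x ltac:(by rewrite gtrBl).
  by rewrite in_itv /= => h; exists q.
have ratr' (x : R) : exists q : rat, x < ratr q < x + e.
  have [q] := @rat_in_itvoo R x (x + e) ltac:(by rewrite ltrDl).
  by rewrite in_itv /= => h; exists q.
have [a /andP[a1 a2]] := ratl p.1; have [b /andP[b1 b2]] := ratr' p.1.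
have [c /andP[c1 c2]] := ratl p.2; have [d /andP[d1 d2]] := ratr' p.2.
exists ((a, b), (c, d)) => /=; first by apply/open_boxP; rewrite a2 b1 c2 d1.
move=> q /open_boxP [/andP[q1 q2] /andP[q3 q4]]; apply: eU.
split; rewrite /ball /= ltr_norml; apply/andP; split; lra.
Qed.

(** The sigma-algebra is the product one, so an open set is measurable as a countable union of
    rational boxes. *)
Lemma open_measurable_plane U : open U -> measurable U.
Proof.
move=> oU.
pose B (q : rat * rat * (rat * rat)) :=
  open_box (ratr q.1.1 : R) (ratr q.1.2) (ratr q.2.1) (ratr q.2.2).
have -> : U = \bigcup_q (if `[< B q `<=` U >] then B q else set0).
  apply/seteqP; split => [p Up|p [q _]].
    have [q Bp BU] := nbhs_rat_box (open_nbhs_nbhs (conj oU Up)).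
    by exists q => //; case: asboolP.
  by case: asboolP => // qU /qU.
apply: countable_bigcupT_measurable => [|q]; first exact: countableP.
case: asboolP => _; last exact: measurable0.
by apply: measurableX; exact: (measurable_itv `]_, _[).
Qed.

Lemma continuous_measurable_plane U (g : plane R -> R) : open U ->
  (forall p, U p -> {for p, continuous g}) -> measurable_fun U g.
Proof.
move=> oU cg; apply: (measurability (@RGenOInfty.G R)).
  exact: RGenOInfty.measurableE.
move=> _ [_ [x ->] <-]; apply: open_measurable_plane.
rewrite openE => p [Up /=]; rewrite in_itv /= andbT => xg.
have h1 := open_nbhs_nbhs (conj oU Up).
have h2 := cvgr_gt _ (cg p Up) _ xg.
suff : \forall q \near p, (U `&` g @^-1` `]x, +oo[%classic) q by [].
have {}h1 : \forall q \near p, U q by [].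
near=> q; split; first by near: q.
by rewrite /= in_itv /= andbT; near: q; exact: h2.
Unshelve. all: by end_near. Qed.

Lemma near_lt_continuous (T : topologicalType) (F G : T -> R) (t : T) :
  {for t, continuous F} -> {for t, continuous G} -> F t < G t ->
  \forall s \near t, F s < G s.
Proof.
move=> cF cG FG.
have c : {for t, continuous (fun s => G s - F s)} by apply: continuousB.
have := cvgr_gt _ c 0; rewrite subr_gt0 => /(_ _ FG).
by apply: filterS => s; rewrite subr_gt0.
Qed.

Lemma ge0_integral_plane (f : plane R -> \bar R) :
  measurable_fun [set: plane R] f -> (forall p, (0 <= f p)%E) ->
  (\int[(lebesgue_measure \x lebesgue_measure)%E]_p f p =
   \int[lebesgue_measure]_y \int[lebesgue_measure]_x f (x, y))%E.
Proof. by move=> mf f0; rewrite fubini_tonelli1// -fubini_tonelli. Qed.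

End PlaneMeasurability.

(** * Substitution in one coordinate of the plane *)

Section Primitive.
Context (R : realType).
Local Notation lam := (@lebesgue_measure R).
Local Notation lam2 := (lam \x lam)%E.
Implicit Types (p q : plane R).

(** The image of the box under [(u p, p.2)] when [u] increases in its first variable: the region
    between the graphs of [u (a, _)] and [u (b, _)]. *)
Definition slice_region (u : plane R -> R) (a b c d : R) : set (plane R) :=
  [set q | (c < q.2 < d) /\ (u (a, q.2) < q.1 < u (b, q.2))].

Variables (u ux X : plane R -> R) (a b c d : R).
Hypothesis ab : a < b.
Hypothesis dux : forall p, a <= p.1 <= b -> c < p.2 < d ->
  is_derive p.1 1 (fun x => u (x, p.2)) (ux p).
Hypothesis cu : forall p, a <= p.1 <= b -> c < p.2 < d -> {for p, continuous u}.
Hypothesis cux : forall p, a <= p.1 <= b -> c < p.2 < d -> {for p, continuous ux}.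
Hypothesis ux0 : forall p, a <= p.1 <= b -> c < p.2 < d -> 0 < ux p.
Hypothesis XK : forall p, open_box a b c d p -> X (u p, p.2) = p.1.

Let u_lt x x' y : c < y < d -> a <= x -> x < x' -> x' <= b -> u (x, y) < u (x', y).
Proof.
move=> yd; apply: (gtr0_derive1_incr (f := fun x => u (x, y))).
- move=> z; rewrite in_itv /= => /andP[az zb].
  have dz := dux (p := (z, y)) ltac:(by rewrite /= !ltW) yd; exact: ex_derive.
- move=> z; rewrite in_itv /= => /andP[az zb].
  have az' : a <= (z, y).1 <= b by rewrite /= !ltW.
  have dz := dux az' yd.
  by rewrite derive1E (@derive_val _ _ _ _ _ _ _ dz); apply: ux0.
- apply: continuous_in_subspaceT => x0 /[!inE]/=; rewrite in_itv /= => axb.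
  have dz := dux (p := (x0, y)) axb yd.
  apply/differentiable_continuous/derivable1_diffP; exact: ex_derive.
Qed.

Let cslice x q : a <= x <= b -> c < q.2 < d ->
  {for q, continuous (fun q' => u (x, q'.2))}.
Proof.
move=> xb qd; have h := cu (p := (x, q.2)) xb qd.
apply: (@continuous_comp _ _ _ (fun q' : plane R => (x, q'.2)) u) => //.
apply: (@cvg_pair _ _ _ _ (nbhs x) (nbhs q.2)); first exact: cvg_cst.
exact: cvg_snd.
Qed.

Let csnd q : {for q, continuous (fun q' : plane R => q'.2)}.
Proof. exact: cvg_snd. Qed.

Let cfst q : {for q, continuous (fun q' : plane R => q'.1)}.
Proof. exact: cvg_fst. Qed.

Let near_slab q : c < q.2 < d -> \forall q' \near q, c < (q' : plane R).2 < d.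
Proof.
move=> /andP[cq qd].
have h1 : \forall q' \near q, c < (q' : plane R).2.
  by apply: near_lt_continuous => //; exact: cvg_cst.
have h2 : \forall q' \near q, (q' : plane R).2 < d.
  by apply: near_lt_continuous => //; exact: cvg_cst.
by near=> q'; apply/andP; split; near: q'.
Unshelve. all: by end_near. Qed.

(** Arbitrary ends [x] and [x'] are allowed because the superlevel sets of the inverse [X] are
    regions whose left end has moved. *)
Lemma open_slice_region x x' : a <= x <= b -> a <= x' <= b ->
  open [set q | (c < q.2 < d) /\ (u (x, q.2) < q.1 < u (x', q.2))].
Proof.
move=> xb xb'; rewrite openE => q [qd /andP[q1 q2]].
have h := near_slab qd.
have h1 : \forall q' \near q, u (x, q'.2) < q'.1.
  by apply: near_lt_continuous => //; exact: cslice.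
have h2 : \forall q' \near q, q'.1 < u (x', q'.2).
  by apply: near_lt_continuous => //; exact: cslice.
suff : \forall q' \near q, (c < q'.2 < d) /\ (u (x, q'.2) < q'.1 < u (x', q'.2)) by [].
near=> q'; split; first by near: q'.
by apply/andP; split; near: q'.
Unshelve. all: by end_near. Qed.

Let ab_a : a <= a <= b. Proof. by rewrite lexx ltW. Qed.
Let ab_b : a <= b <= b. Proof. by rewrite lexx ltW. Qed.

Lemma slice_preim q : slice_region u a b c d q ->
  exists x, [/\ a < x < b, u (x, q.2) = q.1 & X q = x].
Proof.
move=> [qd /andP[q1 q2]].
have cw : {within `[a, b], continuous (fun x => u (x, q.2))}.
  apply: continuous_in_subspaceT => x0 /[!inE]/=; rewrite in_itv /= => axb.
  have dz := dux (p := (x0, q.2)) axb qd.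
  apply/differentiable_continuous/derivable1_diffP; exact: ex_derive.
have [x] := IVT (ltW ab) cw (v := q.1)
  ltac:(by rewrite ge_min le_max !(ltW q1, ltW q2) orbT).
rewrite in_itv /= => /andP[ax xb] uxq; exists x.
suff xab : a < x < b.
  split => //; rewrite -[RHS](XK (p := (x, q.2))); last by apply/open_boxP.
  by congr X; rewrite /= uxq; case: (q).
rewrite !lt_neqAle ax xb !andbT; apply/andP; split; apply/eqP => e.
  by rewrite -uxq -e ltxx in q1.
by rewrite -uxq e ltxx in q2.
Qed.

Lemma slice_image :
  (fun p => (u p, p.2)) @` open_box a b c d = slice_region u a b c d.
Proof.
apply/seteqP; split => [_ [p /open_boxP[/andP[ap pb] pd] <-]|q qs].
  by case: p ap pb pd => x y /= ap pb yd; split => //=; rewrite !u_lt// ltW.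
have [qd _] := qs; have [x [xab xq _]] := slice_preim qs.
exists (x, q.2); first by apply/open_boxP.
by case: q qs qd xq => /= ? ? _ _ ->.
Qed.

Lemma measurable_slice : measurable (slice_region u a b c d).
Proof. by apply: open_measurable_plane; exact: open_slice_region. Qed.

(** As [u] increases in its first variable, the set where [X] exceeds [t] is the open region between
    the graphs of [u (t, _)] and [u (b, _)]. Monotonicity thus replaces an inverse function
    theorem. *)
Lemma measurable_slice_inverse : measurable_fun (slice_region u a b c d) X.
Proof.
apply: (measurability (@RGenOInfty.G R)).
  exact: RGenOInfty.measurableE.
move=> _ [_ [t ->] <-].
have [ta|at_] := leP t a.
  rewrite (_ : _ `&` _ = slice_region u a b c d); first exact: measurable_slice.
  apply/seteqP; split => [q []//|q qs]; split => //=.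
  rewrite in_itv /= andbT; have [x [xab xq Xq]] := slice_preim qs.
  have [qd _] := qs; case/andP: (xab) => ax _.
  by rewrite Xq (le_lt_trans ta).
have [bt|tb] := leP b t.
  rewrite (_ : _ `&` _ = set0); first exact: measurable0.
  apply/seteqP; split => // q [qs] /=.
  rewrite in_itv /= andbT; have [x [xab xq Xq]] := slice_preim qs.
  have [qd _] := qs; case/andP: (xab) => _ xb.
  rewrite Xq.
  by move=> tx; have := lt_trans tx xb; rewrite ltNge bt.
have tab : a <= t <= b by rewrite !ltW.
rewrite (_ : _ `&` _ = [set q | (c < q.2 < d) /\ (u (t, q.2) < q.1 < u (b, q.2))]).
  by apply: open_measurable_plane; apply: open_slice_region.
apply/seteqP; split => [q [qs]|q [qd /andP[q1 q2]]] /=.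
  rewrite in_itv /= andbT; have [x [xab xq Xq]] := slice_preim qs.
  have [qd /andP[_ q2]] := qs.
  rewrite -xq Xq.
  by case/andP: xab => ax xb tx; split => //; rewrite !u_lt// ltW.
have qs : slice_region u a b c d q.
  by split => //; rewrite q2 (lt_trans _ q1) ?u_lt// ltW.
split => //; have [x [xab xq Xq]] := slice_preim qs.
rewrite in_itv /= andbT Xq.
rewrite ltNge; apply/negP => xt; rewrite -xq in q1.
case/andP: xab => ax xb.
move: xt; rewrite le_eqVlt => /orP[/eqP xt|xt]; first by rewrite xt ltxx in q1.
have := u_lt qd (ltW ax) xt (ltW tb).
by move=> /(lt_trans q1); rewrite ltxx.
Qed.

Lemma measurable_slice_comp (f : plane R -> \bar R) :
  measurable_fun [set: plane R] f ->
  measurable_fun (slice_region u a b c d) (fun q => f (X q, q.2)).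
Proof.
move=> mf; have mA := measurable_slice.
apply: (eq_measurable_fun (fun q => f ((X \_ (slice_region u a b c d)) q, q.2))).
  by move=> q qA; rewrite patchE qA.
apply: measurable_funTS; apply: (measurableT_comp mf).
apply: measurable_fun_pair; last exact: measurable_snd.
by apply/(measurable_restrictT _ mA); exact: measurable_slice_inverse.
Qed.

(** The map [(u p, p.2)] has Jacobian [ux] and preserves horizontal lines, so Tonelli reduces the
    claim to substitution on each line. *)
Lemma ge0_integral_primitive (f : plane R -> \bar R) :
  measurable_fun [set: plane R] f -> (forall p, (0 <= f p)%E) ->
  (\int[lam2]_(p in open_box a b c d) (f p * (ux p)%:E) =
   \int[lam2]_(q in slice_region u a b c d) f (X q, q.2))%E.
Proof.
move=> mf f0; set B := open_box a b c d; set A := slice_region u a b c d.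
have mB : measurable B by apply: open_measurable_plane; exact: open_open_box.
have mA : measurable A by exact: measurable_slice.
have mux : measurable_fun B ux.
  apply: continuous_measurable_plane; first exact: open_open_box.
  by move=> p /open_boxP[/andP[ap pb] pd]; apply: cux => //; rewrite !ltW.
pose F := (fun p => f p * (ux p)%:E)%E \_ B.
pose G := (fun q => f (X q, q.2)) \_ A.
have mF : measurable_fun [set: plane R] F.
  apply/(measurable_restrictT _ mB); apply: emeasurable_funM.
    exact: measurable_funTS.
  exact/measurable_EFinP.
have mG : measurable_fun [set: plane R] G.
  by apply/(measurable_restrictT _ mA); exact: measurable_slice_comp.
have F0 p : (0 <= F p)%E.
  rewrite /F patchE; case: ifPn => //; rewrite inE => /open_boxP[/andP[ap pb] pd].
  by rewrite mule_ge0// lee_fin ltW// ux0// !ltW.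
have G0 p : (0 <= G p)%E by rewrite /G patchE; case: ifPn.
rewrite integral_mkcond [RHS]integral_mkcond -/F -/G.
rewrite !ge0_integral_plane//; apply: eq_integral => y _.
have [yd|yd] := boolP (c < y < d); last first.
  rewrite !integral0_eq// => x _; rewrite /F /G patchE ifF//;
    apply/negP; rewrite inE.
    by move=> [/= h _]; rewrite h in yd.
  by move=> /open_boxP[_ /= h]; rewrite h in yd.
have mGy : measurable_fun [set: R] (fun x => G (x, y)) by exact: measurable_fun_pair1.
transitivity (\int[lam]_(x in `]a, b[) (G (u (x, y), y) * (ux (x, y))%:E))%E.
  rewrite [RHS]integral_mkcond; apply: eq_integral => x _.
  rewrite /F !patchE.
  have -> : ((x, y) \in B) = (x \in `]a, b[%classic).
    apply/idP/idP; rewrite !inE /= in_itv /=; first by case/open_boxP.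
    by move=> h; apply/open_boxP.
  case: ifPn => //; rewrite inE /= in_itv /= => xab.
  rewrite /G patchE; case: ifPn => [_|]; first by rewrite (XK (p := (x, y)))//; apply/open_boxP.
  move=> /negP[]; rewrite inE; split => //=.
  by case/andP: xab => ax xb; rewrite !u_lt// ltW.
have hd x : a <= x <= b -> is_derive x 1 (fun x => u (x, y)) (ux (x, y)).
  by move=> xab; exact: (dux (p := (x, y))).
have hc x : a <= x <= b -> {for x, continuous (fun x => ux (x, y))}.
  move=> xab; have h := cux (p := (x, y)) xab yd.
  apply: (@continuous_comp _ _ _ (fun x' : R => (x', y)) ux) => //.
  apply: (@cvg_pair _ _ _ _ (nbhs x) (nbhs y)); first exact: cvg_id.
  exact: cvg_cst.
have hp x : a <= x <= b -> 0 < ux (x, y) by move=> xab; exact: (ux0 (p := (x, y))).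
have := ge0_substitution_increasing ab hd hc hp mGy (fun x => G0 (x, y)).
move=> /= <-; rewrite integral_mkcond; apply: eq_integral => x _; rewrite patchE.
case: ifPn => //; rewrite notin_setE /= in_itv /= => h.
by rewrite /G patchE ifF//; apply/negP; rewrite inE => -[].
Qed.

End Primitive.

(** Strict monotonicity on each horizontal line makes the chosen preimage unique; where there is
    none, [X] takes the default value 0. *)
Lemma exists_slice_inverse (R : realType) (u ux : plane R -> R) (a b c d : R) :
  (forall p, a <= p.1 <= b -> c < p.2 < d ->
    is_derive p.1 1 (fun x => u (x, p.2)) (ux p)) ->
  (forall p, a <= p.1 <= b -> c < p.2 < d -> 0 < ux p) ->
  exists X : plane R -> R, forall p, open_box a b c d p -> X (u p, p.2) = p.1.
Proof.
move=> dux ux0.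
exists (fun q => xget 0 [set x | a < x < b /\ u (x, q.2) = q.1]) => p /open_boxP[pab pcd].
have u_lt x x' : a < x -> x < x' -> x' < b -> u (x, p.2) < u (x', p.2).
  move=> ax xx' xb; apply: (gtr0_derive1_incr (f := fun x => u (x, p.2)) (a := x) (b := x')) => //.
  - move=> z; rewrite in_itv /= => /andP[az zb].
    have az' : a <= z <= b by apply/andP; split; lra.
    have dz := dux (z, p.2) az' pcd; exact: ex_derive.
  - move=> z; rewrite in_itv /= => /andP[az zb].
    have az' : a <= z <= b by apply/andP; split; lra.
    have dz := dux (z, p.2) az' pcd.
    by rewrite derive1E (@derive_val _ _ _ _ _ _ _ dz); apply: (ux0 (z, p.2)).
  - apply: continuous_in_subspaceT => z /[!inE]/=; rewrite in_itv /= => /andP[az zb].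
    have az' : a <= z <= b by apply/andP; split; lra.
    have dz := dux (z, p.2) az' pcd.
    apply/differentiable_continuous/derivable1_diffP; exact: ex_derive.
have up : u (p.1, p.2) = u p by rewrite -surjective_pairing.
case: xgetP => [x _ [/= /andP[ax xb] e]|/(_ p.1)]; last by case.
case/andP: pab => ap pb; case: (ltgtP x p.1) => // h.
  by have := u_lt _ _ ax h pb; rewrite e up ltxx.
by have := u_lt _ _ ap h xb; rewrite e up ltxx.
Qed.

(** * Invariance of the plane measure under swap and quarter turn *)

Section PlaneSymmetries.
Context (R : realType).
Local Notation lam := (@lebesgue_measure R).
Local Notation lam2 := (lam \x lam)%E.

Lemma ge0_integral_oppr (f : R -> \bar R) : measurable_fun [set: R] f ->
  (forall x, (0 <= f x)%E) ->
  (\int[lam]_x f (- x)%R = \int[lam]_x f x)%E.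
Proof.
move=> mf f0.
transitivity (\int[pushforward lam (-%R : _ -> measurableTypeR R)]_x f x)%E; last first.
  by apply: eq_measure_integral => A mA _; exact: lebesgue_measureN.
by rewrite ge0_integral_pushforward//; exact: measurableT_comp.
Qed.

Variable f : plane R -> \bar R.
Hypotheses (mf : measurable_fun [set: plane R] f) (f0 : forall p, (0 <= f p)%E).

Lemma ge0_integral_swap :
  (\int[lam2]_p f (p.2, p.1) = \int[lam2]_p f p)%E.
Proof.
rewrite ge0_integral_plane//; last first.
  apply: (measurableT_comp mf).
  by apply: measurable_fun_pair; [exact: measurable_snd|exact: measurable_fst].
by rewrite fubini_tonelli1.
Qed.

(** A quarter turn preserves orientation, unlike the swap, so composing a map with it keeps the
    Jacobian positive. *)
Lemma ge0_integral_rot :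
  (\int[lam2]_p f (- p.2, p.1)%R = \int[lam2]_p f p)%E.
Proof.
have mrot : measurable_fun [set: plane R] (fun p : plane R => (- p.2, p.1)).
  apply: measurable_fun_pair; last exact: measurable_fst.
  by apply: measurableT_comp => //; exact: measurable_snd.
rewrite ge0_integral_plane//; last exact: (measurableT_comp mf mrot).
rewrite (ge0_integral_oppr (f := fun y => \int[lam]_x f (y, x))%E).
- by rewrite fubini_tonelli1.
- exact: measurable_fun_fubini_tonelli_F.
- by move=> y; apply: integral_ge0.
Qed.

End PlaneSymmetries.

(** * Functions of class C1 in the plane *)

Section PlaneCalculus.
Context (R : realType).
Implicit Types (p q : plane R) (U : set (plane R)) (g : plane R -> R).

Definition C1_on U g : Prop := forall p, U p ->
  [/\ derivable g p vx, derivable g p vy, {for p, continuous g},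
      {for p, continuous ('D_vx g)} & {for p, continuous ('D_vy g)}].

Lemma smooth_on_C1 U g : smooth_on U g -> C1_on U g.
Proof.
move=> sg p Up; have [h1 h2 h3] := sg 1 : Ck_on 1 U g.
have [dx dy] := h1 p Up.
by split; [exact: dx|exact: dy|exact: (sg 0 p Up)|exact: h2|exact: h3].
Qed.

Lemma C1_derivablex U g p : C1_on U g -> U p -> derivable g p vx.
Proof. by move=> Cg Up; case: (Cg p Up) => h _ _ _ _; exact: h. Qed.

Lemma C1_derivabley U g p : C1_on U g -> U p -> derivable g p vy.
Proof. by move=> Cg Up; case: (Cg p Up) => _ h _ _ _; exact: h. Qed.

Lemma C1_continuous U g p : C1_on U g -> U p -> {for p, continuous g}.
Proof. by move=> Cg Up; case: (Cg p Up) => _ _ h _ _; exact: h. Qed.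

Lemma C1_continuousx U g p : C1_on U g -> U p -> {for p, continuous ('D_vx g)}.
Proof. by move=> Cg Up; case: (Cg p Up) => _ _ _ h _; exact: h. Qed.

Lemma C1_continuousy U g p : C1_on U g -> U p -> {for p, continuous ('D_vy g)}.
Proof. by move=> Cg Up; case: (Cg p Up) => _ _ _ _ h; exact: h. Qed.

Lemma is_derive_slicex g p : derivable g p vx ->
  is_derive p.1 1 (fun x => g (x, p.2)) ('D_vx g p).
Proof.
move=> dg; have e : (fun h : R =>
    h^-1 *: (((fun x => g (x, p.2)) \o shift p.1) (h *: 1) - g (p.1, p.2))) =
    (fun h : R => h^-1 *: ((g \o shift p) (h *: vx) - g p)).
  apply/funext => h; case: p {dg} => x y /=; congr (_ *: (g _ - _)).
  by transitivity (h * 1 + x, h * 0 + y); first by rewrite mulr0 add0r.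
by apply: DeriveDef; rewrite /derivable /derive ?e.
Qed.

Lemma is_derive_slicey g p : derivable g p vy ->
  is_derive p.2 1 (fun y => g (p.1, y)) ('D_vy g p).
Proof.
move=> dg; have e : (fun h : R =>
    h^-1 *: (((fun y => g (p.1, y)) \o shift p.2) (h *: 1) - g (p.1, p.2))) =
    (fun h : R => h^-1 *: ((g \o shift p) (h *: vy) - g p)).
  apply/funext => h; case: p {dg} => x y /=; congr (_ *: (g _ - _)).
  by transitivity (h * 0 + x, h * 1 + y); first by rewrite mulr0 add0r.
by apply: DeriveDef; rewrite /derivable /derive ?e.
Qed.

(** The form with distances handles increments of either sign at once. *)
Lemma MVT_unordered (f df : R -> R) (a b : R) :
  (forall x, `|x - a| <= `|b - a| -> is_derive x 1 f (df x)) ->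
  exists2 x, `|x - a| <= `|b - a| & f b - f a = df x * (b - a).
Proof.
move=> dfx.
have main (c d : R) : c <= d -> (forall x : R, c <= x <= d -> is_derive x 1 f (df x)) ->
    exists2 x, c <= x <= d & f d - f c = df x * (d - c).
  move=> cd dfx'.
  have [x xd||x xcd e] := MVT_segment (f := f) (df := df) cd.
  - by apply: dfx'; move: xd; rewrite in_itv /= => /andP[? ?]; rewrite !ltW.
  - apply: continuous_in_subspaceT => x /[!inE]/=; rewrite in_itv /= => xcd.
    have dz := dfx' _ xcd.
    apply/differentiable_continuous/derivable1_diffP; exact: ex_derive.
  - by exists x => //; move: xcd; rewrite in_itv.
have [ab|ba] := leP a b.
  have [x|x /andP[ax xb] e] := main a b ab.
    by move=> /andP[ax xb]; apply: dfx; rewrite !ger0_norm ?subr_ge0// lerD2r.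
  by exists x => //; rewrite !ger0_norm ?subr_ge0// lerD2r.
have [x|x /andP[bx xa] e] := main b a (ltW ba).
  move=> /andP[bx xa]; apply: dfx.
  by rewrite !ler0_norm ?subr_le0 ?(ltW ba)// lerN2 lerD2r.
exists x; last by rewrite -opprB e -mulrN opprB.
by rewrite !ler0_norm ?subr_le0 ?(ltW ba)// lerN2 lerD2r.
Qed.

Lemma differentiable_linear_approx (V W : normedModType R) (f : V -> W)
    (df : {linear V -> W}) (x : V) : continuous df ->
  (forall e : R, 0 < e ->
    \forall h \near (0 : V), `|f (h + x) - (f x + df h)| <= e * `|h|) ->
  differentiable f x.
Proof.
move=> cdf happ.
have fdf : f \o shift x = cst (f x) + df +o_ 0 id.
  by apply/eqaddoP => e e0; exact: happ.
by apply/diff_locallyP; rewrite (diff_unique cdf fdf).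
Qed.

(** The increment is split along a vertical and a horizontal segment. The mean value theorem on
    each, with continuity of the partial derivatives, bounds either error by half of [e * |h|]. *)
Lemma C1_differentiable U g p : open U -> C1_on U g -> U p ->
  differentiable g p.
Proof.
move=> oU Cg Up.
pose l v : R := v.1 * 'D_vx g p + v.2 * 'D_vy g p.
have lin_l : linear l.
  by move=> k v w; rewrite /l /= /GRing.scale /=; ring.
pose lL := GRing.isLinear.Build _ _ _ _ _ lin_l.
pose L : {linear (plane R : normedModType R) -> (R : normedModType R)} := HB.pack l lL.
have cL : continuous (L : plane R -> R).
  move=> q; change (l q' @[q' --> q] --> l q).
  by apply: cvgD; (apply: cvgM; [|exact: cvg_cst]); [exact: cvg_fst|exact: cvg_snd].
apply: (differentiable_linear_approx cL) => _/posnumP[e].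
have [_ _ _ cx cy] := Cg p Up.
have e20 : 0 < e%:num / 2 by [].
have : \forall q \near p, [/\ U q, `|'D_vx g p - 'D_vx g q| < e%:num / 2 &
                                   `|'D_vy g p - 'D_vy g q| < e%:num / 2].
  have h0 : \forall q \near p, U q by apply: open_nbhs_nbhs.
  have /cvgrPdist_lt/(_ _ e20) h1 := cx; have /cvgrPdist_lt/(_ _ e20) h2 := cy.
  by move: h0 h1 h2; apply: filterS3 => q; split.
move=> /nbhs_ballP[d /= d0 pd].
have : \forall h \near (0 : plane R), `|h| < d.
  by apply/nbhs_ballP; exists d => // h; rewrite -ball_normE /= sub0r normrN.
apply: filterS => h hd.
have h1 : `|h.1| <= `|h| by rewrite prod_normE le_max lexx.
have h2 : `|h.2| <= `|h| by rewrite prod_normE le_max lexx orbT.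
have inb (x y : R) : `|x - p.1| <= `|h| -> `|y - p.2| <= `|h| -> ball p d (x, y).
  by move=> xh yh; split; rewrite /ball /= distrC (le_lt_trans _ hd).
change (`|g (h + p) - (g p + l h)| <= e%:num * `|h|).
have -> : h + p = (h.1 + p.1, h.2 + p.2) by [].
have [x xh ex] : exists2 x, `|x - p.1| <= `|(h.1 + p.1) - p.1| &
    g (h.1 + p.1, h.2 + p.2) - g (p.1, h.2 + p.2) =
    'D_vx g (x, h.2 + p.2) * (h.1 + p.1 - p.1).
  apply: (MVT_unordered (f := fun x => g (x, h.2 + p.2))
    (df := fun x => 'D_vx g (x, h.2 + p.2))) => x.
  rewrite addrK => xh.
  have [Uq _ _] := pd (x, h.2 + p.2) (inb x (h.2 + p.2) (le_trans xh h1) ltac:(by rewrite addrK)).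
  by have [dx _ _ _ _] := Cg _ Uq; exact: (is_derive_slicex dx).
have [y yh ey] : exists2 y, `|y - p.2| <= `|(h.2 + p.2) - p.2| &
    g (p.1, h.2 + p.2) - g (p.1, p.2) =
    'D_vy g (p.1, y) * (h.2 + p.2 - p.2).
  apply: (MVT_unordered (f := fun y => g (p.1, y))
    (df := fun y => 'D_vy g (p.1, y))) => y.
  rewrite addrK => yh.
  have [Uq _ _] := pd (p.1, y) (inb p.1 y ltac:(by rewrite subrr normr0) (le_trans yh h2)).
  by have [_ dy _ _ _] := Cg _ Uq; exact: (is_derive_slicey dy).
move: xh yh ex ey; rewrite !addrK => xh yh ex ey.
have [_ bx _] := pd (x, h.2 + p.2) (inb x (h.2 + p.2) (le_trans xh h1) ltac:(by rewrite addrK)).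
have [_ _ by_] := pd (p.1, y) (inb p.1 y ltac:(by rewrite subrr normr0) (le_trans yh h2)).
have -> : g (h.1 + p.1, h.2 + p.2) - (g p + l h) =
    - ('D_vx g p - 'D_vx g (x, h.2 + p.2)) * h.1 -
      ('D_vy g p - 'D_vy g (p.1, y)) * h.2.
  have gp : g p = g (p.1, p.2) by congr g; case: (p).
  have -> : g (h.1 + p.1, h.2 + p.2) = 'D_vx g (x, h.2 + p.2) * h.1 +
     ('D_vy g (p.1, y) * h.2 + g p) by rewrite -ex -ey gp; ring.
  by rewrite /l; ring.
rewrite mulNr -opprD normrN (le_trans (ler_normD _ _))// !normrM.
have -> : e%:num * `|h| = e%:num / 2 * `|h| + e%:num / 2 * `|h| by field.
by apply: lerD; apply: ler_pM => //; exact: ltW.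
Qed.

Lemma derive_comp_diff (V W : normedModType R) (f : V -> W) (g : W -> R) (x v : V) :
  differentiable f x -> differentiable g (f x) ->
  'D_v (fun y => g (f y)) x = 'd g (f x) ('d f x v).
Proof.
move=> df dg; transitivity ('d (g \o f) x v).
  by apply: deriveE; exact: differentiable_comp.
by rewrite (diff_comp df dg).
Qed.

Lemma derive_pair (V : normedModType R) (f g : V -> R) (x v : V) :
  differentiable f x -> differentiable g x ->
  'd (fun y => (f y, g y)) x v = ('D_v f x, 'D_v g x) :> R * R.
Proof.
by move=> df dg; rewrite (diff_pair df dg) (deriveE v df) (deriveE v dg).
Qed.

Lemma diff_plane g p v : differentiable g p ->
  'd g p v = v.1 * 'D_vx g p + v.2 * 'D_vy g p.
Proof.
move=> dg; have e : v = v.1 *: vx + v.2 *: vy.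
  transitivity (v.1 * 1 + v.2 * 0, v.1 * 0 + v.2 * 1); last by [].
  by rewrite !mulr0 !mulr1 addr0 add0r; case: (v).
rewrite (deriveE vx dg) (deriveE vy dg) {1}e.
transitivity ('d g p (v.1 *: vx) + 'd g p (v.2 *: vy)); first exact: linearD.
by congr (_ + _); exact: linearZ.
Qed.

Lemma derive_comp_plane (V : normedModType R) g (u1 u2 : V -> R) (x v : V) :
  differentiable g (u1 x, u2 x) -> differentiable u1 x -> differentiable u2 x ->
  'D_v (fun y => g (u1 y, u2 y)) x =
  'D_v u1 x * 'D_vx g (u1 x, u2 x) + 'D_v u2 x * 'D_vy g (u1 x, u2 x).
Proof.
move=> dg d1 d2.
have dT : differentiable (fun y => (u1 y, u2 y)) x by exact: differentiable_pair.
transitivity ('d g (u1 x, u2 x) ('d (fun y => (u1 y, u2 y)) x v)).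
  by apply: (derive_comp_diff v (f := fun y => (u1 y, u2 y))).
transitivity ('d g (u1 x, u2 x) ('D_v u1 x, 'D_v u2 x)).
  by congr ('d g _ _); exact: derive_pair.
exact: diff_plane.
Qed.

End PlaneCalculus.

(** * Local change of variables by factorization *)

Section LocalChangeOfVariables.
Context (R : realType).
Local Notation lam := (@lebesgue_measure R).
Local Notation lam2 := (lam \x lam)%E.
Implicit Types (p q : plane R) (V W : set (plane R)).

Definition jacobian (u v : plane R -> R) p : R :=
  'D_vx u p * 'D_vy v p - 'D_vy u p * 'D_vx v p.

(** Maps are given by components because [C1_on] concerns real functions. The Jacobian is positive,
    as between charts of an oriented atlas, and so enters the formulas without absolute value. *)
Record C1_diffeo V W (T1 T2 S1 S2 : plane R -> R) : Prop := C1Diffeo {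
  diffeo_openV : open V;
  diffeo_openW : open W;
  diffeo_T1 : C1_on V T1;
  diffeo_T2 : C1_on V T2;
  diffeo_S1 : C1_on W S1;
  diffeo_S2 : C1_on W S2;
  diffeo_im : forall p, V p -> W (T1 p, T2 p);
  diffeo_preim : forall q, W q -> V (S1 q, S2 q);
  diffeoK : forall p, V p -> (S1 (T1 p, T2 p), S2 (T1 p, T2 p)) = p;
  diffeoKV : forall q, W q -> (T1 (S1 q, S2 q), T2 (S1 q, S2 q)) = q;
  diffeo_jacobian : forall p, V p -> 0 < jacobian T1 T2 p
}.

(** The image of [U] is written as a preimage under the inverse map. All measurable [f] are included
    so that cutting [f] off passes the formula to measurable parts of [U]. *)
Definition cov_on V W (T1 T2 S1 S2 : plane R -> R) (U : set (plane R)) :=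
  [/\ open U, U `<=` V &
    forall f : plane R -> \bar R, measurable_fun [set: plane R] f ->
      (forall p, (0 <= f p)%E) ->
      (\int[lam2]_(p in U) (f (T1 p, T2 p) * (jacobian T1 T2 p)%:E) =
       \int[lam2]_(q in W `&` [set q | U (S1 q, S2 q)]) f q)%E].

Definition locally_cov V W (T1 T2 S1 S2 : plane R -> R) p :=
  exists2 U : set (plane R), U p & cov_on V W T1 T2 S1 S2 U.

Lemma derive_snd p (v : plane R) : 'D_v (fun q => q.2) p = v.2.
Proof.
have c : continuous (@snd R R) by move=> x; exact: cvg_snd.
have d : differentiable (@snd R R) p by apply: (@linear_differentiable _ _ _ (@snd R R) p).
transitivity ('d (@snd R R) p v); first exact: deriveE.
by rewrite (@diff_lin _ _ _ (@snd R R)).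
Qed.

Lemma box_nbhs p (P : set (plane R)) : nbhs p P -> exists a b c d,
  [/\ a < b, c < d, open_box a b c d p &
      forall q, a <= q.1 <= b -> c <= q.2 <= d -> P q].
Proof.
move=> /nbhs_ballP[e /= e0 eP].
exists (p.1 - e / 2), (p.1 + e / 2), (p.2 - e / 2), (p.2 + e / 2).
split; [lra|lra|by apply/open_boxP; split; apply/andP; split; lra|].
move=> q /andP[q1 q2] /andP[q3 q4]; apply: eP.
by split; rewrite /ball /= ltr_norml; apply/andP; split; lra.
Qed.

Lemma measurable_fun_comp_plane (f : plane R -> \bar R) (D : set (plane R)) (u1 u2 : plane R -> R) :
  measurable_fun [set: plane R] f -> measurable D ->
  measurable_fun D u1 -> measurable_fun D u2 ->
  measurable_fun D (fun p => f (u1 p, u2 p)).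
Proof.
move=> mf mD m1 m2.
apply: (eq_measurable_fun (fun q => f ((u1 \_ D) q, (u2 \_ D) q))).
  by move=> q qD; rewrite !patchE qD.
apply: measurable_funTS; apply: (measurableT_comp mf).
by apply: measurable_fun_pair; exact/(measurable_restrictT _ mD).
Qed.

Lemma continuous_pair_at (T : topologicalType) (u1 u2 : T -> R) (t : T) :
  {for t, continuous u1} -> {for t, continuous u2} ->
  {for t, continuous (fun s => (u1 s, u2 s))}.
Proof. by move=> c1 c2; exact: (cvg_pair c1 c2). Qed.

Lemma continuous_swap p : {for p, continuous (fun q : plane R => (q.2, q.1))}.
Proof. by apply: continuous_pair_at; [exact: cvg_snd|exact: cvg_fst]. Qed.

Section Local.
Variables (V W : set (plane R)) (T1 T2 S1 S2 : plane R -> R).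
Hypothesis D : C1_diffeo V W T1 T2 S1 S2.
Let T p := (T1 p, T2 p).
Let S q := (S1 q, S2 q).
Let oV := diffeo_openV D.
Let oW := diffeo_openW D.
Let J := jacobian T1 T2.

(** Cramer's rule for one entry of the inverse differential, from differentiating [S2 (T p) = p.2]
    in both directions. It makes the derivative of [S2] along [vy] positive as soon as that of [T1]
    along [vx] is, so that both factors are monotone. *)
Lemma diffeo_inverse_derive p : V p -> 'D_vy S2 (T p) * J p = 'D_vx T1 p.
Proof.
move=> Vp; have Wp := diffeo_im D Vp.
have d1 := C1_differentiable oV (diffeo_T1 D) Vp.
have d2 := C1_differentiable oV (diffeo_T2 D) Vp.
have dS := C1_differentiable oW (diffeo_S2 D) Wp.
have ch v : 'D_v T1 p * 'D_vx S2 (T p) + 'D_v T2 p * 'D_vy S2 (T p) = v.2.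
  rewrite -(derive_comp_plane v dS d1 d2) -(derive_snd p v).
  apply: near_eq_derive; have : \forall q \near p, V q by apply: open_nbhs_nbhs.
  by apply: filterS => q Vq; rewrite -[in RHS](diffeoK D Vq).
have := ch vx; have := ch vy; rewrite /J /jacobian /=.
move: ('D_vx T1 p) ('D_vy T1 p) ('D_vx T2 p) ('D_vy T2 p) => a b c d.
move: ('D_vx S2 (T p)) ('D_vy S2 (T p)) => s t e1 e0.
transitivity (a * (b * s + d * t) - b * (a * s + c * t)); first by ring.
by rewrite e1 e0; ring.
Qed.

Let cT p : V p -> {for p, continuous T}.
Proof.
move=> Vp; have [_ _ c1 _ _] := diffeo_T1 D Vp; have [_ _ c2 _ _] := diffeo_T2 D Vp.
exact: continuous_pair_at.
Qed.

(* The maps Phi p = (T1 p, p.2) and Theta q = (q.1, S2 q) change one coordinate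
   only, and Phi = Theta \o T: both sides are compared on the image of Phi. *)
Lemma locally_cov_derivex_gt0 p0 : V p0 -> 0 < 'D_vx T1 p0 ->
  locally_cov V W T1 T2 S1 S2 p0.
Proof.
move=> V0 T1x0.
have [a [b [c [d [ab cd B0 B1V]]]]] : exists a b c d, [/\ a < b, c < d, open_box a b c d p0 &
    forall q, a <= q.1 <= b -> c <= q.2 <= d -> V q /\ 0 < 'D_vx T1 q].
  apply: (box_nbhs (P := fun q => V q /\ 0 < 'D_vx T1 q)).
  have h0 : \forall q \near p0, V q by apply: open_nbhs_nbhs.
  have h1 : \forall q \near p0, 0 < 'D_vx T1 q.
    by have [_ _ _ cx _] := diffeo_T1 D V0; apply: near_lt_continuous => //; exact: cvg_cst.
  by move: h0 h1; apply: filterS2.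
have W0 := diffeo_im D V0.
have S2y0 : 0 < 'D_vy S2 (T p0).
  by rewrite -(pmulr_lgt0 _ (diffeo_jacobian D V0)) (diffeo_inverse_derive V0).
have [a2 [b2 [c2 [d2 [ab2 cd2 B20 B2W]]]]] : exists a b c d,
  [/\ a < b, c < d, open_box a b c d (T p0) &
    forall q, a <= q.1 <= b -> c <= q.2 <= d -> W q /\ 0 < 'D_vy S2 q].
  apply: (box_nbhs (P := fun q => W q /\ 0 < 'D_vy S2 q)).
  have h0 : \forall q \near T p0, W q by apply: open_nbhs_nbhs.
  have h1 : \forall q \near T p0, 0 < 'D_vy S2 q.
    by have [_ _ _ _ cy] := diffeo_S2 D W0; apply: near_lt_continuous => //; exact: cvg_cst.
  by move: h0 h1; apply: filterS2.
set B1 := open_box a b c d in B0; set B2 := open_box a2 b2 c2 d2 in B20.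
have B1V' p : B1 p -> V p /\ 0 < 'D_vx T1 p.
  by move=> /open_boxP[/andP[? ?] /andP[? ?]]; apply: B1V; rewrite !ltW.
have B2W' q : B2 q -> W q /\ 0 < 'D_vy S2 q.
  by move=> /open_boxP[/andP[? ?] /andP[? ?]]; apply: B2W; rewrite !ltW.
have oB1 : open B1 by exact: open_open_box.
have oB2 : open B2 by exact: open_open_box.
(* On [U] both factors are under control: Phi on [B1], and Theta on [B2] after applying [T]. *)
pose U := [set p | B1 p /\ B2 (T p)].
have oU : open U.
  rewrite openE => p [B1p B2p].
  have [Vp _] := B1V' _ B1p.
  have h1 : \forall q \near p, B1 q by apply: open_nbhs_nbhs.
  have h2 : \forall q \near p, B2 (T q).
    by apply: (cT Vp); apply: open_nbhs_nbhs.
  suff : \forall q \near p, U q by [].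
  by move: h1 h2; apply: filterS2.
have UV : U `<=` V by move=> p [/B1V'[]].
exists U; first by [].
split; [exact: oU|exact: UV|move=> f mf f0].
have mU := open_measurable_plane oU.
have mV := open_measurable_plane oV.
have mW := open_measurable_plane oW.
have mB1 := open_measurable_plane oB1.
have mB2 := open_measurable_plane oB2.
have mC (A : set (plane R)) (g : plane R -> R) : open A ->
    (forall p, A p -> {for p, continuous g}) -> measurable_fun A g.
  exact: continuous_measurable_plane.
have mT1 : measurable_fun V T1.
  by apply: mC => // p Vp; exact: (C1_continuous (diffeo_T1 D) Vp).
have mT2 : measurable_fun V T2.
  by apply: mC => // p Vp; exact: (C1_continuous (diffeo_T2 D) Vp).
have mS1 : measurable_fun W S1.
  by apply: mC => // p Vp; exact: (C1_continuous (diffeo_S1 D) Vp).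
have mS2 : measurable_fun W S2.
  by apply: mC => // p Vp; exact: (C1_continuous (diffeo_S2 D) Vp).
have mT1x : measurable_fun V ('D_vx T1).
  by apply: mC => // p Vp; exact: (C1_continuousx (diffeo_T1 D) Vp).
have mT1y : measurable_fun V ('D_vy T1).
  by apply: mC => // p Vp; exact: (C1_continuousy (diffeo_T1 D) Vp).
have mT2x : measurable_fun V ('D_vx T2).
  by apply: mC => // p Vp; exact: (C1_continuousx (diffeo_T2 D) Vp).
have mT2y : measurable_fun V ('D_vy T2).
  by apply: mC => // p Vp; exact: (C1_continuousy (diffeo_T2 D) Vp).
(* Phi accounts for the factor ['D_vx T1] of the Jacobian. The remaining quotient is the inverse of
   ['D_vy S2] at [T p], and will cancel against the Jacobian of Theta. *)
pose g p := (f (T p) * (J p / 'D_vx T1 p)%:E)%E.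
have mg : measurable_fun U g.
  have cinv : measurable_fun U (fun p => ('D_vx T1 p)^-1).
    apply: mC => // p [B1p _]; have [Vp gt0] := B1V' _ B1p.
    exact: (cvgV (lt0r_neq0 gt0) (C1_continuousx (diffeo_T1 D) Vp)).
  apply: emeasurable_funM.
    by apply: measurable_fun_comp_plane => //; exact: (measurable_funS mV UV).
  apply/measurable_EFinP; apply: measurable_funM => //.
  apply: (measurable_funS mV UV).
  exact: (measurable_funB (measurable_funM mT1x mT2y) (measurable_funM mT1y mT2x)).
pose h := g \_ U.
have mh : measurable_fun [set: plane R] h by exact/(measurable_restrictT _ mU).
have h0 p : (0 <= h p)%E.
  rewrite /h patchE; case: ifPn => //; rewrite inE => -[B1p _].
  have [Vp gt0] := B1V' _ B1p; rewrite mule_ge0// lee_fin.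
  by rewrite divr_ge0// ltW//; exact: (diffeo_jacobian D Vp).
pose k := (fun q => h (S q)) \_ B2.
have mhS : measurable_fun B2 (fun q => h (S q)).
  apply: measurable_fun_comp_plane => //.
    by apply: (measurable_funS mW) => // q /B2W'[].
  by apply: (measurable_funS mW) => // q /B2W'[].
have mk : measurable_fun [set: plane R] k by exact/(measurable_restrictT _ mB2).
have k0 q : (0 <= k q)%E by rewrite /k patchE; case: ifPn.
have cd_le x : c < x < d -> c <= x <= d by move=> /andP[? ?]; rewrite !ltW.
have ab2_le x : a2 < x < b2 -> a2 <= x <= b2 by move=> /andP[? ?]; rewrite !ltW.
have hd1 p : a <= p.1 <= b -> c < p.2 < d -> is_derive p.1 1 (fun x => T1 (x, p.2)) ('D_vx T1 p).
  move=> pab /cd_le pcd; have [Vp _] := B1V _ pab pcd.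
  exact: (is_derive_slicex (C1_derivablex (diffeo_T1 D) Vp)).
have hc1 p : a <= p.1 <= b -> c < p.2 < d -> {for p, continuous T1}.
  by move=> pab /cd_le pcd; have [Vp _] := B1V _ pab pcd; exact: (C1_continuous (diffeo_T1 D) Vp).
have hcx1 p : a <= p.1 <= b -> c < p.2 < d -> {for p, continuous ('D_vx T1)}.
  by move=> pab /cd_le pcd; have [Vp _] := B1V _ pab pcd; exact: (C1_continuousx (diffeo_T1 D) Vp).
have hp1 p : a <= p.1 <= b -> c < p.2 < d -> 0 < 'D_vx T1 p.
  by move=> pab /cd_le pcd; have [_] := B1V _ pab pcd.
have [X XK] := exists_slice_inverse hd1 hp1.
(* Swapping the coordinates turns Theta, which changes the second one, into a map to which the
   substitution in the first coordinate applies. *)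
pose u2 p := S2 (p.2, p.1).
pose u2x p := 'D_vy S2 (p.2, p.1).
have hd2 p : c2 <= p.1 <= d2 -> a2 < p.2 < b2 -> is_derive p.1 1 (fun x => u2 (x, p.2)) (u2x p).
  move=> pcd /ab2_le pab; have [Wp _] := B2W (p.2, p.1) pab pcd.
  exact: (is_derive_slicey (C1_derivabley (diffeo_S2 D) Wp)).
have hc2 p : c2 <= p.1 <= d2 -> a2 < p.2 < b2 -> {for p, continuous u2}.
  move=> pcd /ab2_le pab; have [Wp _] := B2W (p.2, p.1) pab pcd.
  have [_ _ cc _ _] := diffeo_S2 D Wp.
  exact: (continuous_comp (@continuous_swap p) cc).
have hcx2 p : c2 <= p.1 <= d2 -> a2 < p.2 < b2 -> {for p, continuous u2x}.
  move=> pcd /ab2_le pab; have [Wp _] := B2W (p.2, p.1) pab pcd.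
  have [_ _ _ _ cc] := diffeo_S2 D Wp.
  exact: (continuous_comp (@continuous_swap p) cc).
have hp2 p : c2 <= p.1 <= d2 -> a2 < p.2 < b2 -> 0 < u2x p.
  by move=> pcd /ab2_le pab; have [_] := B2W (p.2, p.1) pab pcd.
have [Y YK] := exists_slice_inverse hd2 hp2.
pose k' q := k (q.2, q.1).
have mk' : measurable_fun [set: plane R] k'.
  apply: (measurableT_comp mk).
  by apply: measurable_fun_pair; [exact: measurable_snd|exact: measurable_fst].
have k'0 q : (0 <= k' q)%E by exact: k0.
have prim1 := ge0_integral_primitive ab hd1 hc1 hcx1 hp1 XK mh h0.
have prim2 := ge0_integral_primitive cd2 hd2 hc2 hcx2 hp2 YK mk' k'0.
set A1 := slice_region _ _ _ _ _ in prim1.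
set A2 := slice_region _ _ _ _ _ in prim2.
pose F1 := (fun q => h (X q, q.2)) \_ A1.
pose F2 := (fun q => k' (Y q, q.2)) \_ A2.
have im1 : A1 = (fun p => (T1 p, p.2)) @` B1.
  by rewrite /A1 (slice_image ab hd1 hp1 XK).
have im2 : A2 = (fun p => (u2 p, p.2)) @` open_box c2 d2 a2 b2.
  by rewrite /A2 (slice_image cd2 hd2 hp2 YK).
have swapB2 p : open_box c2 d2 a2 b2 p <-> B2 (p.2, p.1).
  by split=> /open_boxP[? ?]; apply/open_boxP.
have F1E p : B1 p -> F1 (T1 p, p.2) = h p.
  move=> B1p; rewrite /F1 patchE ifT; last by rewrite inE im1; exists p.
  by rewrite /= (XK _ B1p); case: (p).
have F2E q : B2 q -> F2 (S2 q, q.1) = h (S q).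
  move=> B2q; have B2q' : open_box c2 d2 a2 b2 (q.2, q.1).
    by apply/swapB2; case: (q) B2q.
  have Yq : Y (S2 q, q.1) = q.2.
    by rewrite -[RHS](YK _ B2q'); congr (Y (S2 _, _)); case: (q).
  rewrite /F2 patchE ifT; last first.
    by rewrite inE im2; exists (q.2, q.1) => //=; congr (S2 _, _); case: (q).
  rewrite /k' /= Yq /k patchE ifT; first by case: (q).
  by rewrite inE; case: (q) B2q.
(* At [(T1 p, p.2)] with [p] in [U] both sides equal [h p], because Phi p = Theta (T p); away from
   these points both vanish. *)
have F12 q : F1 q = F2 (q.2, q.1).
  have [[p [Up <-]]|nU] := pselect (exists p, U p /\ (T1 p, p.2) = q).
    have [B1p B2p] := Up; have Vp := UV _ Up.
    have SK := diffeoK D Vp.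
    rewrite F1E//=; have := F2E _ B2p; rewrite /S SK /= => <-.
    by congr (F2 (_, _)); exact: (congr1 snd SK).
  transitivity (0%E : \bar R); last apply/esym.
    rewrite /F1 patchE; case: ifPn => //; rewrite inE im1 => -[p B1p pq].
    rewrite -pq (XK _ B1p) /= /h patchE ifF//; apply/negP; rewrite inE => Up.
    by apply: nU; exists p; split => //; case: (p) Up.
  rewrite /F2 patchE; case: ifPn => //; rewrite inE im2 => -[r r2 rq].
  rewrite -rq (YK _ r2) /k' /= /k patchE; case: ifPn => //.
  rewrite inE => Br /=; have [Wr _] := B2W' _ Br.
  rewrite /h patchE ifF//; apply/negP; rewrite inE => Ur; apply: nU.
  exists (S (r.2, r.1)); split => //.
  have := diffeoKV D Wr => /(congr1 fst) /= ->.
  by move: rq; rewrite /u2; case: (q) => ? ? [-> ->].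
have mA1 : measurable A1 by exact: (measurable_slice ab hc1).
have mA2 : measurable A2 by exact: (measurable_slice cd2 hc2).
have mF2 : measurable_fun [set: plane R] F2.
  apply/(measurable_restrictT _ mA2); exact: (measurable_slice_comp cd2 hd2 hc2 hp2 YK mk').
have F20 q : (0 <= F2 q)%E by rewrite /F2 patchE; case: ifPn.
have main : (\int[lam2]_(p in B1) (h p * ('D_vx T1 p)%:E) =
             \int[lam2]_(p in open_box c2 d2 a2 b2) (k' p * (u2x p)%:E))%E.
  rewrite prim1 prim2 integral_mkcond [RHS]integral_mkcond -/F1 -/F2.
  by rewrite -(ge0_integral_swap mF2 F20); apply: eq_integral => q _; exact: F12.
transitivity (\int[lam2]_(p in B1) (h p * ('D_vx T1 p)%:E))%E.
  rewrite integral_mkcond [RHS]integral_mkcond; apply: eq_integral => p _.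
  rewrite !patchE; have [pU|pU] := boolP (p \in U).
    have [B1p B2p] := set_mem pU; have [Vp gt0] := B1V' _ B1p.
    have hE : h p = g p by rewrite /h patchE pU.
    rewrite (mem_set B1p) hE /g.
    rewrite -[RHS](muleA (f (T p)) (J p / 'D_vx T1 p)%:E ('D_vx T1 p)%:E) -EFinM.
    by rewrite (divfK (lt0r_neq0 gt0)).
  have hE : h p = 0%E by rewrite /h patchE (negbTE pU).
  by rewrite hE mul0e if_same.
rewrite main.
pose G := (fun q => h (S q) * ('D_vy S2 q)%:E)%E \_ B2.
have mS2y : measurable_fun B2 ('D_vy S2).
  apply: (mC _ _ oB2) => q /B2W'[Wq _].
  exact: (C1_continuousy (diffeo_S2 D) Wq).
have mG : measurable_fun [set: plane R] G.
  apply/(measurable_restrictT _ mB2).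
  apply: emeasurable_funM; [exact: mhS|exact/measurable_EFinP].
have G0 q : (0 <= G q)%E.
  rewrite /G patchE; case: ifPn => [Bq|_]; last exact: lexx.
  have [_ gt0] := B2W' _ (set_mem Bq).
  by apply: mule_ge0; [exact: h0|rewrite lee_fin ltW].
transitivity (\int[lam2]_q G q)%E.
  rewrite -(ge0_integral_swap mG G0) integral_mkcond; apply: eq_integral => q _.
  rewrite /G !patchE /k' /k patchE.
  have -> : (q \in open_box c2 d2 a2 b2) = ((q.2, q.1) \in B2).
    by apply/idP/idP; rewrite !inE => /swapB2.
  by case: ((q.2, q.1) \in B2).
rewrite [RHS]integral_mkcond; apply: eq_integral => q _.
rewrite /G !patchE.
have [qU|qU] := boolP (q \in W `&` [set q | U (S q)]); last first.
  case: ifPn => [B2q|_]; last by [].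
  have [Wq _] := B2W' _ (set_mem B2q).
  suff hE : h (S q) = 0%E by rewrite hE mul0e.
  rewrite /h patchE; case: ifPn => [SU|_]; last exact: erefl.
  exfalso; apply/(negP qU)/mem_set.
  by split; [exact: Wq|exact: (set_mem SU)].
have [Wq /= USq] := set_mem qU; have [B1S B2S] := USq.
have TS := diffeoKV D Wq.
have B2q : B2 q by move: B2S; rewrite /T TS.
have [VS gt0] := B1V' _ B1S.
have := diffeo_inverse_derive VS; rewrite /T TS => eJ.
have hE : h (S q) = (f q * (J (S q) / 'D_vx T1 (S q))%:E)%E.
  by rewrite /h patchE (mem_set USq) /g /T TS.
rewrite (mem_set B2q) hE.
rewrite -[LHS](muleA (f q) (J (S q) / 'D_vx T1 (S q))%:E ('D_vy S2 q)%:E) -EFinM.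
have alg (x y z : R) : z * x = y -> y != 0 -> x / y * z = 1.
  by move=> e y0; rewrite mulrAC [x * z]mulrC e divff.
have -> : J (S q) / 'D_vx T1 (S q) * 'D_vy S2 q = 1 := alg _ _ _ eJ (lt0r_neq0 gt0).
by rewrite mule1.
Qed.

End Local.
End LocalChangeOfVariables.

(** * Composition of C1 functions *)

Section C1Composition.
Context (R : realType).
Implicit Types (p q : plane R) (U : set (plane R)).

Lemma continuous_eq_on U (f g : plane R -> R) p : open U -> U p ->
  (forall q, U q -> f q = g q) -> {for p, continuous g} -> {for p, continuous f}.
Proof.
move=> oU Up fg cg.
have h : \forall q \near p, U q by apply: open_nbhs_nbhs.
rewrite /prop_for /continuous_at (fg _ Up).
apply: cvg_trans cg; apply: near_eq_cvg.
by move: h; apply: filterS => q Uq; exact: esym (fg _ Uq).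
Qed.

Lemma C1_comp U U' (g u1 u2 : plane R -> R) : open U -> open U' ->
  C1_on U g -> C1_on U' u1 -> C1_on U' u2 ->
  (forall p, U' p -> U (u1 p, u2 p)) ->
  C1_on U' (fun p => g (u1 p, u2 p)) /\
  forall p v, U' p -> 'D_v (fun p => g (u1 p, u2 p)) p =
    'D_v u1 p * 'D_vx g (u1 p, u2 p) + 'D_v u2 p * 'D_vy g (u1 p, u2 p).
Proof.
move=> oU oU' Cg C1 C2 im.
have dE p v : U' p -> 'D_v (fun p => g (u1 p, u2 p)) p =
    'D_v u1 p * 'D_vx g (u1 p, u2 p) + 'D_v u2 p * 'D_vy g (u1 p, u2 p).
  move=> U'p; apply: derive_comp_plane.
  - exact: (C1_differentiable oU Cg (im _ U'p)).
  - exact: (C1_differentiable oU' C1 U'p).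
  - exact: (C1_differentiable oU' C2 U'p).
split; last exact: dE.
move=> p U'p; have cu := continuous_pair_at (C1_continuous C1 U'p) (C1_continuous C2 U'p).
have d : differentiable (g \o (fun p => (u1 p, u2 p))) p.
  apply: differentiable_comp; last exact: (C1_differentiable oU Cg (im _ U'p)).
  by apply: differentiable_pair;
    [exact: (C1_differentiable oU' C1 U'p)|exact: (C1_differentiable oU' C2 U'p)].
split.
- exact: (diff_derivable d).
- exact: (diff_derivable d).
- exact: (differentiable_continuous d).
- apply: (continuous_eq_on oU' U'p (fun q => @dE q vx)).
  have cx := continuous_comp cu (C1_continuousx Cg (im _ U'p)).
  have cy := continuous_comp cu (C1_continuousy Cg (im _ U'p)).
  exact: (cvgD (cvgM (C1_continuousx C1 U'p) cx) (cvgM (C1_continuousx C2 U'p) cy)).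
- apply: (continuous_eq_on oU' U'p (fun q => @dE q vy)).
  have cx := continuous_comp cu (C1_continuousx Cg (im _ U'p)).
  have cy := continuous_comp cu (C1_continuousy Cg (im _ U'p)).
  exact: (cvgD (cvgM (C1_continuousy C1 U'p) cx) (cvgM (C1_continuousy C2 U'p) cy)).
Qed.

Lemma C1_lin U (a b : R) : C1_on U (fun p => a * p.1 + b * p.2) /\
  forall v p, 'D_v (fun p : plane R => a * p.1 + b * p.2) p = a * v.1 + b * v.2.
Proof.
pose l p : R := a * p.1 + b * p.2.
have lin_l : linear l by move=> k v w; rewrite /l /= /GRing.scale /=; ring.
pose lL := GRing.isLinear.Build _ _ _ _ _ lin_l.
pose L : {linear (plane R : normedModType R) -> (R : normedModType R)} := HB.pack l lL.
have cL : continuous (L : plane R -> R).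
  move=> q; change (l q' @[q' --> q] --> l q).
  by apply: cvgD; (apply: cvgM; [exact: cvg_cst|]); [exact: cvg_fst|exact: cvg_snd].
have dl p : differentiable l p by exact: (@linear_differentiable _ _ _ L p).
have dE v p : 'D_v l p = l v.
  transitivity ('d l p v); first exact: deriveE.
  by rewrite (@diff_lin _ _ _ L).
split; last exact: dE.
move=> p _; have dc v : {for p, continuous ('D_v l)}.
  have -> : 'D_v l = cst (l v) by apply/funext => q; exact: dE.
  exact: cvg_cst.
split; [exact: (diff_derivable (dl p))|exact: (diff_derivable (dl p))|
  exact: (cL p)|exact: dc|exact: dc].
Qed.

End C1Composition.

(** * Reduction to a positive partial derivative by quarter turns *)

Section Rotation.
Context (R : realType).
Local Notation lam := (@lebesgue_measure R).
Local Notation lam2 := (lam \x lam)%E.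
Implicit Types (p q : plane R) (V W : set (plane R)).

Definition rot p : plane R := (- p.2, p.1).

Lemma C1_rot V (g : plane R -> R) : open V -> C1_on V g ->
  [/\ open (rot @^-1` V), C1_on (rot @^-1` V) (fun p => g (rot p)),
      forall p, V (rot p) -> 'D_vx (fun p => g (rot p)) p = 'D_vy g (rot p) &
      forall p, V (rot p) -> 'D_vy (fun p => g (rot p)) p = - 'D_vx g (rot p)].
Proof.
move=> oV Cg.
have crot : continuous rot.
  move=> p; apply: (@continuous_pair_at R _ (fun p => - p.2) (fun p => p.1)).
    by apply: cvgN; exact: cvg_snd.
  exact: cvg_fst.
have oV' : open (rot @^-1` V) by exact: open_comp.
have [C1 d1] := C1_lin (rot @^-1` V) 0 (-1 : R).
have [C2 d2] := C1_lin (rot @^-1` V) 1 (0 : R).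
have rotE p : rot p = (0 * p.1 + -1 * p.2, 1 * p.1 + 0 * p.2).
  by rewrite /rot !mul0r mul1r mulN1r add0r addr0.
have [|C dE] := C1_comp oV oV' Cg C1 C2.
  by move=> p; rewrite /preimage /= rotE.
have gE : (fun p => g (rot p)) = (fun p => g (0 * p.1 + -1 * p.2, 1 * p.1 + 0 * p.2)).
  by apply/funext => p; rewrite rotE.
split; [exact: oV'|by rewrite gE|..] => p Vp.
  by rewrite gE (dE p vx Vp) d1 d2 -rotE /=; ring.
by rewrite gE (dE p vy Vp) d1 d2 -rotE /=; ring.
Qed.

(** The inverse quarter turn sends [(x, y)] to [(y, - x)], whence the components [S2] and [- S1] of
    the new inverse. *)
Lemma diffeo_rot V W T1 T2 S1 S2 : C1_diffeo V W T1 T2 S1 S2 ->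
  C1_diffeo (rot @^-1` V) W (fun p => T1 (rot p)) (fun p => T2 (rot p))
    S2 (fun q => - S1 q).
Proof.
move=> D; have oV := diffeo_openV D; have oW := diffeo_openW D.
have [oV' Ca ax ay] := C1_rot oV (diffeo_T1 D).
have [_ Cb bx by_] := C1_rot oV (diffeo_T2 D).
(* [- S1] is of class C1 as a linear function composed with the pair [(S1, S1)]. *)
have [Cl _] := C1_lin [set: plane R] (-1 : R) 0.
have [|CS _] := C1_comp openT oW Cl (diffeo_S1 D) (diffeo_S1 D); first by [].
have SE : (fun q => - S1 q) = (fun q => -1 * (S1 q, S1 q).1 + 0 * (S1 q, S1 q).2).
  by apply/funext => q /=; rewrite mul0r addr0 mulN1r.
have rotK p : (- - p.1, p.2) = p by rewrite opprK; case: p.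
split.
- exact: oV'.
- exact: oW.
- exact: Ca.
- exact: Cb.
- exact: (diffeo_S2 D).
- by rewrite SE.
- by move=> p Vp; exact: (diffeo_im D Vp).
- move=> q Wq; rewrite /preimage /rot /= opprK; exact: (diffeo_preim D Wq).
- move=> p Vp; have := diffeoK D Vp; case: p {Vp} => x y; rewrite /rot /= => -[-> ->].
  by rewrite opprK.
- move=> q Wq; rewrite /rot /= opprK; exact: (diffeoKV D Wq).
- move=> p Vp; rewrite /jacobian (ax p Vp) (ay p Vp) (bx p Vp) (by_ p Vp).
  have := diffeo_jacobian D Vp; rewrite /jacobian.
  move: ('D_vx T1 _) ('D_vy T1 _) ('D_vx T2 _) ('D_vy T2 _) => a b c d.
  by have -> : b * - c - - a * d = a * d - b * c by ring.
Qed.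

Lemma measurable_diffeo_integrand V W T1 T2 S1 S2 (f : plane R -> \bar R) :
  C1_diffeo V W T1 T2 S1 S2 -> measurable_fun [set: plane R] f ->
  measurable_fun V (fun p => f (T1 p, T2 p) * (jacobian T1 T2 p)%:E)%E.
Proof.
move=> D mf; have oV := diffeo_openV D.
have mV := open_measurable_plane oV.
apply: emeasurable_funM.
  apply: (measurable_fun_comp_plane mf mV).
    by apply: (continuous_measurable_plane oV) => p Vp; exact: (C1_continuous (diffeo_T1 D) Vp).
  by apply: (continuous_measurable_plane oV) => p Vp; exact: (C1_continuous (diffeo_T2 D) Vp).
apply/measurable_EFinP; apply: (continuous_measurable_plane oV) => p Vp.
exact: (cvgB (cvgM (C1_continuousx (diffeo_T1 D) Vp) (C1_continuousy (diffeo_T2 D) Vp))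
  (cvgM (C1_continuousy (diffeo_T1 D) Vp) (C1_continuousx (diffeo_T2 D) Vp))).
Qed.

(** The quarter turn preserves the measure, and composing with it only transports the Jacobian; a
    formula for the turned map on [U] is thus one for the original map on the turned set. *)
Lemma locally_cov_rot V W T1 T2 S1 S2 p0 : C1_diffeo V W T1 T2 S1 S2 ->
  locally_cov (rot @^-1` V) W (fun p => T1 (rot p)) (fun p => T2 (rot p))
    S2 (fun q => - S1 q) (p0.2, - p0.1) ->
  locally_cov V W T1 T2 S1 S2 p0.
Proof.
move=> D [U U0 [oU UV cov]].
have oV := diffeo_openV D.
pose rotV p : plane R := (p.2, - p.1).
have rotVK p : rot (rotV p) = p by rewrite /rot /rotV /= opprK; case: p.
have rotK p : rotV (rot p) = p by rewrite /rot /rotV /= opprK; case: p.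
have crotV : continuous rotV.
  move=> p; apply: (@continuous_pair_at R _ (fun p => p.2) (fun p => - p.1)).
    exact: cvg_snd.
  by apply: cvgN; exact: cvg_fst.
have oU' : open (rotV @^-1` U) by exact: open_comp.
have UV' : rotV @^-1` U `<=` V by move=> p /UV; rewrite /preimage /= rotVK.
exists (rotV @^-1` U); first exact: U0.
split; [exact: oU'|exact: UV'|move=> f mf f0].
have mU' := open_measurable_plane oU'; have mU := open_measurable_plane oU.
have mV := open_measurable_plane oV.
pose F := (fun p => f (T1 p, T2 p) * (jacobian T1 T2 p)%:E)%E \_ (rotV @^-1` U).
have mF : measurable_fun [set: plane R] F.
  apply/(measurable_restrictT _ mU').
  exact: (measurable_funS mV UV' (measurable_diffeo_integrand D mf)).
have F0 p : (0 <= F p)%E.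
  rewrite /F patchE; case: ifPn => [Up|_]; last exact: lexx.
  apply: mule_ge0; first exact: f0.
  by rewrite lee_fin ltW//; exact: (diffeo_jacobian D (UV' _ (set_mem Up))).
transitivity (\int[lam2]_p F p)%E; first by rewrite integral_mkcond.
rewrite -(ge0_integral_rot mF F0) -cov//.
rewrite [RHS]integral_mkcond; apply: eq_integral => p _.
rewrite /F !patchE -/(rot p).
have -> : (rot p \in rotV @^-1` U) = (p \in U).
  by apply/idP/idP => /set_mem h; apply/mem_set; move: h; rewrite /preimage /= rotK.
case: (boolP (p \in U)) => [pU|_]; last by [].
have Vp := UV _ (set_mem pU).
have [_ _ ax ay] := C1_rot oV (diffeo_T1 D).
have [_ _ bx by_] := C1_rot oV (diffeo_T2 D).
have jE : jacobian T1 T2 (rot p) =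
    jacobian (fun q => T1 (rot q)) (fun q => T2 (rot q)) p.
  rewrite /jacobian (ax p Vp) (ay p Vp) (bx p Vp) (by_ p Vp).
  by move: ('D_vx T1 _) ('D_vy T1 _) ('D_vx T2 _) ('D_vy T2 _) => a b c d; ring.
by rewrite -jE.
Qed.

(** A quarter turn replaces the partial derivatives of [T1] in x and y by the one in y and the
    opposite of the one in x. They do not both vanish where the Jacobian is positive, so at most
    three turns make the first one positive. *)
Lemma diffeo_locally_cov V W T1 T2 S1 S2 p0 : C1_diffeo V W T1 T2 S1 S2 -> V p0 ->
  locally_cov V W T1 T2 S1 S2 p0.
Proof.
have rotVK p : rot (p.2, - p.1) = p by rewrite /rot /= opprK; case: p.
have L1 V' T1' T2' S1' S2' p1 : C1_diffeo V' W T1' T2' S1' S2' -> V' p1 ->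
    0 < 'D_vy T1' p1 -> locally_cov V' W T1' T2' S1' S2' p1.
  move=> D V1 pos; apply: (locally_cov_rot D).
  have V1' : V' (rot (p1.2, - p1.1)) by rewrite rotVK.
  apply: (locally_cov_derivex_gt0 (diffeo_rot D) V1').
  have [_ _ e _] := C1_rot (diffeo_openV D) (diffeo_T1 D).
  by rewrite (e _ V1') rotVK.
have L2 V' T1' T2' S1' S2' p1 : C1_diffeo V' W T1' T2' S1' S2' -> V' p1 ->
    'D_vx T1' p1 < 0 -> locally_cov V' W T1' T2' S1' S2' p1.
  move=> D V1 neg; apply: (locally_cov_rot D).
  have V1' : V' (rot (p1.2, - p1.1)) by rewrite rotVK.
  apply: (L1 _ _ _ _ _ _ (diffeo_rot D) V1').
  have [_ _ _ e] := C1_rot (diffeo_openV D) (diffeo_T1 D).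
  by rewrite (e _ V1') rotVK oppr_gt0.
move=> D V0.
have [neg|pos|x0] := ltgtP ('D_vx T1 p0) 0.
- exact: (L2 _ _ _ _ _ _ D V0 neg).
- exact: (locally_cov_derivex_gt0 D V0 pos).
have [neg|pos|y0] := ltgtP ('D_vy T1 p0) 0.
- apply: (locally_cov_rot D).
  have V1' : V (rot (p0.2, - p0.1)) by rewrite rotVK.
  apply: (L2 _ _ _ _ _ _ (diffeo_rot D) V1').
  have [_ _ e _] := C1_rot (diffeo_openV D) (diffeo_T1 D).
  by rewrite (e _ V1') rotVK.
- exact: (L1 _ _ _ _ _ _ D V0 pos).
have := diffeo_jacobian D V0.
by rewrite /jacobian x0 y0 !mul0r subrr ltxx.
Qed.

End Rotation.

(** * Gluing of the local formulas *)

Section ChangeOfVariables.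
Context (R : realType).
Local Notation lam := (@lebesgue_measure R).
Local Notation lam2 := (lam \x lam)%E.
Implicit Types (p q : plane R).
Variables (V W : set (plane R)) (T1 T2 S1 S2 : plane R -> R).
Hypothesis D : C1_diffeo V W T1 T2 S1 S2.

Let oV := diffeo_openV D.
Let oW := diffeo_openW D.
Let mV := open_measurable_plane oV.
Let mW := open_measurable_plane oW.

Let measurable_diffeo_preimage (E : set (plane R)) : measurable E ->
  measurable (W `&` [set q | E (S1 q, S2 q)]).
Proof.
move=> mE.
have mS : measurable_fun [set: plane R] (fun q => ((S1 \_ W) q, (S2 \_ W) q)).
  apply: measurable_fun_pair; apply/(measurable_restrictT _ mW);
    apply: (continuous_measurable_plane oW) => q Wq.
    exact: (C1_continuous (diffeo_S1 D) Wq).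
  exact: (C1_continuous (diffeo_S2 D) Wq).
rewrite (_ : _ `&` _ = W `&` (fun q => ((S1 \_ W) q, (S2 \_ W) q)) @^-1` E).
  by apply: measurableI => //; rewrite -[X in measurable X]setTI; exact: mS.
by apply/seteqP; split => q [Wq Eq]; split => //;
  move: Eq; rewrite /preimage /= !patchE (mem_set Wq).
Qed.

(** Countably many rational boxes, each inside a set where the local formula holds, cover [V].
    Removing from each the previous ones gives disjoint measurable pieces, over which both sides are
    summed. *)
Lemma ge0_change_of_variables (f : plane R -> \bar R) :
  measurable_fun [set: plane R] f -> (forall p, (0 <= f p)%E) ->
  (\int[lam2]_(p in V) (f (T1 p, T2 p) * (jacobian T1 T2 p)%:E) =
   \int[lam2]_(q in W) f q)%E.
Proof.
move=> mf f0.
pose B (r : rat * rat * (rat * rat)) :=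
  open_box (ratr r.1.1 : R) (ratr r.1.2) (ratr r.2.1) (ratr r.2.2).
pose good (r : rat * rat * (rat * rat)) := 
  exists2 U : set (plane R), B r `<=` U & cov_on V W T1 T2 S1 S2 U.
(* Codes of no box, or of a box that is not good, give the empty set; the corresponding pieces
   contribute 0. *)
pose F n : set (plane R) := if unpickle n is Some r then
  (if `[< good r >] then B r else set0) else set0.
have mF n : measurable (F n).
  rewrite /F; case: unpickle => [q|]; last exact: measurable0.
  case: asboolP => _; last exact: measurable0.
  by apply: open_measurable_plane; exact: open_open_box.
have FV : \bigcup_n F n = V.
  apply/seteqP; split => [p [n _]|p Vp].
    rewrite /F; case: unpickle => [r|//]; case: asboolP => [[U BU [_ UV _]] /BU|_ []].
    exact: UV.
  have [U Up covU] := diffeo_locally_cov D Vp; have [oU _ _] := covU.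
  have [q Bp BU] := nbhs_rat_box (open_nbhs_nbhs (conj oU Up)).
  exists (pickle q); first exact: Logic.I.
  rewrite /F (pickleK q); case: asboolP => [_|ng]; first exact: Bp.
  by exfalso; apply: ng; exists U; [exact: BU|exact: covU].
pose E := seqDU F.
have mE n : measurable (E n) by exact: seqDU_measurable.
have EV : \bigcup_n E n = V by rewrite /E -seqDU_bigcup_eq.
have tE : trivIset setT E by exact: trivIset_seqDU.
have EsubV n : E n `<=` V by rewrite -EV => p Ep; exists n.
pose E' n := W `&` [set q | E n (S1 q, S2 q)].
have mE' n : measurable (E' n) by exact: measurable_diffeo_preimage.
have EW : \bigcup_n E' n = W.
  apply/seteqP; split => [q [n _ []]//|q Wq].
  have : (\bigcup_n E n) (S1 q, S2 q) by rewrite EV; exact: (diffeo_preim D Wq).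
  by move=> [n _ En]; exists n.
have tE' : trivIset setT E'.
  apply/trivIsetP => i j _ _ ij; apply/seteqP; split => // q [[_ /= Ei] [_ /= Ej]].
  have /trivIsetP/(_ i j Logic.I Logic.I ij) := tE.
  by rewrite predeqE => /(_ (S1 q, S2 q))[/(_ (conj Ei Ej))].
rewrite -{1}EV -[in RHS]EW.
rewrite ge0_integral_bigcup//; last 2 first.
- by rewrite EV; exact: (measurable_diffeo_integrand D mf).
- move=> p; rewrite EV => Vp; apply: mule_ge0; first exact: f0.
  by rewrite lee_fin ltW//; exact: (diffeo_jacobian D Vp).
rewrite ge0_integral_bigcup//; last exact: measurable_funTS.
apply: eq_eseriesr => n _.
have [U EU [oU UV cov]] : 
  exists2 U : set (plane R), E n `<=` U & cov_on V W T1 T2 S1 S2 U.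
  have empty : E n `<=` set0 -> 
  exists2 U : set (plane R), E n `<=` U & cov_on V W T1 T2 S1 S2 U.
    move=> E0; exists set0; first exact: E0.
    split; [exact: open0|exact: sub0set|move=> g mg g0].
    rewrite (_ : W `&` _ = set0) ?integral_set0//.
    by apply/seteqP; split => // q [].
  have EF : E n `<=` F n by exact: subset_seqDU.
  rewrite /F in EF; case: unpickle EF => [q|].
    case: asboolP => [[U BU hU] EB|_]; last exact: empty.
    by exists U; [move=> p /EB/BU|exact: hU].
  exact: empty.
(* Cutting [f] off outside the image of [E n] reduces the formula on [U] to the formula on the
   piece. *)
pose g := f \_ (E' n).
have mg : measurable_fun [set: plane R] g.
  by apply/(measurable_restrictT _ (mE' n)); exact: measurable_funTS.
have g0 p : (0 <= g p)%E by rewrite /g patchE; case: ifPn.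
have := cov g mg g0.
have -> : (\int[lam2]_(q in W `&` [set q | U (S1 q, S2 q)]) g q = \int[lam2]_(q in E' n) f q)%E.
  rewrite integral_mkcond [RHS]integral_mkcond; apply: eq_integral => q _.
  rewrite /g !patchE; case: (boolP (q \in E' n)) => [/set_mem[Wq Eq]|_].
    by rewrite mem_set//; split => //; exact: EU.
  by rewrite if_same.
move=> <-; rewrite integral_mkcond [RHS]integral_mkcond; apply: eq_integral => p _.
rewrite !patchE; case: (boolP (p \in E n)) => [/set_mem Ep|nEp].
  have Vp := UV _ (EU _ Ep).
  rewrite (mem_set (EU _ Ep)); congr (_ * _)%E.
  rewrite /g patchE ifT//; apply/mem_set; split; first exact: (diffeo_im D Vp).
  by rewrite /= (diffeoK D Vp).
case: ifPn => [/set_mem Up|_]; last exact: erefl.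
have -> : g (T1 p, T2 p) = 0%E; last by rewrite mul0e.
rewrite /g patchE; case: ifPn => [/set_mem[_ /=]|_]; last exact: erefl.
by rewrite (diffeoK D (UV _ Up)) => Ep; exfalso; apply/(negP nEp)/mem_set.
Qed.

End ChangeOfVariables.

(** * Compactly supported functions *)

Section CompactSupport.
Context (R : realType).
Local Notation lam := (@lebesgue_measure R).
Local Notation lam2 := (lam \x lam)%E.
Implicit Types (p q : plane R) (U K : set (plane R)).

(** Positive and negative parts are transformed separately, since multiplication by the positive
    Jacobian commutes with taking them. *)
Lemma Rintegral_change_of_variables (V W : set (plane R)) (T1 T2 S1 S2 F : plane R -> R) :
  C1_diffeo V W T1 T2 S1 S2 -> measurable_fun W F ->
  \int[lam2]_(q in W) F q = \int[lam2]_(p in V) (F (T1 p, T2 p) * jacobian T1 T2 p).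
Proof.
move=> D mF; have mW := open_measurable_plane (diffeo_openW D).
have part (G : plane R -> \bar R) : measurable_fun W G -> (forall q, 0 <= G q)%E ->
    (\int[lam2]_(q in W) G q =
     \int[lam2]_(p in V) (G (T1 p, T2 p) * (jacobian T1 T2 p)%:E))%E.
  move=> mG G0; pose G' := G \_ W.
  have mG' : measurable_fun [set: plane R] G' by exact/(measurable_restrictT _ mW).
  have G'0 q : (0 <= G' q)%E by rewrite /G' patchE; case: ifPn.
  transitivity (\int[lam2]_(q in W) G' q)%E.
    by apply: eq_integral => q qW; rewrite /G' patchE qW.
  rewrite -(ge0_change_of_variables D mG' G'0).
  apply: eq_integral => p /set_mem Vp.
  by rewrite /G' patchE (mem_set (diffeo_im D Vp)).
have mFE : measurable_fun W (EFin \o F) by exact/measurable_EFinP.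
rewrite /Rintegral; congr fine.
rewrite [LHS]integralE [RHS]integralE.
rewrite (part _ (measurable_funepos mFE)); last by move=> q; exact: funepos_ge0.
rewrite (part _ (measurable_funeneg mFE)); last by move=> q; exact: funeneg_ge0.
have posM (r j : R) : 0 <= j -> maxe (r * j)%:E 0 = (maxe r%:E 0 * j%:E)%E.
  move=> j0; rewrite -[0%E]/(0%:E) -!EFin_max -EFinM; congr EFin.
  by rewrite -[X in Num.max (r * j) X](mul0r j) maxr_pMl.
congr (_ - _)%E; apply: eq_integral => p /set_mem Vp;
  have J0 := ltW (diffeo_jacobian D Vp).
  by rewrite [RHS]funeposE [X in (X * _)%E]funeposE posM.
rewrite [RHS]funenegE [X in (X * _)%E]funenegE -posM//.
by congr (maxe _ _); rewrite /= mulNr.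
Qed.

Lemma open_setC_compact K : compact K -> open (~` K).
Proof.
move=> cK; apply: closed_openC; apply: (compact_closed _ cK).
exact: (@norm_hausdorff _ (R * R)%type).
Qed.

(** [U] and the complement of [K] are open and cover the plane; the extension is [g] on the former
    and 0 on the latter. *)
Lemma continuous_patch_compact U K (g : plane R -> R) :
  open U -> compact K -> K `<=` U ->
  (forall p, U p -> {for p, continuous g}) ->
  (forall p, U p -> ~ K p -> g p = 0) ->
  continuous (g \_ U).
Proof.
move=> oU cK KU cg gK p.
have oCK : open (~` K) by exact: open_setC_compact.
have [Kp|nKp] := pselect (K p).
  apply: (continuous_eq_on oU (KU _ Kp) _ (cg _ (KU _ Kp))) => q Uq.
  by rewrite patchE (mem_set Uq).
apply: (continuous_eq_on (g := cst 0) oCK nKp); last exact: cvg_cst.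
move=> q nKq; rewrite patchE; case: ifPn => [/set_mem Uq|_]; last by [].
exact: gK.
Qed.

Lemma compact_in_box K : compact K -> exists2 M : R, 0 < M &
  forall p, K p -> open_box (- M) M (- M) M p.
Proof.
move=> /compact_bounded[M [_ hM]].
exists (`|M| + 1) => [|p Kp]; first by rewrite ltr_wpDl.
(* [compact_bounded] gives every bound above [M]; the remaining half leaves room for the open
   box. *)
have := hM (`|M| + 1 / 2) ltac:(by rewrite (le_lt_trans (ler_norm M))// ltrDl) p Kp.
move=> pM; have {}pM : `|p| <= `|M| + 1 / 2 by exact: pM.
move: pM; rewrite prod_normE ge_max => /andP[p1 p2].
by apply/open_boxP; rewrite -!ltr_norml; split;
  [apply: (le_lt_trans p1)|apply: (le_lt_trans p2)]; rewrite ltrD2l; lra.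
Qed.

Lemma integrable_compact_support K (g : plane R -> R) :
  continuous g -> compact K -> (forall p, ~ K p -> g p = 0) ->
  lam2.-integrable [set: plane R] (EFin \o g).
Proof.
move=> cg cK gK.
have [M M0 KM] := compact_in_box cK.
pose B := open_box (- M) M (- M) M.
have mB : measurable B by apply: open_measurable_plane; exact: open_open_box.
have mg : measurable_fun [set: plane R] g.
  by apply: (continuous_measurable_plane openT) => p _; exact: cg.
have -> : EFin \o g = (EFin \o g) \_ B.
  apply/funext => p; rewrite patchE; case: ifPn => // /negP nB /=.
  by rewrite gK// => Kp; apply: nB; exact/mem_set/KM.
have mkc := @integrable_mkcond _ _ _ lam2 B (EFin \o g); apply/mkc; first exact: mB.
apply: measurable_bounded_integrable; first exact: mB.
- pose I := `]- M, M[%classic : set R.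
  have BE : lam2 B = (lam I * lam I)%E.
    by apply: product_measure1E; exact: (measurable_itv `]- M, M[).
  have IE : lam I = (M - - M)%:E.
    transitivity (lebesgue_measure I); first by [].
    by rewrite lebesgue_measure_itv /= lte_fin ifT// gtrN.
  by rewrite [ltLHS]BE IE -EFinM ltry.
- exact: measurable_funTS.
- have cgK : compact (g @` K).
    by apply: continuous_compact => //; exact: continuous_subspaceT.
  have [N [_ hN]] := compact_bounded cgK.
  exists (`|N| + 1); split; first exact: num_real.
  move=> x Nx p _ /=; have [Kp|nKp] := pselect (K p).
    apply: hN; last by exists p.
    by rewrite (le_lt_trans _ Nx)// (le_trans (ler_norm N))// lerDl.
  by rewrite gK// normr0 ltW// (le_lt_trans _ Nx)// addr_ge0.
Qed.

(** The fundamental theorem on [[- M, M]]: the endpoints lie outside the open interval, so [f]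
    vanishes there. *)
Lemma integral_derive_eq0 (f df : R -> R) (M : R) : 0 < M ->
  (forall x : R, is_derive x 1 f (df x)) -> continuous df ->
  (forall x, ~~ (- M < x < M) -> f x = 0 /\ df x = 0) ->
  (\int[lam]_x (df x)%:E = 0)%E.
Proof.
move=> M0 dfx cdf f0.
pose I := `[- M, M]%classic : set R.
transitivity (\int[lam]_(x in I) (df x)%:E)%E.
  rewrite [RHS]integral_mkcond; apply: eq_integral => x _.
  rewrite patchE; case: ifPn => // /negP nx.
  rewrite (f0 x _).2//; apply/negP => /andP[x1 x2]; apply: nx.
  by apply/mem_set; rewrite /I /= in_itv /= !ltW.
have cf x : {for x, continuous f}.
  have dz := dfx x; apply/differentiable_continuous/derivable1_diffP; exact: ex_derive.
rewrite /I (continuous_FTC2 (F := f)).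
- by rewrite (f0 M _).1 ?(f0 (- M) _).1 ?ltxx ?andbF// subee.
- by rewrite gtrN.
- by apply: continuous_subspaceT => x; exact: cdf.
- split.
  + by move=> x _; have dz := dfx x; exact: ex_derive.
  + by apply: cvg_at_right_filter; exact: cf.
  + by apply: cvg_at_left_filter; exact: cf.
- by move=> x _; have dz := dfx x; rewrite derive1E (@derive_val _ _ _ _ _ _ _ dz).
Qed.

Lemma derive_near0 U K (g : plane R -> R) v p : open U -> compact K ->
  (forall p, U p -> ~ K p -> g p = 0) -> U p -> ~ K p -> 'D_v g p = 0.
Proof.
move=> oU cK gK Up nKp.
have oCK : open (~` K) by exact: open_setC_compact.
transitivity ('D_v (cst (0 : R)) p); last exact: derive_cst.
apply: near_eq_derive.
have h1 : \forall q \near p, U q by apply: open_nbhs_nbhs.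
have h2 : \forall q \near p, (~` K) q by apply: open_nbhs_nbhs.
by move: h1 h2; apply: filterS2 => q; exact: gK.
Qed.

(** Extension by zero brings integrals over an arbitrary open set, whose slices may be complicated,
    back to Fubini over the whole plane. *)
Lemma C1_patch_compact U K (g : plane R -> R) :
  open U -> compact K -> K `<=` U -> C1_on U g ->
  (forall p, U p -> ~ K p -> g p = 0) ->
  C1_on [set: plane R] (g \_ U) /\ forall v p, U p -> 'D_v (g \_ U) p = 'D_v g p.
Proof.
move=> oU cK KU Cg gK.
have oCK : open (~` K) by exact: open_setC_compact.
have eqU p : U p -> \near p, g p = (g \_ U) p.
  move=> Up; have h1 : \forall q \near p, U q by apply: open_nbhs_nbhs.
  by apply: filterS h1 => q Uq; rewrite patchE (mem_set Uq).
have eqK p : ~ K p -> \near p, cst 0 p = (g \_ U) p.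
  move=> nKp; have h1 : \forall q \near p, (~` K) q by apply: open_nbhs_nbhs.
  apply: filterS h1 => q nKq; rewrite patchE; case: ifPn => [/set_mem Uq|_]; last by [].
  by rewrite gK.
have dE v p : U p -> 'D_v (g \_ U) p = 'D_v g p.
  by move=> Up; apply/esym/near_eq_derive; exact: eqU.
(* The derivative of the extension is the extension of the derivative, to which
   [continuous_patch_compact] applies again. *)
have dE' v : 'D_v (g \_ U) = ('D_v g) \_ U.
  apply/funext => p; rewrite patchE; case: ifPn => [/set_mem Up|/negP nUp]; first exact: dE.
  have nKp : ~ K p by move=> /KU /mem_set.
  transitivity ('D_v (cst (0 : R)) p); last exact: derive_cst.
  by apply/esym/near_eq_derive; exact: eqK.
split; last exact: dE.
have der v p : (U p -> derivable g p v) -> derivable (g \_ U) p v.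
  move=> dg; have [Kp|nKp] := pselect (K p).
    exact: (near_eq_derivable (eqU _ (KU _ Kp)) (dg (KU _ Kp))).
  exact: (near_eq_derivable (eqK _ nKp) (derivable_cst _ _ _)).
move=> p _; split.
- by apply: der => Up; exact: (C1_derivablex Cg Up).
- by apply: der => Up; exact: (C1_derivabley Cg Up).
- by apply: (continuous_patch_compact oU cK KU) => // q Uq; exact: (C1_continuous Cg Uq).
- rewrite dE'; apply: (continuous_patch_compact oU cK KU) => q Uq.
    exact: (C1_continuousx Cg Uq).
  by move=> nKq; exact: (derive_near0 vx oU cK gK Uq nKq).
- rewrite dE'; apply: (continuous_patch_compact oU cK KU) => q Uq.
    exact: (C1_continuousy Cg Uq).
  by move=> nKq; exact: (derive_near0 vy oU cK gK Uq nKq).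
Qed.

(** After extension by zero, Fubini integrates first in the direction of the derivative, where each
    line contributes 0. *)
Lemma integral_divergence_eq0 U K (g : plane R -> R) :
  open U -> compact K -> K `<=` U -> C1_on U g ->
  (forall p, U p -> ~ K p -> g p = 0) ->
  \int[lam2]_(p in U) 'D_vx g p = 0 /\ \int[lam2]_(p in U) 'D_vy g p = 0.
Proof.
move=> oU cK KU Cg gK.
have [C1 dE] := C1_patch_compact oU cK KU Cg gK.
pose G := g \_ U; rewrite -/G in C1 dE.
have [M M0 KM] := compact_in_box cK.
have GK p : ~ K p -> G p = 0.
  move=> nKp; rewrite /G patchE; case: ifPn => [/set_mem Up|_]; last by [].
  exact: gK.
have DGK v p : ~ K p -> 'D_v G p = 0.
  by move=> nKp; apply: (derive_near0 v openT cK _ Logic.I nKp) => q _; exact: GK.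
have toT v : \int[lam2]_(p in U) 'D_v g p = \int[lam2]_p 'D_v G p.
  rewrite Rintegral_mkcond; congr (Rintegral _ _ _); apply/funext => p.
  rewrite patchE; case: ifPn => [/set_mem Up|/negP nUp]; first by rewrite (dE v p Up).
  by apply/esym/DGK => /KU /mem_set.
have cX : continuous ('D_vx G) by move=> p; exact: (C1_continuousx C1 Logic.I).
have cY : continuous ('D_vy G) by move=> p; exact: (C1_continuousy C1 Logic.I).
have out (x y : R) : ~~ (- M < x < M) \/ ~~ (- M < y < M) -> ~ K (x, y).
  by move=> + /KM /open_boxP[/= h1 h2]; rewrite h1 h2 => -[].
split; rewrite toT /Rintegral.
  rewrite -(integral21_prod_meas1 (integrable_compact_support cX cK (DGK vx))).
  rewrite integral0_eq// => y _; rewrite /fubini_G /=.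
  apply: (integral_derive_eq0 (f := fun x => G (x, y)) M0) => x.
  - exact: (is_derive_slicex (C1_derivablex C1 (p := (x, y)) Logic.I)).
  - apply: (continuous_comp _ (cX (x, y))).
    by apply: (@continuous_pair_at R _ id (cst y)); [exact: cvg_id|exact: cvg_cst].
  - by move=> hx; split; [apply: GK|apply: DGK]; apply: out; left.
rewrite -(integral12_prod_meas1 (integrable_compact_support cY cK (DGK vy))).
rewrite integral0_eq// => x _; rewrite /fubini_F /=.
apply: (integral_derive_eq0 (f := fun y => G (x, y)) M0) => y.
- exact: (is_derive_slicey (C1_derivabley C1 (p := (x, y)) Logic.I)).
- apply: (continuous_comp _ (cY (x, y))).
  by apply: (@continuous_pair_at R _ (cst x) id); [exact: cvg_cst|exact: cvg_id].
- by move=> hy; split; [apply: GK|apply: DGK]; apply: out; right.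
Qed.

End CompactSupport.

(** * Conformal charts and the spinor *)

Section ComplexDifferentiability.
Context (R : realType).
Local Notation C := (R[i]).
Implicit Types (p q : plane R).

Definition cdiff (g : plane R -> C) p : Prop :=
  differentiable (fun q => complex.Re (g q)) p /\
  differentiable (fun q => complex.Im (g q)) p.

Lemma cdiff_cst (c : C) p : cdiff (fun=> c) p.
Proof. by split; exact: differentiable_cst. Qed.

Lemma cdiffD g h p : cdiff g p -> cdiff h p -> cdiff (fun q => g q + h q) p.
Proof.
move=> [g1 g2] [h1 h2]; split.
  rewrite (_ : (fun q => _) = (fun q => complex.Re (g q)) + (fun q => complex.Re (h q))).
    exact: differentiableD.
  by apply/funext => q; rewrite fctE; case: (g q) (h q) => ? ? [].
rewrite (_ : (fun q => _) = (fun q => complex.Im (g q)) + (fun q => complex.Im (h q))).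
  exact: differentiableD.
by apply/funext => q; rewrite fctE; case: (g q) (h q) => ? ? [].
Qed.

Lemma cdiffM g h p : cdiff g p -> cdiff h p -> cdiff (fun q => g q * h q) p.
Proof.
move=> [g1 g2] [h1 h2]; split.
  rewrite (_ : (fun q => _) = (fun q => complex.Re (g q)) * (fun q => complex.Re (h q)) -
      (fun q => complex.Im (g q)) * (fun q => complex.Im (h q))).
    by apply: differentiableB; exact: differentiableM.
  by apply/funext => q; rewrite !fctE; case: (g q) (h q) => ? ? [].
rewrite (_ : (fun q => _) = (fun q => complex.Re (g q)) * (fun q => complex.Im (h q)) +
    (fun q => complex.Im (g q)) * (fun q => complex.Re (h q))).
  by apply: differentiableD; exact: differentiableM.
by apply/funext => q; rewrite !fctE; case: (g q) (h q) => ? ? [].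
Qed.

Lemma cdiff_conj g p : cdiff g p -> cdiff (fun q => (g q)^*%C) p.
Proof.
move=> [g1 g2]; split.
  rewrite (_ : (fun q => _) = (fun q => complex.Re (g q))) //.
  by apply/funext => q; case: (g q).
rewrite (_ : (fun q => _) = - (fun q => complex.Im (g q))).
  exact: differentiableN.
by apply/funext => q; rewrite fctE; case: (g q).
Qed.

(** The square root is taken of a number at least 1, away from its singularity. *)
Lemma cdiff_diag (F : plane R -> SL2t R) p :
  cdiff (fun q => offdiag (F q)) p -> differentiable (fun q => angle (F q)) p ->
  cdiff (fun q => diag (F q)) p.
Proof.
move=> [b1 b2] dt; apply: cdiffM.
  split; last exact: differentiable_cst.
  pose s q := 1 + (complex.Re (offdiag (F q)) ^+ 2 + complex.Im (offdiag (F q)) ^+ 2).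
  have ds : differentiable s p.
    rewrite (_ : s = cst 1 +
      ((fun q => complex.Re (offdiag (F q))) * (fun q => complex.Re (offdiag (F q)))
      + (fun q => complex.Im (offdiag (F q))) * (fun q => complex.Im (offdiag (F q))))).
      apply: differentiableD; first exact: differentiable_cst.
      by apply: differentiableD; exact: differentiableM.
    by apply/funext => q; rewrite /s !fctE !expr2.
  have s0 : 0 < s p by rewrite /s ltr_wpDr// addr_ge0 ?sqr_ge0.
  have -> : (fun q => complex.Re ((Num.sqrt (1 + absq (offdiag (F q))))%:C)) = Num.sqrt \o s by [].
  apply: differentiable_comp => //; apply/derivable1_diffP.
  have h := is_derive1_sqrt s0; exact: ex_derive.
split.
  have -> : (fun q => complex.Re (expi (angle (F q)))) = cos \o (fun q => angle (F q)) by [].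
  apply: differentiable_comp => //; apply/derivable1_diffP; exact: ex_derive.
have -> : (fun q => complex.Im (expi (angle (F q)))) = sin \o (fun q => angle (F q)) by [].
apply: differentiable_comp => //; apply/derivable1_diffP; exact: ex_derive.
Qed.

(** Through [coverM] left translation becomes multiplication by a constant matrix, so the angle
    correction [rarg] in the group law need not be differentiated. *)
Lemma cdiff_cover_mul (x : SL2t R) (F : plane R -> SL2t R) p a b :
  cdiff (fun q => offdiag (F q)) p -> differentiable (fun q => angle (F q)) p ->
  cdiff (fun q => Defs.cover (x * F q)%g a b) p.
Proof.
move=> db dt; have dd := cdiff_diag db dt.
have dc c d : cdiff (fun q => Defs.cover (F q) c d) p.
  case: c => -[|[|//]] ?; case: d => -[|[|//]] ?.
  - by rewrite (_ : (fun q => _) = (fun q => diag (F q)))//; apply/funext => q; rewrite mxE.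
  - by rewrite (_ : (fun q => _) = (fun q => offdiag (F q)))//; apply/funext => q; rewrite mxE.
  - rewrite (_ : (fun q => _) = (fun q => (offdiag (F q))^*%C)); first exact: cdiff_conj.
    by apply/funext => q; rewrite mxE.
  - rewrite (_ : (fun q => _) = (fun q => (diag (F q))^*%C)); first exact: cdiff_conj.
    by apply/funext => q; rewrite mxE.
rewrite (_ : (fun q => _) = (fun q => Defs.cover x a 0 * Defs.cover (F q) 0 b +
    Defs.cover x a (lift ord0 ord0) * Defs.cover (F q) (lift ord0 ord0) b)).
  by apply: cdiffD; apply: cdiffM => //; exact: cdiff_cst.
by apply/funext => q; rewrite coverM mxE big_ord_recl big_ord1.
Qed.

Lemma cderive_near_eq (g h : plane R -> C) v p :
  (\near p, g p = h p) -> cderive v g p = cderive v h p.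
Proof.
move=> gh; congr (_ +i* _); apply: near_eq_derive;
  by apply: filterS gh => q ->.
Qed.

Lemma cderive_comp (g : plane R -> C) (u1 u2 : plane R -> R) v p :
  cdiff g (u1 p, u2 p) -> differentiable u1 p -> differentiable u2 p ->
  cderive v (fun q => g (u1 q, u2 q)) p =
  ('D_v u1 p)%:C * cderive vx g (u1 p, u2 p) + ('D_v u2 p)%:C * cderive vy g (u1 p, u2 p).
Proof.
move=> [g1 g2] d1 d2; rewrite /cderive.
rewrite (derive_comp_plane v g1 d1 d2) (derive_comp_plane v g2 d1 d2).
set a := 'D_v u1 p; set b := 'D_v u2 p.
move: ('D_vx _ _) ('D_vy _ _) ('D_vx _ _) ('D_vy _ _) => c d e h.
by apply/eqP; rewrite eq_complex /=; apply/andP; split; apply/eqP; ring.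
Qed.

End ComplexDifferentiability.

(** * Orientation-preserving conformal maps are holomorphic *)

Section Conformality.
Context (R : realType).
Local Notation C := (R[i]).

Lemma metric_comb (X Y : 'M[C]_2) (a b c d : C) :
  metric (a *: X + b *: Y) (c *: X + d *: Y) =
  a * c * metric X X + (a * d + b * c) * metric X Y + b * d * metric Y Y.
Proof.
have coordD (k : 'I_3) (s t : C) :
    Defs.coord (s *: X + t *: Y) k = s * Defs.coord X k + t * Defs.coord Y k.
  by rewrite /Defs.coord /triple !mxE; case: (val k) => [|[|?]]; ring.
rewrite /metric !big_ord_recl !big_ord0 !coordD; ring.
Qed.

(** [(a, b)] and [(c, d)] are orthogonal of equal length, so Lagrange's identity makes the
    determinant plus or minus their squared length. Positivity selects the sign, and then
    [(c + b) ^+ 2 + (d - a) ^+ 2] vanishes. *)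
Lemma conformal_CR (E E' a b c d : R) : 0 < E ->
  (a ^+ 2 + b ^+ 2) * E = E' -> (c ^+ 2 + d ^+ 2) * E = E' ->
  (a * c + b * d) * E = 0 -> 0 < a * d - c * b -> c = - b /\ d = a.
Proof.
move=> E0 h1 h2 /eqP; rewrite mulf_eq0 (gt_eqF E0) orbF => /eqP h3 h4.
have s : a ^+ 2 + b ^+ 2 = c ^+ 2 + d ^+ 2.
  by apply: (mulIf (lt0r_neq0 E0)); rewrite h1 h2.
have e2 : (a * d - c * b) ^+ 2 = (a ^+ 2 + b ^+ 2) ^+ 2.
  transitivity ((a ^+ 2 + b ^+ 2) * (c ^+ 2 + d ^+ 2) - (a * c + b * d) ^+ 2); first by ring.
  by rewrite h3 -s; ring.
have e1 : a * d - c * b = a ^+ 2 + b ^+ 2.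
  apply/eqP; rewrite -(eqrXn2 (n := 2))// ?e2//; first exact: ltW.
  by rewrite addr_ge0 ?sqr_ge0.
have : (c + b) ^+ 2 + (d - a) ^+ 2 = 0.
  transitivity ((a ^+ 2 + b ^+ 2) + (c ^+ 2 + d ^+ 2) - 2 * (a * d - c * b)); first by ring.
  by rewrite -s e1; ring.
move=> /eqP; rewrite paddr_eq0 ?sqr_ge0// !sqrf_eq0 addr_eq0 subr_eq0.
by move=> /andP[/eqP-> /eqP->].
Qed.

Lemma conformal_transition (X Y X' Y' : 'M[C]_2) (a b c d E E' : R) :
  X' = a%:C *: X + b%:C *: Y -> Y' = c%:C *: X + d%:C *: Y ->
  [/\ metric X X = E%:C, metric Y Y = E%:C & metric X Y = 0] ->
  [/\ metric X' X' = E'%:C, metric Y' Y' = E'%:C & metric X' Y' = 0] ->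
  0 < E -> 0 < a * d - c * b -> c = - b /\ d = a.
Proof.
move=> -> -> [XX YY XY] [eX eY eXY] E0 jac.
have toR (x y : R) : x%:C = y%:C -> x = y by case.
have hX := metric_comb X Y a%:C b%:C a%:C b%:C.
have hY := metric_comb X Y c%:C d%:C c%:C d%:C.
have hXY := metric_comb X Y a%:C b%:C c%:C d%:C.
rewrite eX XX YY XY in hX; rewrite eY XX YY XY in hY; rewrite eXY XX YY XY in hXY.
apply: (@conformal_CR E E') => //; apply: toR.
- by rewrite hX !(rmorphM, rmorphD) /=; ring.
- by rewrite hY !(rmorphM, rmorphD) /=; ring.
- by rewrite [RHS]hXY !(rmorphM, rmorphD) /=; ring.
Qed.

(** The Cauchy-Riemann equations turn the real chain rule into multiplication of the z-derivative by
    the complex derivative. The constant [k] is the factor by which a coordinate is read off a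
    matrix entry. *)
Lemma holomorphic_d_z (k x y x' y' s s' : C) (a b c d : R) : c = - b -> d = a ->
  s = k * (2^-1 * (x - 'i * y)) -> s' = k * (2^-1 * (x' - 'i * y')) ->
  x' = a%:C * x + b%:C * y -> y' = c%:C * x + d%:C * y ->
  s' = (a +i* b) * s.
Proof.
move=> -> -> -> -> -> ->.
have -> : a +i* b = a%:C + 'i * b%:C.
  by apply/eqP; rewrite eq_complex /=; apply/andP; split; apply/eqP; ring.
have i2 : 'i * 'i = -1 :> C by rewrite -expr2 sqr_i.
rewrite rmorphN /=.
transitivity (k * (2^-1 * (a%:C * x - ('i * 'i) * b%:C * y + 'i * b%:C * x - 'i * a%:C * y))).
  by rewrite i2; ring.
by ring.
Qed.

Lemma left_derivE (F : plane R -> SL2t R) v p a b : left_deriv F v p a b =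
  cderive v (fun q => Defs.cover ((F p)^-1 * F q)%g a b) p.
Proof. by rewrite mxE. Qed.

Lemma left_d_zE (F : plane R -> SL2t R) p a b : left_d_z F p a b =
  2^-1 * (left_deriv F vx p a b - 'i * left_deriv F vy p a b).
Proof.
transitivity (d_z (fun q => Defs.cover ((F p)^-1 * F q)%g a b) p); first by rewrite mxE.
by congr (2^-1 * (_ - 'i * _)); apply/esym; exact: left_derivE.
Qed.

Lemma mx_combE (X Y : 'M[C]_2) (s t : C) a b :
  (s *: X + t *: Y) a b = s * X a b + t * Y a b.
Proof. by rewrite !mxE. Qed.

End Conformality.

(** * The third component of the mean curvature equation *)

Section MeanCurvature.
Context (R : realType).
Local Notation C := (R[i]).

Lemma coord_e_delta (k l : 'I_3) : Defs.coord (e_ R k) l = (k == l)%:R.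
Proof.
by case: k => -[|[|[|//]]] ?; case: l => -[|[|[|//]]] ?;
  rewrite /Defs.coord /e_ /f_ /triple /= !mxE /=; apply/eqP; rewrite eq_complex /=;
  apply/andP; split; apply/eqP; field.
Qed.

Lemma metric_e (A : 'M[C]_2) (l : 'I_3) : metric A (e_ R l) = Defs.coord A l.
Proof.
rewrite /metric (bigD1 l)//= coord_e_delta eqxx mulr1 big1 ?addr0// => k kl.
by rewrite coord_e_delta eq_sym (negbTE kl) mulr0.
Qed.

Lemma coordZ (c : C) (A : 'M[C]_2) k : Defs.coord (c *: A) k = c * Defs.coord A k.
Proof. by rewrite /Defs.coord /triple !mxE; case: (val k) => [|[|?]]; ring. Qed.

Lemma bracket3E (j k m l : 'I_3) (c : C) : bracket (e_ R j) (e_ R k) = c *: e_ R m ->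
  bracket3 R j k l = c * (m == l)%:R.
Proof.
move=> e; transitivity (Defs.coord (bracket (e_ R j) (e_ R k)) l); first exact: metric_e.
transitivity (Defs.coord (c *: e_ R m) l); first by congr (Defs.coord _ _).
by rewrite coordZ; congr (_ * _); exact: coord_e_delta.
Qed.

Lemma bracket3C (j k l : 'I_3) : bracket3 R j k l = - bracket3 R k j l.
Proof.
rewrite /bracket3; move: (e_ R j) (e_ R k) => A B.
transitivity (Defs.coord (bracket A B) l); first exact: metric_e.
transitivity (Defs.coord (-1 *: bracket B A) l).
  by congr (Defs.coord _ _); rewrite /bracket scaleN1r opprB.
by rewrite coordZ mulN1r; congr (- _); apply/esym; exact: metric_e.
Qed.

Lemma bracket3_values (l : 'I_3) :
  [/\ bracket3 R 0 1 l = - 2 * (2 == l)%:R,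
      bracket3 R 0 2 l = - 2^-1 * (1 == l)%:R &
      bracket3 R 1 2 l = 2^-1 * (0 == l)%:R].
Proof.
have [e01 e02 e12] := bracket_e R.
by split; [exact: bracket3E e01|exact: bracket3E e02|exact: bracket3E e12].
Qed.

Lemma bracket3_diag (j l : 'I_3) : bracket3 R j j l = 0.
Proof.
have -> : bracket3 R j j l = 0 * (0 == l)%:R; last by rewrite mul0r.
by apply: bracket3E; rewrite /bracket subrr scale0r.
Qed.

(* The antisymmetry in the first two indices expresses that the left-invariant
   field e_3 is Killing. *)
Lemma Gamma2_values : [/\ Gamma R 0 1 2 = -1, Gamma R 1 0 2 = 1 &
  forall j k, (j, k) != (0, 1) -> (j, k) != (1, 0) -> Gamma R j k 2 = 0].
Proof.
have h (l : 'I_3) := bracket3_values l.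
have I3 (u : 'I_3) : [\/ u = 0, u = 1 | u = 2].
  by case: u => -[|[|[|//]]] ?; [apply: Or31|apply: Or32|apply: Or33]; apply/val_inj.
split.
- rewrite /Gamma (bracket3C 2 0).
  by have [-> _ _] := h 2; have [_ _ ->] := h 0; have [_ -> _] := h 1; rewrite /=; field.
- rewrite /Gamma (bracket3C 1 0) (bracket3C 2 1).
  by have [-> _ _] := h 2; have [_ _ ->] := h 0; have [_ -> _] := h 1; rewrite /=; field.
move=> j k; case: (I3 j) => ->; case: (I3 k) => -> //; move=> _ _;
  rewrite /Gamma ?bracket3_diag ?(bracket3C 2 0) ?(bracket3C 2 1).
- by have [_ -> _] := h 0; rewrite /= mulr0 oppr0 !addr0 ?subr0 mulr0.
- by have [_ -> _] := h 2; rewrite /= !mulr0 ?oppr0 ?addr0 ?mulr0.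
- by have [_ _ ->] := h 1; rewrite /= mulr0 oppr0 !addr0 ?subr0 mulr0.
- by have [_ _ ->] := h 2; rewrite /= !mulr0 ?oppr0 ?addr0 ?mulr0.
- by have [_ -> _] := h 2; rewrite /= !mulr0 ?oppr0 ?addr0 ?mulr0.
- by have [_ _ ->] := h 2; rewrite /= !mulr0 ?oppr0 ?addr0 ?mulr0.
- by rewrite !addr0 ?subr0 mulr0.
Qed.

Lemma sum_ord3 (F : 'I_3 -> C) : \sum_k F k = F 0 + F 1 + F 2.
Proof.
rewrite !big_ord_recl big_ord0 addr0 addrA.
by congr (_ + _ + _); congr F; exact: val_inj.
Qed.

(** The right-hand side is a number minus its conjugate, hence purely imaginary: the connection will
    not contribute to the real part of the equation. *)
Lemma sum_antisym (z : 'I_3 -> C) (G : 'I_3 -> 'I_3 -> C) :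
  G 0 1 = -1 -> G 1 0 = 1 ->
  (forall j k, (j, k) != (0, 1) -> (j, k) != (1, 0) -> G j k = 0) ->
  \sum_j \sum_k (z j)^*%C * z k * G j k = (z 1)^*%C * z 0 - (z 0)^*%C * z 1.
Proof.
move=> g01 g10 g0; rewrite !sum_ord3 g01 g10.
by rewrite (g0 0 0)// (g0 0 2)// (g0 1 1)// (g0 1 2)// (g0 2 0)// (g0 2 1)// (g0 2 2)//; ring.
Qed.

(** The left-hand side is twice the real part of the zbar-derivative of [Z_3]. On the right the
    conformal factor cancels against the one in [normal], leaving a polynomial identity in the
    spinor. *)
Lemma mean_curvature_divergence (psi1 psi2 : plane R -> C) (alpha H : R) (p : plane R) :
  let Z := Z_ psi1 psi2 in
  nabla_zbar_z Z p 2 =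
    2^-1 * (expR (2 * alpha) * H)%:C * normal (fun=> alpha) Z p 2 ->
  'D_vx (fun q => complex.Re (Z q 2)) p - 'D_vy (fun q => complex.Im (Z q 2)) p =
  H * (absq (psi2 p) ^+ 2 - absq (psi1 p) ^+ 2).
Proof.
move=> Z /(congr1 (@complex.Re R)).
have [g01 g10 g0] := Gamma2_values.
have -> : nabla_zbar_z Z p 2 = d_zbar (fun q => Z q 2) p +
    ((Z p 1)^*%C * Z p 0 - (Z p 0)^*%C * Z p 1).
  rewrite /nabla_zbar_z; congr (_ + _).
  exact: (@sum_antisym (Z p) (fun j k => Gamma R j k 2) g01 g10 g0).
rewrite /normal.
have e1 : expR (2 * alpha) * expR (- (2 * alpha)) = 1 :> R by rewrite -expRD subrr expR0.
have -> : 2^-1 * (expR (2 * alpha) * H)%:C *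
   (2 * 'i * (expR (- (2 * alpha)))%:C * triple ((Z p 1)^*%C * Z p 2 - Z p 1 * (Z p 2)^*%C)
         ((Z p 2)^*%C * Z p 0 - Z p 2 * (Z p 0)^*%C)
         ((Z p 0)^*%C * Z p 1 - Z p 0 * (Z p 1)^*%C) 2) =
   H%:C * ('i * ((Z p 0)^*%C * Z p 1 - Z p 0 * (Z p 1)^*%C)).
  rewrite /triple /= rmorphM /=.
  transitivity ((expR (2 * alpha) * expR (- (2 * alpha)))%:C * H%:C *
    ('i * ((Z p 0)^*%C * Z p 1 - Z p 0 * (Z p 1)^*%C))); last by rewrite e1 mul1r.
  by rewrite rmorphM /=; field.
rewrite /d_zbar /cderive.
set X := 'D_vx _ p; set X' := 'D_vx _ p; set Y := 'D_vy _ p; set Y' := 'D_vy _ p.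
rewrite /Z /Z_ /triple /=; move: X X' Y Y' => X X' Y Y'.
case: (psi1 p) (psi2 p) => a1 a2 [b1 b2]; rewrite /absq /= => h.
move: h; rewrite !(mul0r, mul1r, mulr0, subr0, sub0r, addr0, add0r).
set L := (X in X = _); set Q := (X in _ = X) => h.
(* Simplification unfolds the complex number [2^-1] into the quotient that defines the inverse; it
   is folded back into a real [2^-1]. *)
have half : (1 + 1) / ((1 + 1) ^+ 2 + 0 ^+ 2) = 2^-1 :> R by field.
have eL : L = 2^-1 * (X - Y') by rewrite /L {L h} half; field.
have eQ : Q = 2^-1 * (H * ((b1 ^+ 2 + b2 ^+ 2) ^+ 2 - (a1 ^+ 2 + a2 ^+ 2) ^+ 2)).
  by rewrite /Q {Q h} half; field.
by apply: (@mulfI _ 2^-1); [rewrite invr_eq0 pnatr_eq0|rewrite -eL h eQ].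
Qed.

End MeanCurvature.

(** * Overlaps and transition maps *)

Section Atlas.
Context (R : realType) (M : topologicalType) (A : oriented_atlas R M).
Implicit Types (i j : chart A) (p q : plane R) (m : M).

Lemma img_iparam i p : img i p ->
  dom i (iparam i p) /\ param i (iparam i p) = p.
Proof. by move=> [m im <-]; rewrite (paramK im). Qed.

Lemma iparam_continuous_at i p : img i p -> {for p, continuous (iparam i)}.
Proof.
move=> ip; have := @iparam_continuous _ _ A i.
rewrite continuous_open_subspace; last exact: img_open.
by move=> /(_ p); apply; rewrite inE.
Qed.

Definition overlap i j : set (plane R) := param i @` (dom i `&` dom j).

Lemma overlapP i j p : overlap i j p <-> img i p /\ dom j (iparam i p).
Proof.
split=> [[m [im jm] <-]|[[m im <-]]]; first by split; [exists m|rewrite (paramK im)].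
by rewrite (paramK im) => jm; exists m.
Qed.

Lemma open_img_preimage i (B : set M) : open B ->
  open [set p | img i p /\ B (iparam i p)].
Proof.
move=> oB; rewrite openE => p [ip Bp].
have h1 : \forall q \near p, img i q.
  by apply: open_nbhs_nbhs; split => //; exact: img_open.
have h2 : \forall q \near p, B (iparam i q).
  by apply: (iparam_continuous_at ip); apply: open_nbhs_nbhs.
suff : \forall q \near p, [set p | img i p /\ B (iparam i p)] q by [].
by move: h1 h2; apply: filterS2.
Qed.

Lemma open_overlap i j : open (overlap i j).
Proof.
have -> : overlap i j = [set p | img i p /\ dom j (iparam i p)].
  by apply/seteqP; split => p /overlapP.
by apply: open_img_preimage; exact: dom_open.
Qed.

Definition transition i j p : plane R := param j (iparam i p).

Lemma iparam_transition i j p : overlap i j p ->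
  iparam j (transition i j p) = iparam i p.
Proof. by move=> /overlapP[_ jm]; rewrite /transition (paramK jm). Qed.

Lemma transition_overlap i j p : overlap i j p -> overlap j i (transition i j p).
Proof.
move=> /overlapP[ip jm]; have [im _] := img_iparam ip.
by exists (iparam i p).
Qed.

Lemma transitionK i j p : overlap i j p -> transition j i (transition i j p) = p.
Proof.
move=> op; have /overlapP[ip _] := op.
by rewrite {1}/transition (iparam_transition op); have [] := img_iparam ip.
Qed.

Lemma diffeo_transition i j : C1_diffeo (overlap i j) (overlap j i)
  (fun p => (transition i j p).1) (fun p => (transition i j p).2)
  (fun q => (transition j i q).1) (fun q => (transition j i q).2).
Proof.
have eta i' j' p : ((transition i' j' p).1, (transition i' j' p).2) = transition i' j' p.
  by case: transition.
have [s1 s2] := @transition_smooth _ _ A i j; have [s3 s4] := @transition_smooth _ _ A j i.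
split.
- exact: open_overlap.
- exact: open_overlap.
- exact: (smooth_on_C1 s1).
- exact: (smooth_on_C1 s2).
- exact: (smooth_on_C1 s3).
- exact: (smooth_on_C1 s4).
- by move=> p op; rewrite eta; exact: transition_overlap.
- by move=> p op; rewrite eta; exact: transition_overlap.
- by move=> p op; rewrite !eta; exact: transitionK.
- by move=> p op; rewrite !eta; exact: transitionK.
- by move=> p op; exact: (transition_oriented op).
Qed.

End Atlas.

(** * Transformation of Z_3 and of the flux between charts *)

Section SpinorTransition.
Context (R : realType) (M : topologicalType) (A : oriented_atlas R M).
Local Notation C := (R[i]).
Implicit Types (i j : chart A) (p q : plane R).
Variables (f : M -> SL2t R) (alpha : chart A -> plane R -> R).
Variables (psi1 psi2 : chart A -> plane R -> C).
Hypothesis f_immersion : conformal_immersion f alpha.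
Hypothesis psi_spinor : generating_spinor f psi1 psi2.

Let F i q := f (iparam i q).

(** This is [Z_3], which does not depend on the common sign of the spinor chosen in each chart. *)
Definition spinor_product i p : C := psi1 i p * (psi2 i p)^*%C.

(** Only the third basis vector has a nonzero diagonal, so the top left entry isolates [Z_3]. *)
Lemma spinor_sum_00 (z : 'I_3 -> C) : (\sum_k z k *: e_ R k) 0 0 = z 2 * (2^-1 * ('i / 2)).
Proof.
have e0 : e_ R 0 0 0 = 0 by rewrite !mxE /= mulr0.
have e1 : e_ R 1 0 0 = 0 by rewrite !mxE /= mulr0.
have e2 : e_ R 2 0 0 = 2^-1 * ('i / 2) by rewrite !mxE.
transitivity (\sum_k z k * e_ R k 0 0).
  by rewrite summxE; apply: eq_bigr => k _; rewrite mxE.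
by rewrite sum_ord3 e0 e1 e2 !mulr0 !add0r.
Qed.

(** The spinors of two charts are related only through [f]; expressing their product by the
    derivative of [f] gives access to the chain rule. *)
Lemma spinor_productE i p : img i p ->
  spinor_product i p = - (4 * 'i) * left_d_z (F i) p 0 0.
Proof.
move=> ip; have [_ _ ->//] := psi_spinor i.
have i2 : 'i * 'i = -1 :> C by rewrite -expr2 sqr_i.
have zE : Z_ (psi1 i) (psi2 i) p 2 = spinor_product i p by [].
rewrite spinor_sum_00 zE; transitivity (- ('i * 'i) * spinor_product i p).
  by rewrite i2 opprK mul1r.
by field.
Qed.

Let cdiff_F i p x a b : img i p -> cdiff (fun q => Defs.cover (x * F i q)%g a b) p.
Proof.
move=> ip; have [sm _] := f_immersion; have [[s1 s2] s3] := sm i.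
have oi : open (img i) by exact: img_open.
apply: cdiff_cover_mul.
  split.
    exact: (C1_differentiable oi (smooth_on_C1 s1) ip).
  exact: (C1_differentiable oi (smooth_on_C1 s2) ip).
exact: (C1_differentiable oi (smooth_on_C1 s3) ip).
Qed.

Let T1 i j p := (transition i j p).1.
Let T2 i j p := (transition i j p).2.

(** The translating element is the value of [f] at one point of [M], the same in both charts, so
    each matrix entry obeys the ordinary chain rule. *)
Lemma left_deriv_transition i j v p : overlap i j p ->
  left_deriv (F i) v p =
  ('D_v (T1 i j) p)%:C *: left_deriv (F j) vx (transition i j p) +
  ('D_v (T2 i j) p)%:C *: left_deriv (F j) vy (transition i j p).
Proof.
move=> op; apply/matrixP => a b.
have D := diffeo_transition i j.
have oV := diffeo_openV D.
have d1 := C1_differentiable oV (diffeo_T1 D) op.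
have d2 := C1_differentiable oV (diffeo_T2 D) op.
have Fp q : overlap i j q -> F i q = F j (transition i j q).
  by move=> oq; rewrite /F iparam_transition.
have eta q : (T1 i j q, T2 i j q) = transition i j q by rewrite /T1 /T2; case: transition.
pose g r := Defs.cover ((F j (transition i j p))^-1 * F j r)%g a b.
transitivity (cderive v (fun q => g (T1 i j q, T2 i j q)) p).
  apply: (etrans (left_derivE (F i) v p a b)); apply: cderive_near_eq.
  have h : \forall q \near p, overlap i j q by apply: open_nbhs_nbhs.
  by apply: filterS h => q oq; rewrite /g eta (Fp _ op) (Fp _ oq).
have cg : cdiff g (T1 i j p, T2 i j p).
  rewrite eta; apply: cdiff_F; have /transition_overlap/overlapP[] := op; done.
transitivity (('D_v (T1 i j) p)%:C * cderive vx g (transition i j p) +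
    ('D_v (T2 i j) p)%:C * cderive vy g (transition i j p)).
  by rewrite (cderive_comp v cg d1 d2) eta.
apply/esym; apply: (etrans (mx_combE _ _ _ _ _ _)).
by congr (_ * _ + _ * _); exact: left_derivE.
Qed.

Lemma transition_CR i j p : overlap i j p ->
  'D_vy (T1 i j) p = - 'D_vx (T2 i j) p /\ 'D_vy (T2 i j) p = 'D_vx (T1 i j) p.
Proof.
move=> op; have [_ conf] := f_immersion.
have /overlapP[ip _] := op; have /overlapP[jp _] := transition_overlap op.
exact: (conformal_transition (left_deriv_transition vx op) (left_deriv_transition vy op)
  (conf j _ jp) (conf i p ip) (expR_gt0 _) (diffeo_jacobian (diffeo_transition i j) op)).
Qed.

Lemma spinor_product_transition i j p : overlap i j p ->
  spinor_product i p = ('D_vx (T1 i j) p +i* 'D_vx (T2 i j) p) *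
    spinor_product j (transition i j p).
Proof.
move=> op; have /overlapP[ip _] := op; have /overlapP[jp _] := transition_overlap op.
have [c d] := transition_CR op.
pose k : C := - (4 * 'i).
have ei := etrans (spinor_productE ip) (congr1 ( *%R k) (left_d_zE (F i) p 0 0)).
have ej := etrans (spinor_productE jp) (congr1 ( *%R k) (left_d_zE (F j) (transition i j p) 0 0)).
have entry v := etrans (congr1 (fun X : 'M[C]_2 => X 0 0) (left_deriv_transition v op))
  (mx_combE _ _ _ _ _ _).
exact: (holomorphic_d_z c d ej ei (entry vx) (entry vy)).
Qed.

(* The coefficient in the chart [i] of the global 2-form dr /\ eta, with eta the
   conjugate of the 1-form Re (Z_3 dz). *)
Definition flux i (r : M -> R) p : R :=
  'D_vx (fun q => r (iparam i q)) p * complex.Re (spinor_product i p) -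
  'D_vy (fun q => r (iparam i q)) p * complex.Im (spinor_product i p).

(** The flux is twice the real part of the zbar-derivative of [r] times [Z_3]. The transition
    contributes the conjugate of its complex derivative to the first factor and the derivative
    itself to the second; their product is the Jacobian. *)
Lemma flux_transition i j (r : M -> R) p : overlap i j p ->
  C1_on (img j) (fun q => r (iparam j q)) ->
  flux i r p = flux j r (transition i j p) * jacobian (T1 i j) (T2 i j) p.
Proof.
move=> op Cr; have /overlapP[jp _] := transition_overlap op.
have D := diffeo_transition i j; have oV := diffeo_openV D.
have d1 := C1_differentiable oV (diffeo_T1 D) op.
have d2 := C1_differentiable oV (diffeo_T2 D) op.
have eta q : (T1 i j q, T2 i j q) = transition i j q by rewrite /T1 /T2; case: transition.
have dr := C1_differentiable (@img_open _ _ A j) Cr jp.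
have dE v : 'D_v (fun q => r (iparam i q)) p =
    'D_v (T1 i j) p * 'D_vx (fun q => r (iparam j q)) (transition i j p) +
    'D_v (T2 i j) p * 'D_vy (fun q => r (iparam j q)) (transition i j p).
  rewrite -eta in dr; rewrite -[in RHS]eta -(derive_comp_plane v dr d1 d2).
  apply: near_eq_derive.
  have h : \forall q \near p, overlap i j q by apply: open_nbhs_nbhs.
  by apply: filterS h => q oq; rewrite -(iparam_transition oq) -eta.
rewrite /flux !dE (spinor_product_transition op) /jacobian.
have [-> ->] := transition_CR op.
move: ('D_vx (T1 i j) p) ('D_vx (T2 i j) p) => a b.
move: ('D_vx _ _) ('D_vy _ _) => rx ry.
by case: (spinor_product j _) => P Q /=; ring.
Qed.

End SpinorTransition.

(** * The energy integral *)

Section C1Algebra.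
Context (R : realType).
Local Notation lam := (@lebesgue_measure R).
Local Notation lam2 := (lam \x lam)%E.
Implicit Types (p q : plane R) (U : set (plane R)) (g h : plane R -> R).

Lemma C1_onD U g h : open U -> C1_on U g -> C1_on U h -> C1_on U (fun p => g p + h p).
Proof.
move=> oU Cg Ch.
have dE v p : derivable g p v -> derivable h p v ->
    'D_v (fun p => g p + h p) p = 'D_v g p + 'D_v h p by exact: deriveD.
move=> p Up.
have [gx hx] := (C1_derivablex Cg Up, C1_derivablex Ch Up).
have [gy hy] := (C1_derivabley Cg Up, C1_derivabley Ch Up).
split.
- exact: (derivableD gx hx).
- exact: (derivableD gy hy).
- exact: (cvgD (C1_continuous Cg Up) (C1_continuous Ch Up)).
- apply: (continuous_eq_on oU Up (fun q Uq => dE _ _ (C1_derivablex Cg Uq) (C1_derivablex Ch Uq))).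
  exact: (cvgD (C1_continuousx Cg Up) (C1_continuousx Ch Up)).
- apply: (continuous_eq_on oU Up (fun q Uq => dE _ _ (C1_derivabley Cg Uq) (C1_derivabley Ch Uq))).
  exact: (cvgD (C1_continuousy Cg Up) (C1_continuousy Ch Up)).
Qed.

Lemma derive_mul g h v p : derivable g p v -> derivable h p v ->
  'D_v (fun p => g p * h p) p = 'D_v g p * h p + g p * 'D_v h p.
Proof.
move=> dg dh; transitivity (g p *: 'D_v h p + h p *: 'D_v g p); first exact: (deriveM dg dh).
by rewrite addrC [h p *: _]mulrC.
Qed.

Lemma C1_onM U g h : open U -> C1_on U g -> C1_on U h -> C1_on U (fun p => g p * h p).
Proof.
move=> oU Cg Ch p Up.
have [gx hx] := (C1_derivablex Cg Up, C1_derivablex Ch Up).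
have [gy hy] := (C1_derivabley Cg Up, C1_derivabley Ch Up).
have [cg ch] := (C1_continuous Cg Up, C1_continuous Ch Up).
split.
- exact: (derivableM gx hx).
- exact: (derivableM gy hy).
- exact: (cvgM cg ch).
- apply: (continuous_eq_on oU Up
    (fun q Uq => derive_mul (C1_derivablex Cg Uq) (C1_derivablex Ch Uq))).
  exact: (cvgD (cvgM (C1_continuousx Cg Up) ch) (cvgM cg (C1_continuousx Ch Up))).
- apply: (continuous_eq_on oU Up
    (fun q Uq => derive_mul (C1_derivabley Cg Uq) (C1_derivabley Ch Uq))).
  exact: (cvgD (cvgM (C1_continuousy Cg Up) ch) (cvgM cg (C1_continuousy Ch Up))).
Qed.

Lemma C1_onN U g : open U -> C1_on U g -> C1_on U (fun p => - g p).
Proof.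
move=> oU Cg p Up.
have gx := C1_derivablex Cg Up; have gy := C1_derivabley Cg Up.
split.
- exact: (derivableN gx).
- exact: (derivableN gy).
- exact: (cvgN (C1_continuous Cg Up)).
- apply: (continuous_eq_on oU Up (fun q Uq => deriveN (C1_derivablex Cg Uq))).
  exact: (cvgN (C1_continuousx Cg Up)).
- apply: (continuous_eq_on oU Up (fun q Uq => deriveN (C1_derivabley Cg Uq))).
  exact: (cvgN (C1_continuousy Cg Up)).
Qed.

Lemma derive_big_sum (I : Type) (r : seq I) (F : I -> plane R -> R) v p :
  (forall i, derivable (F i) p v) ->
  derivable (fun q => \sum_(i <- r) F i q) p v /\
  'D_v (fun q => \sum_(i <- r) F i q) p = \sum_(i <- r) 'D_v (F i) p.
Proof.
move=> dF; elim: r => [|i r [dr er]].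
  have -> : (fun q => \sum_(i <- [::]) F i q) = cst 0 by apply/funext => q; rewrite big_nil.
  by split; [exact: derivable_cst|rewrite big_nil; exact: derive_cst].
have -> : (fun q => \sum_(j <- i :: r) F j q) = (fun q => F i q + \sum_(j <- r) F j q).
  by apply/funext => q; rewrite big_cons.
split; first exact: (derivableD (dF i) dr).
transitivity ('D_v (F i) p + 'D_v (fun q => \sum_(j <- r) F j q) p).
  exact: (deriveD (dF i) dr).
by rewrite er big_cons.
Qed.

Lemma integrable_on_compact U K g : open U -> compact K -> K `<=` U ->
  (forall p, U p -> {for p, continuous g}) ->
  (forall p, U p -> ~ K p -> g p = 0) -> lam2.-integrable U (EFin \o g).
Proof.
move=> oU cK KU cg gK.
have mkc := @integrable_mkcond _ _ _ lam2 U (EFin \o g).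
apply/mkc; first exact: (open_measurable_plane oU).
have -> : (EFin \o g) \_ U = EFin \o (g \_ U).
  by apply/funext => p; rewrite /comp !patchE; case: ifPn.
apply: (integrable_compact_support _ cK); first exact: (continuous_patch_compact oU cK KU).
move=> p nKp; rewrite patchE; case: ifPn => [/set_mem Up|_]; last by [].
exact: gK.
Qed.

Lemma Rintegral_big_sum (I : Type) (r : seq I) U (F : I -> plane R -> R) : open U ->
  (forall i, lam2.-integrable U (EFin \o F i)) ->
  \int[lam2]_(p in U) (\sum_(i <- r) F i p) = \sum_(i <- r) \int[lam2]_(p in U) F i p.
Proof.
move=> oU iF.
have mU : measurable (U : set (measurableTypeR R * measurableTypeR R)).
  exact: (open_measurable_plane oU).
(* Integrability of the partial sums is carried through the induction, as additivity of the integral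
   requires it. *)
suff [] : lam2.-integrable U (EFin \o (fun p => \sum_(i <- r) F i p)) /\
  \int[lam2]_(p in U) (\sum_(i <- r) F i p) = \sum_(i <- r) \int[lam2]_(p in U) F i p by [].
elim: r => [|i r [ir er]].
  have -> : (fun q => \sum_(i <- [::]) F i q) = cst 0 by apply/funext => q; rewrite big_nil.
  rewrite big_nil; split; first exact: integrable0.
  by rewrite /Rintegral integral0.
have -> : (fun q => \sum_(j <- i :: r) F j q) = (fun q => F i q + \sum_(j <- r) F j q).
  by apply/funext => q; rewrite big_cons.
split; last by rewrite RintegralD// ?er ?big_cons.
have := integrableD mU (iF i) ir.
by apply: eq_integrable.
Qed.

Lemma Rintegral_restrict_support U W g : W `<=` U ->
  (forall p, U p -> ~ W p -> g p = 0) ->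
  \int[lam2]_(p in U) g p = \int[lam2]_(p in W) g p.
Proof.
move=> WU gW; rewrite Rintegral_mkcond [RHS]Rintegral_mkcond.
congr (Rintegral _ _ _); apply/funext => p; rewrite !patchE.
case: (boolP (p \in W)) => [/set_mem Wp|nWp]; first by rewrite (mem_set (WU _ Wp)).
case: ifPn => [/set_mem Up|_]; last by [].
by apply: gW => // /mem_set Wp; rewrite Wp in nWp.
Qed.

End C1Algebra.

(** * Stokes' theorem with a partition of unity *)

Section Energy.
Context (R : realType) (M : topologicalType) (A : oriented_atlas R M).
Local Notation C := (R[i]).
Local Notation lam := (@lebesgue_measure R).
Local Notation lam2 := (lam \x lam)%E.
Implicit Types (p q : plane R).
Hypothesis M_compact : compact [set: M].
Variables (f : M -> SL2t R) (alpha : chart A -> plane R -> R).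
Variables (psi1 psi2 : chart A -> plane R -> C) (H : M -> R).
Hypothesis f_immersion : conformal_immersion f alpha.
Hypothesis psi_spinor : generating_spinor f psi1 psi2.
Hypothesis H_mean : mean_curvature alpha psi1 psi2 H.
Variables (K : finType) (P : partition_of_unity A K).

Let ch := pu_chart P.
Let rho := pu_fun P.
Let oimg (i : chart A) : open (img i) := @img_open _ _ A i.
Let Z i p := spinor_product psi1 psi2 i p.
Let fl i r p := flux psi1 psi2 i r p.
Let pull (i : chart A) (r : M -> R) p := r (iparam i p).

(** The support of [rho k] in its own chart, compact as the continuous image of a closed subset of
    [M]. *)
Let S k : set (plane R) := param (ch k) @` closure [set m | rho k m != 0].

Let compact_S k : compact (S k).
Proof.
apply: continuous_compact.
  apply: (continuous_subspaceW (pu_support (p := P) (k := k))).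
  exact: param_continuous.
exact: (subclosed_compact (@closed_closure _ _) M_compact).
Qed.

Let S_img k : S k `<=` img (ch k).
Proof. by move=> _ [m mk <-]; exists m => //; exact: (pu_support mk). Qed.

Let rho_out k p : img (ch k) p -> ~ S k p -> pull (ch k) (rho k) p = 0.
Proof.
move=> ip nS; apply/eqP/negPn/negP => nz; apply: nS.
have [_ pE] := img_iparam ip.
by exists (iparam (ch k) p); first exact: subset_closure.
Qed.

(** In a chart other than its own the support of [rho k] may reach the edge of the image; what
    remains is vanishing off the overlap. *)
Let rho_out_dom k i p : img i p -> ~ dom (ch k) (iparam i p) -> pull i (rho k) p = 0.
Proof.
move=> ip nd; apply/eqP/negPn/negP => nz; apply: nd.
exact/(pu_support (p := P) (k := k))/subset_closure.
Qed.

Let C1_rho k i : C1_on (img i) (pull i (rho k)).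
Proof. apply: smooth_on_C1; exact: (@pu_smooth _ _ _ _ P k i). Qed.

Let C1_Z i : C1_on (img i) (fun p => complex.Re (Z i p)) /\
  C1_on (img i) (fun p => complex.Im (Z i p)).
Proof.
have [[a1 a2] [b1 b2] _] := psi_spinor i.
have oi := @oimg i.
have [ca1 ca2] := (smooth_on_C1 a1, smooth_on_C1 a2).
have [cb1 cb2] := (smooth_on_C1 b1, smooth_on_C1 b2).
split.
  have -> : (fun p => complex.Re (Z i p)) = (fun p =>
      complex.Re (psi1 i p) * complex.Re (psi2 i p) +
      complex.Im (psi1 i p) * complex.Im (psi2 i p)).
    apply/funext => p; rewrite /Z /spinor_product; case: (psi1 i p) (psi2 i p) => ? ? [? ?] /=.
    by rewrite mulrN opprK.
  by apply: (C1_onD oi); apply: (C1_onM oi).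
have -> : (fun p => complex.Im (Z i p)) = (fun p =>
    complex.Im (psi1 i p) * complex.Re (psi2 i p) +
    - (complex.Re (psi1 i p) * complex.Im (psi2 i p))).
  apply/funext => p; rewrite /Z /spinor_product; case: (psi1 i p) (psi2 i p) => ? ? [? ?] /=.
  by rewrite mulrN addrC.
apply: (C1_onD oi); first exact: (C1_onM oi).
by apply: (C1_onN oi); exact: (C1_onM oi).
Qed.

Let divZ i p : R := 'D_vx (fun q => complex.Re (Z i q)) p - 'D_vy (fun q => complex.Im (Z i q)) p.

Let divZE i p : img i p ->
  divZ i p = H (iparam i p) * (absq (psi2 i p) ^+ 2 - absq (psi1 i p) ^+ 2).
Proof.
move=> ip; apply: (@mean_curvature_divergence R (psi1 i) (psi2 i) (alpha i p)).
exact: (H_mean 2 ip).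
Qed.

Let fl_continuous i k p : img i p -> {for p, continuous (fl i (rho k))}.
Proof.
move=> ip; have [cz1 cz2] := C1_Z i; have cr := @C1_rho k i.
exact: (cvgB (cvgM (C1_continuousx cr ip) (C1_continuous cz1 ip))
             (cvgM (C1_continuousy cr ip) (C1_continuous cz2 ip))).
Qed.

Let fl_out k p : img (ch k) p -> ~ S k p -> fl (ch k) (rho k) p = 0.
Proof.
move=> ip nS; have z v := derive_near0 v (@oimg (ch k)) (@compact_S k) (@rho_out k) ip nS.
by rewrite /fl /flux (z vx) (z vy) !mul0r subrr.
Qed.

(** Such a point has a neighbourhood avoiding the closed support of [rho k], so the derivatives
    vanish along with the function. *)
Let fl_out_dom k i p : img i p -> ~ dom (ch k) (iparam i p) -> fl i (rho k) p = 0.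
Proof.
move=> ip nd.
pose O := [set q | img i q /\ (~` closure [set m | rho k m != 0]) (iparam i q)].
have oO : open O by apply: open_img_preimage; apply: closed_openC; exact: closed_closure.
have Op : O p by split => // /(pu_support (p := P) (k := k)).
have z v : 'D_v (pull i (rho k)) p = 0.
  transitivity ('D_v (cst (0 : R)) p); last exact: derive_cst.
  apply: near_eq_derive.
  have h : \forall q \near p, O q by apply: open_nbhs_nbhs.
  apply: filterS h => q [_ nq]; apply/eqP/negPn/negP => nz; apply: nq.
  exact: subset_closure.
by rewrite /fl /flux (z vx) (z vy) !mul0r subrr.
Qed.

(** Product rule: rho div W = div (rho W) - flux, and the divergence of a compactly supported field
    integrates to 0. Integrability of the left-hand side comes from the terms on the right. *)
Let integral_rho_div k :
  lam2.-integrable (img (ch k)) (EFin \o (fun p => pull (ch k) (rho k) p * divZ (ch k) p)) /\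
  \int[lam2]_(p in img (ch k)) (pull (ch k) (rho k) p * divZ (ch k) p) =
  - \int[lam2]_(p in img (ch k)) fl (ch k) (rho k) p.
Proof.
set i := ch k; have oi := @oimg i; have [cz1 cz2] := C1_Z i; have cr := @C1_rho k i.
have c1 := C1_onM oi cr cz1; have c2 := C1_onM oi cr cz2.
set g1 := (fun p => pull i (rho k) p * complex.Re (Z i p)) in c1.
set g2 := (fun p => pull i (rho k) p * complex.Im (Z i p)) in c2.
have o1 p : img i p -> ~ S k p -> g1 p = 0 by move=> ip nS; rewrite /g1 rho_out ?mul0r.
have o2 p : img i p -> ~ S k p -> g2 p = 0 by move=> ip nS; rewrite /g2 rho_out ?mul0r.
have [e1 _] := integral_divergence_eq0 oi (@compact_S k) (@S_img k) c1 o1.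
have [_ e2] := integral_divergence_eq0 oi (@compact_S k) (@S_img k) c2 o2.
have i1 : lam2.-integrable (img i) (EFin \o 'D_vx g1).
  apply: (integrable_on_compact oi (@compact_S k) (@S_img k)) => p ip.
    exact: (C1_continuousx c1 ip).
  exact: (derive_near0 vx oi (@compact_S k) o1 ip).
have i2 : lam2.-integrable (img i) (EFin \o 'D_vy g2).
  apply: (integrable_on_compact oi (@compact_S k) (@S_img k)) => p ip.
    exact: (C1_continuousy c2 ip).
  exact: (derive_near0 vy oi (@compact_S k) o2 ip).
have i3 : lam2.-integrable (img i) (EFin \o fl i (rho k)).
  apply: (integrable_on_compact oi (@compact_S k) (@S_img k)) => p ip; first exact: fl_continuous.
  exact: fl_out.
have mi : measurable (img i : set (measurableTypeR R * measurableTypeR R)).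
  exact: (open_measurable_plane oi).
have pE p : img i p -> pull i (rho k) p * divZ i p = 'D_vx g1 p - 'D_vy g2 p - fl i (rho k) p.
  move=> ip; rewrite /fl /flux /divZ -/(pull i (rho k)).
  rewrite (derive_mul (C1_derivablex cr ip) (C1_derivablex cz1 ip)).
  rewrite (derive_mul (C1_derivabley cr ip) (C1_derivabley cz2 ip)).
  move: ('D_vx (pull i (rho k)) p) ('D_vy (pull i (rho k)) p) => a b.
  move: ('D_vx (fun q => complex.Re (Z i q)) p) ('D_vy (fun q => complex.Im (Z i q)) p) => c d.
  by rewrite -/(Z i p); ring.
have i12 : lam2.-integrable (img i) (EFin \o (fun p => 'D_vx g1 p - 'D_vy g2 p)).
  by have := integrableB mi i1 i2; apply: eq_integrable.
split.
  have := integrableB mi i12 i3; apply: eq_integrable => // p /set_mem ip.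
  by rewrite /comp (pE p ip).
transitivity (\int[lam2]_(p in img i) ('D_vx g1 p - 'D_vy g2 p - fl i (rho k) p)).
  by apply: eq_Rintegral => p /set_mem ip; exact: pE.
by rewrite (RintegralB mi i12 i3) (RintegralB mi i1 i2) e1 e2 subrr sub0r.
Qed.

(** In the chart of [rho k] the compact support comes from the flux; in that of [rho j], treated
    next, it comes from the factor [rho j]. *)
Let integrable_rho_fl_l k j :
  lam2.-integrable (img (ch k)) (EFin \o (fun p => pull (ch k) (rho j) p * fl (ch k) (rho k) p)).
Proof.
apply: (integrable_on_compact (@oimg (ch k)) (@compact_S k) (@S_img k)) => p ip.
  exact: (cvgM (C1_continuous (@C1_rho j (ch k)) ip) (@fl_continuous (ch k) k p ip)).
by move=> nS; rewrite fl_out ?mulr0.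
Qed.

Let integrable_rho_fl_r k j :
  lam2.-integrable (img (ch j)) (EFin \o (fun p => pull (ch j) (rho j) p * fl (ch j) (rho k) p)).
Proof.
apply: (integrable_on_compact (@oimg (ch j)) (@compact_S j) (@S_img j)) => p ip.
  exact: (cvgM (C1_continuous (@C1_rho j (ch j)) ip) (@fl_continuous (ch j) k p ip)).
by move=> nS; rewrite rho_out ?mul0r.
Qed.

(** Both integrals live on the overlap: on the left [rho j] vanishes outside its chart, on the right
    the flux of [rho k] does. *)
Let integral_rho_fl k j :
  \int[lam2]_(p in img (ch k)) (pull (ch k) (rho j) p * fl (ch k) (rho k) p) =
  \int[lam2]_(p in img (ch j)) (pull (ch j) (rho j) p * fl (ch j) (rho k) p).
Proof.
pose V := overlap (ch k) (ch j); pose W := overlap (ch j) (ch k).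
have D : C1_diffeo V W _ _ _ _ := diffeo_transition (ch k) (ch j).
pose G q := pull (ch j) (rho j) q * fl (ch j) (rho k) q.
transitivity (\int[lam2]_(p in V) (pull (ch k) (rho j) p * fl (ch k) (rho k) p)).
  apply: Rintegral_restrict_support => [p /overlapP[]//|p ip nV].
  rewrite rho_out_dom ?mul0r// => jm; apply: nV; exact/overlapP.
transitivity (\int[lam2]_(q in W) G q); last first.
  apply/esym; apply: Rintegral_restrict_support => [p /overlapP[]//|p ip nW].
  rewrite /G fl_out_dom ?mulr0// => km; apply: nW; exact/overlapP.
have mG : measurable_fun W G.
  apply: (continuous_measurable_plane (diffeo_openW D)) => q /overlapP[jq _].
  exact: (cvgM (C1_continuous (@C1_rho j (ch j)) jq) (@fl_continuous (ch j) k q jq)).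
rewrite (Rintegral_change_of_variables D mG); apply: eq_Rintegral => p /set_mem Vp.
rewrite -surjective_pairing /G /pull (iparam_transition Vp) -mulrA; congr (_ * _).
exact: (flux_transition f_immersion psi_spinor Vp (@C1_rho k (ch j))).
Qed.

Let sum_fl_eq0 i p : img i p -> \sum_k fl i (rho k) p = 0.
Proof.
move=> ip; rewrite sumrB -!mulr_suml.
have z v : (forall k, derivable (pull i (rho k)) p v) -> \sum_k 'D_v (pull i (rho k)) p = 0.
  move=> dr; have [_ <-] := derive_big_sum (index_enum K) dr.
  transitivity ('D_v (cst (1 : R)) p); last exact: derive_cst.
  by congr ('D_v _ p); apply/funext => q; exact: pu_sum1.
rewrite (z vx) ?(z vy) ?mul0r ?subrr// => k.
  exact: (C1_derivabley (@C1_rho k i) ip).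
exact: (C1_derivablex (@C1_rho k i) ip).
Qed.

Let sum_integral_fl : \sum_k \int[lam2]_(p in img (ch k)) fl (ch k) (rho k) p = 0.
Proof.
transitivity (\sum_k \sum_j
    \int[lam2]_(p in img (ch k)) (pull (ch k) (rho j) p * fl (ch k) (rho k) p)).
  apply: eq_bigr => k _; rewrite -Rintegral_big_sum//.
  apply: eq_Rintegral => p _; rewrite -mulr_suml.
  by rewrite [X in X * _](_ : _ = 1) ?mul1r//; exact: pu_sum1.
transitivity (\sum_k \sum_j
    \int[lam2]_(p in img (ch j)) (pull (ch j) (rho j) p * fl (ch j) (rho k) p)).
  by apply: eq_bigr => k _; apply: eq_bigr => j _; exact: integral_rho_fl.
(* After the exchange the sum over [k] is taken in the single chart of [rho j], where it vanishes
   pointwise. *)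
rewrite exchange_big /= big1// => j _; rewrite -Rintegral_big_sum//.
transitivity (\int[lam2]_(p in img (ch j)) (cst (0 : R)) p).
  by apply: eq_Rintegral => p /set_mem ip; rewrite -mulr_sumr sum_fl_eq0// mulr0.
by rewrite /Rintegral integral0.
Qed.

(** The common real part carries the factor 1/2, and the imaginary parts add up with coefficient 1/2
    + 3/4 = 5/4; hence 5/8. *)
Lemma Im_potentials (h : R) (z1 z2 : C) :
  complex.Im (potential_U h z1 z2 * potential_V h z1 z2) =
  - (5 / 8) * (h * (absq z2 ^+ 2 - absq z1 ^+ 2)).
Proof.
rewrite /potential_U /potential_V; move: (absq z1) (absq z2) => a b /=.
by field.
Qed.

Lemma Re_potentials (h : R) (z1 z2 : C) :
  complex.Re (potential_U h z1 z2 * potential_V h z1 z2) =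
  h ^+ 2 / 4 * (absq z1 + absq z2) ^+ 2 -
  (1 / 2 * absq z1 - 3 / 4 * absq z2) * (3 / 4 * absq z1 - 1 / 2 * absq z2).
Proof.
rewrite /potential_U /potential_V; move: (absq z1) (absq z2) => a b /=.
by field.
Qed.

Lemma form_integral_Im_potentials : form_integral P (fun i p => complex.Im
  (potential_U (H (iparam i p)) (psi1 i p) (psi2 i p) *
   potential_V (H (iparam i p)) (psi1 i p) (psi2 i p))) = 0.
Proof.
transitivity (\sum_k (- (5 / 8) *
    - \int[lam2]_(p in img (ch k)) fl (ch k) (rho k) p)); last first.
  by rewrite -mulr_sumr sumrN sum_integral_fl oppr0 mulr0.
apply: eq_bigr => k _; have [ik <-] := integral_rho_div k.
have mi : measurable (img (ch k) : set (measurableTypeR R * measurableTypeR R)).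
  exact: (open_measurable_plane (@oimg (ch k))).
rewrite -(RintegralZl _ mi ik); apply: eq_Rintegral => p /set_mem ip.
by rewrite Im_potentials (divZE ip) mulrCA.
Qed.

End Energy.

Theorem proposition6 (R : realType) (M : topologicalType)
    (M_hausdorff : hausdorff_space M) (M_compact : compact [set: M])
    (A : oriented_atlas R M) (f : M -> SL2t R)
    (alpha : chart A -> plane R -> R)
    (psi1 psi2 : chart A -> plane R -> R[i]) (H : M -> R)
    (f_immersion : conformal_immersion f alpha)
    (psi_spinor : generating_spinor f psi1 psi2)
    (H_mean : mean_curvature alpha psi1 psi2 H)
    (K : finType) (P : partition_of_unity A K) :
  complex.Im (energy P H psi1 psi2) = 0 /\
  energy P H psi1 psi2 =
    (form_integral P (fun i p =>
       H (iparam i p) ^+ 2 / 4 * (absq (psi1 i p) + absq (psi2 i p)) ^+ 2 -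
       (1 / 2 * absq (psi1 i p) - 3 / 4 * absq (psi2 i p)) *
       (3 / 4 * absq (psi1 i p) - 1 / 2 * absq (psi2 i p))))%:C.
Proof.
have Im0 := form_integral_Im_potentials M_compact f_immersion psi_spinor H_mean P.
split; first exact: Im0.
rewrite /energy /cform_integral Im0; congr (_ +i* _).
apply: eq_bigr => k _; apply: eq_Rintegral => p _.
by rewrite Re_potentials.
Qed.
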